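(* Let $N\ge2$ be an integer, $\beta\in[0,1)$, and let $F:\mathbb R\to\mathbb R$ satisfy conditions (F1)--(F4) listed in the context. Let $d_{nvl}(N,\beta,F)$ be the normalized vanishing limit defined in the context. Then $$d_{nvl}(N,\beta,F)=\begin{cases}0&\text{if }\beta\in(0,1),\\ C(F)&\text{if }\beta=0.\end{cases}$$
   Context: Notation: $\omega_{N-1}$ is the surface area of the unit sphere in $\mathbb R^N$, $\alpha_N=N\omega_{N-1}^{1/(N-1)}$, $\alpha_{\beta,N}=(1-\beta)\alpha_N$, $\Phi_N(t)=e^t-\sum_{k=0}^{N-2}\frac{t^k}{k!}$, $B_R$ is the open ball of radius $R$ centered at the origin in $\mathbb R^N$, and $\|\cdot\|_p$ is the $L^p(\mathbb R^N)$ norm. Conditions on $F$: (F1) $F\in C^1(\mathbb R)$. (F2) $F$ is strictly increasing on $\mathbb R_+$ and $F(-t)=F(t)$ for $t\in\mathbb R$. (F3) $0\le F(t)\le\Phi_N(\alpha_{\beta,N}|t|^{\frac N{N-1}})$ for all $t\in\mathbb R$. (F4) The limits $\lim_{t\to\infty}e^{-\alpha_{\beta,N}t^{N/(N-1)}}F(t)$ and $C(F)=\lim_{t\to0}|t|^{-N}F(t)$ exist. If the first limit in (F4) is nonzero, $F$ is normalized so that this limit equals $1$. A sequence $\{u_n\}\subset W^{1,N}(\mathbb R^N)$ is a radially symmetric normalized vanishing sequence (RNVS) if every $u_n$ is radially symmetric, $\|\nabla u_n\|_N^N+\|u_n\|_N^N=1$ for all $n$, $u_n\rightharpoonup0$ weakly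 in $W^{1,N}(\mathbb R^N)$, and $\lim_{n\to\infty}\int_{B_R}|x|^{-N\beta}F(u_n)\,dx=0$ for every $R>0$. The normalized vanishing limit is $$d_{nvl}(N,\beta,F)=\sup_{\{u_n\}\,:\,\text{(RNVS)}}\ \limsup_{n\to\infty}\int_{\mathbb R^N}|x|^{-N\beta}F(u_n)\,dx.$$ *)

(* Defs.v *)
From HB Require Import structures.
From mathcomp Require Import all_boot all_order all_algebra.
From mathcomp Require Import all_classical all_reals all_analysis.

Set Implicit Arguments.
Unset Strict Implicit.
Unset Printing Implicit Defensive.

Import Order.TTheory GRing.Theory Num.Theory.
Import numFieldNormedType.Exports.

Local Open Scope classical_set_scope.
Local Open Scope ring_scope.

(* 'rV[R]_n carries the sigma-algebra generated by the n coordinates, which is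
   the Borel sigma-algebra. *)
Section measurable_rV.
Variables (R : realType) (n : nat).

Let coord (i : 'I_n) (x : 'rV[R]_n) : R := x ord0 i.

Let rV_set0 : g_sigma_preimage coord set0.
Proof. exact: sigma_algebra0. Qed.

Let rV_setC A : g_sigma_preimage coord A -> g_sigma_preimage coord (~` A).
Proof. exact: sigma_algebraC. Qed.

Let rV_bigcup (F : _^nat) : (forall i, g_sigma_preimage coord (F i)) ->
  g_sigma_preimage coord (\bigcup_i (F i)).
Proof. exact: sigma_algebra_bigcup. Qed.

HB.instance Definition _ := @isMeasurable.Build default_measure_display
  'rV[R]_n (g_sigma_preimage coord) rV_set0 rV_setC rV_bigcup.

Lemma measurable_coord (i : 'I_n) :
  measurable_fun [set: 'rV[R]_n] (fun x : 'rV[R]_n => x ord0 i).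
Proof.
move=> _ Y mY; rewrite setTI; apply: sub_sigma_algebra => /=.
rewrite -bigcup_seq/=; exists i => /=; first by rewrite mem_index_enum.
by exists Y => //; rewrite setTI.
Qed.

Lemma measurable_fun_rV d (T : measurableType d) (f : T -> 'rV[R]_n) :
  (forall i, measurable_fun [set: T] (fun t => f t ord0 i)) ->
  measurable_fun [set: T] f.
Proof.
move=> mf; apply: (measurability (\big[setU/set0]_(i < n)
  preimage_set_system setT (coord i) measurable)) => //.
move=> _ [B + <-]; rewrite -bigcup_seq => -[i _ [A mA <-]].
by rewrite setTI -comp_preimage; exact: mf.
Qed.

End measurable_rV.

Section lebesgue_rV.
Variable R : realType.

Definition rV_cons n (p : measurableTypeR R * 'rV[R]_n) : 'rV[R]_n.+1 :=
  \row_(i < n.+1) if unlift ord0 i is Some j then p.2 ord0 j else p.1.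

Lemma measurable_rV_cons n :
  measurable_fun [set: measurableTypeR R * 'rV[R]_n] (@rV_cons n).
Proof.
apply: measurable_fun_rV => i; rewrite /rV_cons.
case: (unliftP ord0 i) => [j|] ->.
  under eq_fun do rewrite mxE liftK.
  exact: (measurableT_comp (measurable_coord j) measurable_snd).
under eq_fun do rewrite mxE unlift_none.
exact: measurable_fst.
Qed.

Section succ.
Variables (n : nat) (mu : {sigma_finite_measure set 'rV[R]_n -> \bar R}).

Definition lebesgue_succ : set 'rV[R]_n.+1 -> \bar R :=
  pushforward (lebesgue_measure \x mu)%E (@rV_cons n).

HB.instance Definition _ := Measure.copy lebesgue_succ
  (measure_function_pushforward__canonical__measure_function_Measure
    (lebesgue_measure \x mu)%E (@measurable_rV_cons n)).

Let lebesgue_succ_sigma_finite : sigma_finite setT lebesgue_succ.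
Proof.
pose uncons (x : 'rV[R]_n.+1) : measurableTypeR R * 'rV[R]_n :=
  (x ord0 ord0, \row_j x ord0 (lift ord0 j)).
have muncons : measurable_fun setT uncons.
  apply/measurable_fun_pairP; split; first exact: measurable_coord.
  apply: measurable_fun_rV => j /=; under eq_fun do rewrite mxE.
  exact: measurable_coord.
have consK : cancel (@rV_cons n) uncons.
  move=> [a v]; congr pair; first by rewrite mxE unlift_none.
  by apply/rowP => j; rewrite !mxE liftK.
have /sigma_finiteP[A [TA ndA Aoo]] :=
  sigma_finiteT (lebesgue_measure : {sigma_finite_measure set _ -> \bar R}).
have /sigma_finiteP[B [TB ndB Boo]] := sigma_finiteT mu.
exists (fun k => uncons @^-1` (A k `*` B k)) => [|k].
  rewrite -preimage_bigcup; apply/esym/seteqP; split => // x _.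
  have [i _ Ai] : (\bigcup_i A i) (uncons x).1 by rewrite -TA.
  have [j _ Bj] : (\bigcup_i B i) (uncons x).2 by rewrite -TB.
  exists (maxn i j) => //; split.
    by move: Ai; exact/subsetPset/ndA/leq_maxl.
  by move: Bj; exact/subsetPset/ndB/leq_maxr.
have [[mA fA] [mB fB]] := (Aoo k, Boo k).
split.
  by rewrite -[X in measurable X]setTI; apply: muncons => //; exact: measurableX.
rewrite /lebesgue_succ /pushforward -comp_preimage (_ : uncons \o _ = id).
  by rewrite preimage_id product_measure1E// lte_mul_pinfty// ge0_fin_numE.
by rewrite funeqE.
Qed.

HB.instance Definition _ := @Measure_isSigmaFinite.Build _ _ _ lebesgue_succ
  lebesgue_succ_sigma_finite.

End succ.

Fixpoint lebesgue_rV n : {sigma_finite_measure set 'rV[R]_n -> \bar R} :=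
  if n is m.+1 then lebesgue_succ (lebesgue_rV m) else \d_ (0 : 'rV[R]_0).

Lemma lebesgue_rV_box n (A : 'I_n -> set R) : (forall i, measurable (A i)) ->
  lebesgue_rV n [set x | forall i, A i (x ord0 i)] =
  (\prod_(i < n) lebesgue_measure (A i))%E.
Proof.
elim: n A => [|n ih] A mA /=.
  rewrite big_ord0 diracE mem_set//.
  by move=> [].
rewrite big_ord_recl -ih//= /lebesgue_succ /pushforward.
pose B : set 'rV[R]_n := [set v | forall i, A (lift ord0 i) (v ord0 i)].
have mB : measurable B.
  rewrite (_ : B = \bigcap_(i in [set: 'I_n])
      ((fun x : 'rV[R]_n => x ord0 i) @^-1` A (lift ord0 i))).
    apply: fin_bigcap_measurable => // i _.
    by rewrite -[X in measurable X]setTI; exact: measurable_coord.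
  by apply/seteqP; split => x /= h i; [move=> _; exact: h|exact: h].
rewrite -[X in (_ * lebesgue_rV n X)%E]/B -product_measure1E//; last exact: mA.
rewrite -[X in product_measure1 _ _ X]/(@rV_cons n @^-1` [set x | _]).
suff -> : @rV_cons n @^-1` [set x | forall i, A i (x ord0 i)] = A ord0 `*` B.
  by [].
apply/seteqP; split => -[a v] /=.
  move=> H; split; first by have := H ord0; rewrite mxE unlift_none.
  by move=> i; have := H (lift ord0 i); rewrite mxE liftK.
by move=> [Aa Av] i; rewrite mxE; case: (unliftP ord0 i) => [j|] ->.
Qed.

End lebesgue_rV.

Arguments lebesgue_rV {R} n.

Section euclidean.
Variables (R : realType) (n : nat).
Implicit Types (x : 'rV[R]_n) (A : set 'rV[R]_n).

(* The library norm `|x| on 'rV[R]_n is the sup norm. *)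
Definition enorm x : R := Num.sqrt (\sum_(i < n) x ord0 i ^+ 2).

Definition eball (r : R) : set 'rV[R]_n := [set x | enorm x < r].

Definition esphere : set 'rV[R]_n := [set x | enorm x = 1].

(* Surface measure of a subset of the unit sphere: n times the Lebesgue measure
   of the cone {r *: y | 0 < r < 1, y in A}. *)
Definition surface_measure A : \bar R :=
  (n%:R%:E * lebesgue_rV n
    [set x | (0 < enorm x < 1)%R /\ A ((enorm x)^-1 *: x)])%E.

End euclidean.

Arguments eball {R n}.
Arguments esphere {R n}.

Definition sphere_area (R : realType) (n : nat) : R :=
  fine (surface_measure (@esphere R n)).

Section sobolev.
Variables (R : realType) (n : nat).
Local Notation leb := (@lebesgue_rV R n).
Implicit Types (u phi : 'rV[R]_n -> R) (g : 'rV[R]_n -> 'rV[R]_n) (p : R).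

Definition partial (i : 'I_n) phi : 'rV[R]_n -> R :=
  fun x => 'D_(delta_mx ord0 i) phi x.

Definition iter_partial (s : seq 'I_n) phi := foldr partial phi s.

Definition smooth phi := forall s : seq 'I_n,
  continuous (iter_partial s phi) /\
  forall i x, derivable (iter_partial s phi) x (delta_mx ord0 i).

Definition test_function phi :=
  smooth phi /\ compact (closure [set x | phi x != 0]).

Definition in_Lp p u := u \in Lfun leb p%:E.

(* Components in L^p(R^n) make both integrals below absolutely convergent when
   u is in L^p(R^n) and p >= 1. *)
Definition is_weak_gradient p u g :=
  forall i, in_Lp p (fun x => g x ord0 i) /\
    forall phi, test_function phi ->
      \int[leb]_x (u x * partial i phi x) = - \int[leb]_x (g x ord0 i * phi x).

(* Elements of W^{1,p}(R^n) are represented by functions, not by classes modulo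
   equality almost everywhere. *)
Definition W1 p u := in_Lp p u /\ exists g, is_weak_gradient p u g.

(* Weak gradients are unique up to almost everywhere equality. *)
Definition weak_gradient p u : 'rV[R]_n -> 'rV[R]_n :=
  xget (cst 0) [set g | is_weak_gradient p u g].

Definition W1_energy p u : \bar R :=
  ('N[leb]_p%:E[EFin \o (@enorm R n \o weak_gradient p u)] `^ p +
   'N[leb]_p%:E[EFin \o u] `^ p)%E.

Definition W1_norm p u : \bar R := (W1_energy p u `^ p^-1)%E.

(* Continuous linear functionals on W^{1,p}. The bound forces l to take the same
   value on functions of W^{1,p} that are equal almost everywhere. *)
Definition W1_dual p (l : ('rV[R]_n -> R) -> R) :=
  (forall (a : R) u v, W1 p u -> W1 p v ->
     l (fun x => a * u x + v x) = a * l u + l v) /\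
  exists C : R, forall u, W1 p u -> (`|l u|%:E <= C%:E * W1_norm p u)%E.

Definition W1_weak_cvg p (u_ : nat -> 'rV[R]_n -> R) u :=
  forall l, W1_dual p l -> l (u_ k) @[k --> \oo] --> l u.

Definition radially_symmetric u := exists2 f : R -> R,
  measurable_fun [set: R] f & {ae leb, forall x, u x = f (enorm x)}.

End sobolev.

Section vanishing.
Variables (R : realType) (N : nat) (beta : R) (F : R -> R).

Definition alpha_N : R := N%:R * sphere_area R N `^ (N%:R - 1)^-1.

Definition alpha_beta : R := (1 - beta) * alpha_N.

Definition Phi (t : R) : R := expR t - \sum_(k < N.-1) t ^+ k / k`!%:R.

Definition exp_ratio (t : R) : R :=
  expR (- (alpha_beta * t `^ (N%:R / (N%:R - 1)))) * F t.

Definition power_ratio (t : R) : R := `|t| ^- N * F t.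

Definition C_F : R := lim (power_ratio t @[t --> 0^']).

(* F_normalized is the convention that the limit at infinity, when it is nonzero,
   equals 1. *)
Record F_conditions : Prop := {
  F_C1 : (forall t, derivable F t 1) /\ continuous (derive1 F);
  F_increasing : forall s t, 0 <= s -> s < t -> F s < F t;
  F_even : forall t, F (- t) = F t;
  F_bounds : forall t,
    0 <= F t <= Phi (alpha_beta * `|t| `^ (N%:R / (N%:R - 1)));
  F_cvg_infty : cvg (exp_ratio t @[t --> +oo]);
  F_cvg_0 : cvg (power_ratio t @[t --> 0^']);
  F_normalized : lim (exp_ratio t @[t --> +oo]) != 0 ->
    lim (exp_ratio t @[t --> +oo]) = 1 }.

(* For beta > 0 the weight takes the value 0 at x = 0, because 0 `^ r = 0 for
   r != 0; this concerns a null set only. *)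
Definition F_integral (D : set 'rV[R]_N) (u : 'rV[R]_N -> R) : \bar R :=
  (\int[lebesgue_rV N]_(x in D)
     (enorm x `^ (- (N%:R * beta)) * F (u x))%:E)%E.

(* RNVS: radially symmetric normalized vanishing sequences *)
Record RNVS (u_ : nat -> 'rV[R]_N -> R) : Prop := {
  RNVS_W1 : forall n, W1 N%:R (u_ n);
  RNVS_radial : forall n, radially_symmetric (u_ n);
  RNVS_normalized : forall n, W1_energy N%:R (u_ n) = 1%E;
  RNVS_weak_cvg : W1_weak_cvg N%:R u_ (cst 0);
  RNVS_vanishing : forall r, 0 < r ->
    F_integral (eball r) (u_ n) @[n --> \oo] --> 0%E }.

Definition d_nvl : \bar R :=
  ereal_sup [set limn_esup (fun n => F_integral setT (u_ n)) | u_ in RNVS].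

End vanishing.

(* Main.v *)
(* Upper bound: a radial function of unit norm is uniformly small far away. In the
   variable t = vol(B_{|x|}) its profile f satisfies \int |f|^N <= 1, and testing the
   weak gradient against the fields psi(t) x / |x|^N, whose divergence is a multiple
   of psi'(t), bounds the oscillation of f between two Lebesgue points far out; since
   f takes small values on every interval of fixed large length, f is small there.
   So F(u_n) <= (C(F) + e) |u_n|^N outside a large ball, uniformly in n, where the
   weight is also small if beta > 0; inside the ball the integral tends to 0 by
   assumption.

   Lower bound: dilate a bump supported in the annulus 1 <= |x| <= 2 by the factors
   4^k and normalise. Dilation preserves the N-th power integral of the gradient and
   multiplies that of the function by 4^(kN), so the latter tends to 1 after
   normalisation, while the supremum tends to 0. The supports are disjoint, which
   forces weak convergence to 0. *)

From HB Require Import structures.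
Require Import Defs.
From mathcomp Require Import all_boot all_order all_algebra.
From mathcomp Require Import all_classical all_reals all_analysis.
From mathcomp Require Import measurable_realfun.
From mathcomp Require Import ring lra.
Import Order.TTheory GRing.Theory Num.Theory.
Import numFieldNormedType.Exports.
Local Open Scope classical_set_scope.
Local Open Scope ring_scope.

Set Implicit Arguments.
Unset Strict Implicit.
Unset Printing Implicit Defensive.


(** * Smooth functions and cut-offs *)

(** A weak gradient is known only through its pairing with test functions, and a radial function
    only up to a null set. The decay is therefore not obtained by differentiating the profile: the
    test fields are built so that the pairing returns the difference of two values of the profile,
    up to an error that vanishes at Lebesgue points. The field x / |x|^N is divergence free away
    from 0, so only the derivative of psi survives in the divergence; its size |x|^(1-N) is at most
    1 / L where |x| >= L >= 1, because N >= 2. The order of choices matters: the required smallness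
    fixes the length of the interval that must contain a small value, and L is then taken large
    compared with this length.

    The energy is defined through a chosen weak gradient, so its value on an explicit function is
    accessible only after weak gradients are known to be unique almost everywhere. In the lower
    bound the factor 4 exceeds the ratio 2 of the radii of the annulus, which separates consecutive
    dilates. *)

Lemma scaleRE {R : realType} (a b : R) : a *: b = a * b.
Proof. by []. Qed.

Section directional.
Context {R : realType} {V : normedModType R}.
Implicit Types (f g : V -> R) (x v : V).

(** Restriction to the line through [x] carries the one-variable chain rule over to directional
    derivatives. *)
Lemma is_derive_line f x v d :
  is_derive x v f d <-> is_derive (0 : R) 1 (fun t : R => f (t *: v + x)) d.
Proof.
have E : 'D_v f x = 'D_1 (fun t : R => f (t *: v + x)) 0.
  rewrite /derive; set g1 := fun h => h^-1 *: _; set g2 := fun h => h^-1 *: _.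
  suff -> : g1 = g2 by [].
  by rewrite funeqE /g1 /g2 => h /=; rewrite addr0 scale0r add0r [_%:A]mulr1.
have [E1 E2] := derivable1P f x v.
by split=> -[df <-]; split; rewrite ?E//; [exact: E1|exact: E2].
Qed.

Lemma is_derive_compR (h : R -> R) f x v c d :
  is_derive (f x) 1 h c -> is_derive x v f d ->
  is_derive x v (h \o f) (c * d).
Proof.
move=> hc /is_derive_line fd; apply/is_derive_line.
apply: (@is_derive1_comp _ h (fun t : R => f (t *: v + x))).
by rewrite scale0r add0r.
Qed.

Lemma is_derive_inv f x v d : f x != 0 -> is_derive x v f d ->
  is_derive x v (fun y => (f y)^-1) (- (d * ((f x)^-1 * (f x)^-1))).
Proof.
move=> fx0 [df <-]; split; first exact: derivableV.
by rewrite deriveV// scaleNr -exprVn expr2 [_ *: _]mulrC.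
Qed.

End directional.

Section Ck.
Context {R : realType} {V : normedModType R} {I : Type} (e : I -> V).

(** The derivatives along the directions [e i] are existential witnesses rather than iterated
    partial derivatives, so each closure property (sum, product, inverse, composition) is a plain
    induction on [n]. With [I = unit] and direction 1 this is C^n on the line; with the basis
    vectors it is C^n on R^n. *)
Fixpoint Ck n (f : V -> R) : Prop := continuous f /\
  (if n is m.+1 then exists g : I -> V -> R, forall i,
     (forall x, is_derive x (e i) f (g i x)) /\ Ck m (g i) else True).

Lemma Ck_continuous n f : Ck n f -> continuous f.
Proof. by case: n => [[]|n []]. Qed.

Lemma CkW n f : Ck n.+1 f -> Ck n f.
Proof.
elim: n f => [f []//|n IH f [cf [g Hg]]]; split => //.
by exists g => i; have [fg Cg] := Hg i; split => //; exact: IH.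
Qed.

Lemma Ck_cst n (c : R) : Ck n (cst c).
Proof.
elim: n c => [|n IH] c; first by split => //; exact: cst_continuous.
split; first exact: cst_continuous.
by exists (fun=> cst 0) => i; split => // x; exact: is_derive_cst.
Qed.

Lemma CkD n f g : Ck n f -> Ck n g -> Ck n (fun x => f x + g x).
Proof.
elim: n f g => [|n IH] f g [cf Hf] [cg Hg].
  by split => // x; apply: continuousD; [exact: cf|exact: cg].
split; first by move=> x; apply: continuousD; [exact: cf|exact: cg].
have [[f' Hf'] [g' Hg']] := (Hf, Hg).
exists (fun i x => f' i x + g' i x) => i.
have [[df Cf] [dg Cg]] := (Hf' i, Hg' i).
by split => [x|]; [exact: is_deriveD|exact: IH].
Qed.

Lemma CkM n f g : Ck n f -> Ck n g -> Ck n (fun x => f x * g x).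
Proof.
elim: n f g => [|n IH] f g Hf Hg; move: (Hf) (Hg) => [cf If] [cg Ig].
  by split => // x; apply: continuousM; [exact: cf|exact: cg].
split; first by move=> x; apply: continuousM; [exact: cf|exact: cg].
have [[f' Hf'] [g' Hg']] := (If, Ig).
exists (fun i x => f x * g' i x + g x * f' i x) => i.
have [[df Cf] [dg Cg]] := (Hf' i, Hg' i).
split => [x|]; first exact: is_deriveM.
by apply: CkD; apply: IH => //; exact: CkW.
Qed.

Lemma Ck_sum n (J : Type) (s : seq J) (F : J -> V -> R) :
  (forall j, Ck n (F j)) -> Ck n (fun x => \sum_(j <- s) F j x).
Proof.
move=> CF; elim: s => [|j s IH].
  by under eq_fun do rewrite big_nil; exact: Ck_cst.
by under eq_fun do rewrite big_cons; apply: CkD.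
Qed.

Lemma Ck_prod n (J : Type) (s : seq J) (F : J -> V -> R) :
  (forall j, Ck n (F j)) -> Ck n (fun x => \prod_(j <- s) F j x).
Proof.
move=> CF; elim: s => [|j s IH].
  by under eq_fun do rewrite big_nil; exact: Ck_cst.
by under eq_fun do rewrite big_cons; apply: CkM.
Qed.

Lemma CkV n f : (forall x, f x != 0) -> Ck n f -> Ck n (fun x => (f x)^-1).
Proof.
elim: n f => [|n IH] f f0 Hf; move: (Hf) => [cf If].
  by split => // x; apply: continuousV => //; exact: cf.
split; first by move=> x; apply: continuousV => //; exact: cf.
have [f' Hf'] := If.
exists (fun i x => (-1) * (f' i x * ((f x)^-1 * (f x)^-1))) => i.
have [df Cf] := Hf' i; split => [x|].
  by rewrite mulN1r; exact: is_derive_inv.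
by apply: CkM; [exact: Ck_cst|apply: CkM => //; apply: CkM; apply: IH => //; exact: CkW].
Qed.

End Ck.

Notation Ck1 R := (@Ck R R unit (fun=> 1)).

Lemma Ck_comp {R : realType} {V : normedModType R} {I : Type} (e : I -> V) n
  (h : R -> R) (f : V -> R) : Ck1 R n h -> Ck e n f -> Ck e n (h \o f).
Proof.
elim: n h f => [|n IH] h f Hh Hf; move: (Hh) (Hf) => [ch Ih] [cf If].
  by split => // x; apply: continuous_comp; [exact: cf|exact: ch].
split; first by move=> x; apply: continuous_comp; [exact: cf|exact: ch].
have [[h' Hh'] [f' Hf']] := (Ih, If).
exists (fun i x => h' tt (f x) * f' i x) => i.
have [[dh C_h] [df Cf]] := (Hh' tt, Hf' i).
split => [x|]; first exact: is_derive_compR.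
by apply: CkM => //; apply: IH => //; exact: CkW.
Qed.

Lemma Ck_id {R : realType} n : Ck1 R n (@id R).
Proof.
case: n => [|n]; first by split => // x; exact: cvg_id.
split; first by move=> x; exact: cvg_id.
exists (fun=> cst 1) => i; split; last exact: Ck_cst.
by move=> x; exact: is_derive_id.
Qed.


(* [flat_exp 0] is the usual flat function exp(-1/t); the factors [t ^- k] make
   the family stable under differentiation. *)
Definition flat_exp {R : realType} k (t : R) : R :=
  if 0 < t then t ^- k * expR (- t^-1) else 0.

Section flat_exp.
Context {R : realType}.
Implicit Type t : R.

Lemma flat_exp_ge0 k t : 0 <= flat_exp k t.
Proof.
rewrite /flat_exp; case: ifPn => // t0.
by rewrite mulr_ge0 ?expR_ge0// invr_ge0 exprn_ge0// ltW.
Qed.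

(** Follows from [exp(1/t) >= t^-(k+1) / (k+1)!] for [t > 0]. A bound linear in [|t|] is what
    differentiability at 0 requires. *)
Lemma flat_exp_le k t : flat_exp k t <= k.+1`!%:R * `|t|.
Proof.
rewrite /flat_exp; case: ifPn => [t0|_]; last by rewrite mulr_ge0.
have k0 : 0 < k.+1`!%:R :> R by rewrite ltr0n fact_gt0.
have := @expR_ge1Dxn R t^-1 k; rewrite invr_ge0 => /(_ (ltW t0)) H.
have {}H : t ^- k.+1 / k.+1`!%:R <= expR t^-1.
  by rewrite -exprVn (le_trans _ H)// lerDr.
rewrite expRN gtr0_norm// ler_pdivrMr ?expR_gt0//.
apply: le_trans (ler_wpM2l _ H); last by rewrite mulr_ge0// ltW.
rewrite le_eqVlt; apply/orP; left; apply/eqP; rewrite exprS.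
by field; rewrite ?expf_neq0 ?gt_eqF.
Qed.

Lemma is_derive_flat_exp k t :
  is_derive t 1 (flat_exp k) (flat_exp k.+2 t - k%:R * flat_exp k.+1 t).
Proof.
have [t0|t0|->] := ltgtP t 0.
- rewrite /flat_exp ltNge (ltW t0)/= mulr0 subr0.
  apply: (@near_eq_is_derive _ _ _ (cst 0)).
  near=> s; rewrite /= ltNge ifF//; apply/negbF; apply: ltW.
  by near: s; exact: lt_nbhsl.
- have -> : flat_exp k.+2 t - k%:R * flat_exp k.+1 t =
      t ^- k *: (expR (- t^-1) * t ^- 2) +
      expR (- t^-1) *: (- (k%:R * t ^+ k.-1 * (t ^- k * t ^- k))).
    rewrite /flat_exp t0 !scaleRE/=; case: k => [|k] /=.
      by rewrite !expr0; field; rewrite ?gt_eqF.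
    rewrite !exprS /=; field; rewrite ?expf_neq0 ?gt_eqF//.
  have dX : is_derive t 1 (fun s : R => s ^+ k) (k%:R * t ^+ k.-1).
    by apply: DeriveDef; [exact: exprn_derivable|rewrite exp_derive scaleRE mulr1].
  have dE : is_derive t 1 ((fun s => (s ^+ k)^-1) * (fun s => expR (- s^-1)))
      (t ^- k *: (expR (- t^-1) * t ^- 2) +
      expR (- t^-1) *: (- (k%:R * t ^+ k.-1 * (t ^- k * t ^- k)))).
    apply: is_deriveM.
      by apply: (is_derive_inv _ dX); rewrite expf_neq0// gt_eqF.
    have dI : is_derive t 1 (fun s : R => s^-1) (- (1 * (t^-1 * t^-1))).
      by apply: (is_derive_inv _ (is_derive_id t 1)); rewrite gt_eqF.
    have := @is_derive1_comp _ expR (fun s => - s^-1) t _ _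
      (is_derive_expR _) (is_deriveN dI).
    by rewrite mul1r opprK -invfM -expr2.
  apply: near_eq_is_derive dE.
  by near=> s; rewrite /flat_exp ifT//; near: s; exact: lt_nbhsr.
(* The difference quotient at [h > 0] is exactly [flat_exp k.+1 h], and the linear bound squeezes it
   to 0. *)
- have E0 j : flat_exp j 0 = 0 :> R by rewrite /flat_exp ltxx.
  rewrite !E0 mulr0 subr0.
  have N : `|h| @[h --> (0:R)^'] --> (0:R).
    rewrite -[X in _ --> X](@normr0 R R).
    by apply: cvg_trans (@norm_continuous _ R 0); apply: cvg_app; exact: cvg_within.
  have H : (fun h : R => h^-1 *: (flat_exp k (h *: 1 + 0) - flat_exp k 0)) @ 0^'
      --> (0:R).
    apply: (@squeeze_cvgr _ _ _ _ (fun h : R => - (k.+2`!%:R * `|h|))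
                                  (fun h : R => k.+2`!%:R * `|h|)).
    + near=> h.
      rewrite addr0 [_%:A]mulr1 E0 subr0 scaleRE.
      rewrite -ler_norml; apply: le_trans (flat_exp_le k.+1 h).
      rewrite /flat_exp; case: ifPn => h0; last by rewrite mulr0 normr0.
      rewrite mulrA -invfM -exprS ger0_norm//.
      by rewrite mulr_ge0 ?expR_ge0// invr_ge0 exprn_ge0// ltW.
    + rewrite -[X in _ --> X]oppr0; apply: cvgN; rewrite -[X in _ --> X](mulr0 k.+2`!%:R).
      apply: cvgM; first exact: cvg_cst.
      exact: N.
    + rewrite -[X in _ --> X](mulr0 k.+2`!%:R).
      apply: cvgM; first exact: cvg_cst.
      exact: N.
  split; first by apply/cvg_ex; exists 0; exact: H.
  exact: (cvg_lim _ H).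
Unshelve. all: by end_near. Qed.

Lemma Ck_flat_exp n k : Ck1 R n (@flat_exp R k).
Proof.
elim: n k => [|n IH] k; (split;
  first by move=> t; apply/differentiable_continuous/derivable1_diffP;
  have [] := is_derive_flat_exp k t) => //.
exists (fun _ t => flat_exp k.+2 t + (- k%:R) * flat_exp k.+1 t) => i; split.
  by move=> t; rewrite mulNr; exact: is_derive_flat_exp.
by apply: CkD; [exact: IH|apply: CkM; [exact: Ck_cst|exact: IH]].
Qed.


End flat_exp.

(** A transition from 0 on [t <= -1] to 1 on [t >= 1]; the denominator is positive because [1 + t]
    and [1 - t] cannot both be nonpositive. Its derivative, supported in [-1, 1] and of integral 1,
    serves later as a mollifier. *)
Definition smooth_step {R : realType} (t : R) : R :=
  flat_exp 0 (1 + t) / (flat_exp 0 (1 + t) + flat_exp 0 (1 - t)).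

Section cutoff.
Context {R : realType}.
Implicit Types t a b : R.

Lemma flat_exp_gt0 k t : 0 < t -> 0 < flat_exp k t.
Proof.
move=> t0; rewrite /flat_exp t0 mulr_gt0 ?expR_gt0//.
by rewrite invr_gt0 exprn_gt0.
Qed.

Lemma flat_exp_eq0 k t : t <= 0 -> flat_exp k t = 0.
Proof. by rewrite /flat_exp ltNge => ->. Qed.

Lemma flat_exp0_le1 t : flat_exp 0 t <= 1.
Proof.
rewrite /flat_exp; case: ifPn => // t0.
by rewrite expr0 invr1 mul1r expR_le1 oppr_le0 invr_ge0 ltW.
Qed.

Lemma Ck_affine n (a b : R) : Ck1 R n (fun t => a * t + b).
Proof.
by apply: CkD; [apply: CkM; [exact: Ck_cst|exact: Ck_id]|exact: Ck_cst].
Qed.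

Lemma Ck_comp_affine n (f : R -> R) a b :
  Ck1 R n f -> Ck1 R n (fun t => f (a * t + b)).
Proof. by move=> Cf; exact: (Ck_comp Cf (Ck_affine n a b)). Qed.

(** For [k > 0] this is positive exactly between [a] and [b], with values in [0, 1]. Larger [k]
    steepens both edges, so that the bumps tend to the indicator of the open interval. *)
Definition smooth_bump k a b t : R :=
  flat_exp 0 (k%:R * (t - a)) * flat_exp 0 (k%:R * (b - t)).

Lemma Ck_smooth_bump n k a b : Ck1 R n (smooth_bump k a b).
Proof.
have -> : smooth_bump k a b =
    fun t => flat_exp 0 (k%:R * t + - k%:R * a) *
             flat_exp 0 (- k%:R * t + k%:R * b).
  by apply/funext => t; congr (flat_exp _ _ * flat_exp _ _); ring.
by apply: CkM; apply: Ck_comp_affine; exact: Ck_flat_exp.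
Qed.

Lemma smooth_bump_ge0 k a b t : 0 <= smooth_bump k a b t.
Proof. by rewrite mulr_ge0 ?flat_exp_ge0. Qed.

Lemma smooth_bump_le1 k a b t : smooth_bump k a b t <= 1.
Proof. by rewrite mulr_ile1 ?flat_exp_ge0 ?flat_exp0_le1. Qed.

Lemma smooth_bump_gt0 k a b t : (0 < k)%N -> a < t < b -> 0 < smooth_bump k a b t.
Proof.
move=> k0 /andP[ta tb].
by rewrite mulr_gt0// flat_exp_gt0// mulr_gt0 ?subr_gt0// ltr0n.
Qed.

Lemma smooth_bump_eq0 k a b t : ~~ (a < t < b) -> smooth_bump k a b t = 0.
Proof.
rewrite negb_and -!leNgt => /orP[h|h]; rewrite /smooth_bump.
  by rewrite [flat_exp 0 _]flat_exp_eq0 ?mul0r// mulr_ge0_le0// subr_le0.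
by rewrite [X in _ * X]flat_exp_eq0 ?mulr0// mulr_ge0_le0// subr_le0.
Qed.

Lemma cvg_flat_exp0 t : 0 < t -> flat_exp 0 (k%:R * t) @[k --> \oo] --> (1 : R).
Proof.
move=> t0.
have H : expR (- (k%:R * t)^-1) @[k --> \oo] --> (1 : R).
  have N0 : \forall k \near \oo, 0 < k%:R :> R.
    by exists 1%N => // k /=; rewrite ltr0n.
  have H0 := (@gtr0_cvgV0 _ _ _ _ (fun k : nat => k%:R : R) N0).2 cvgr_idn.
  have {}H0 : - (k%:R^-1 * t^-1) @[k --> \oo] --> - (0 * t^-1).
    by apply: cvgN; apply: cvgM; [exact: H0|exact: cvg_cst].
  rewrite mul0r oppr0 in H0.
  under eq_fun do rewrite invfM.
  by have := continuous_cvg _ (@continuous_expR R 0) H0; rewrite expR0; exact.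
apply: cvg_trans H; apply: near_eq_cvg; near=> k.
rewrite /flat_exp ifT ?expr0 ?invr1 ?mul1r// mulr_gt0// ltr0n.
by near: k; exists 1%N.
Unshelve. all: by end_near. Qed.

Lemma cvg_smooth_bump a b t :
  smooth_bump k a b t @[k --> \oo] --> (\1_(`]a, b[%classic : set R) t : R).
Proof.
rewrite indicE; have [|] := boolP (a < t < b) => tab.
  rewrite mem_set ?in_itv//= -[X in _ --> X]mulr1; case/andP: tab => ta tb.
  by apply: cvgM; apply: cvg_flat_exp0; rewrite subr_gt0.
rewrite memNset/=; last by rewrite in_itv/=; exact/negP.
under eq_fun do rewrite smooth_bump_eq0//.
exact: cvg_cst.
Qed.

Lemma smooth_step_den_gt0 t : 0 < flat_exp 0 (1 + t) + flat_exp 0 (1 - t).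
Proof.
have [h|h] := ltP 0 (1 + t).
  by rewrite ltr_pwDl ?flat_exp_gt0 ?flat_exp_ge0.
by rewrite ltr_wpDl ?flat_exp_ge0// flat_exp_gt0//; lra.
Qed.

Lemma Ck_smooth_step n : Ck1 R n (@smooth_step R).
Proof.
have -> : @smooth_step R = fun t => flat_exp 0 (1 * t + 1) *
    (flat_exp 0 (1 * t + 1) + flat_exp 0 (-1 * t + 1))^-1.
  apply/funext => t; rewrite /smooth_step mul1r mulN1r.
  by rewrite (addrC 1 t) (addrC 1 (- t)).
have C a : Ck1 R n (fun t => flat_exp 0 (a * t + 1)).
  by apply: Ck_comp_affine; exact: Ck_flat_exp.
apply: CkM => //; apply: CkV; last exact: CkD.
move=> t; have := smooth_step_den_gt0 t.
by rewrite mul1r mulN1r (addrC 1 t) (addrC 1 (- t)) => /gt_eqF ->.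
Qed.

Lemma smooth_step_ge0 t : 0 <= smooth_step t.
Proof. by rewrite divr_ge0 ?flat_exp_ge0// ltW ?smooth_step_den_gt0. Qed.

Lemma smooth_step_le1 t : smooth_step t <= 1.
Proof.
rewrite ler_pdivrMr ?smooth_step_den_gt0// mul1r.
by rewrite lerDl flat_exp_ge0.
Qed.

Lemma smooth_step_eq0 t : t <= -1 -> smooth_step t = 0.
Proof. by move=> h; rewrite /smooth_step flat_exp_eq0 ?mul0r//; lra. Qed.

Lemma smooth_step_eq1 t : 1 <= t -> smooth_step t = 1.
Proof.
move=> h; rewrite /smooth_step.
have := smooth_step_den_gt0 t.
rewrite [flat_exp 0 (1 - t)]flat_exp_eq0; last by lra.
by rewrite addr0 => /gt_eqF h'; rewrite divff// h'.
Qed.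

(* The test [0 < s] discards the junk value of [powR] at negative arguments. *)
Definition comp_powR (psi : R -> R) (v q c s : R) : R :=
  if 0 < s then psi (v * s `^ q) * s `^ c else 0.

(** Below [(a / v)^(1/q)] the argument [v * s^q] stays under [a], where [psi] vanishes. This cuts
    off the singularity of [s^c] at 0 for every exponent [c]. *)
Lemma comp_powR_near0 (psi : R -> R) (a v q c s : R) : 0 < a -> 0 < v -> 0 < q ->
  (forall t, t < a -> psi t = 0) -> s < (a / v) `^ q^-1 ->
  comp_powR psi v q c s = 0.
Proof.
move=> a0 v0 q0 psi0 ss0; rewrite /comp_powR; case: ifPn => // sp.
rewrite psi0 ?mul0r// mulrC -ltr_pdivlMr// -[ltRHS]powRr1 ?divr_ge0 ?ltW//.
rewrite -(@mulVf _ q) ?gt_eqF// powRrM.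
by apply: gt0_ltr_powR; rewrite // nnegrE ?powR_ge0 ?ltW.
Qed.

Lemma derive_eq0_lt (psi psi' : R -> R) a : (forall t, t < a -> psi t = 0) ->
  (forall t : R, is_derive t 1 psi (psi' t)) -> forall t, t < a -> psi' t = 0.
Proof.
move=> psi0 dpsi t ta; have [_ <-] := dpsi t.
rewrite (near_eq_derive (g := cst 0)) ?derive_cst//.
by near=> y; rewrite psi0//; near: y; exact: lt_nbhsl.
Unshelve. all: by end_near. Qed.

Lemma is_derive_comp_powR (psi psi' : R -> R) (a v q c s : R) :
  0 < a -> 0 < v -> 0 < q -> (forall t, t < a -> psi t = 0) ->
  (forall t : R, is_derive t 1 psi (psi' t)) ->
  is_derive s 1 (comp_powR psi v q c)
    (v * q * comp_powR psi' v q (q - 1 + c) s + c * comp_powR psi v q (c - 1) s).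
Proof.
move=> a0 v0 q0 psi0 dpsi; have psi'0 := derive_eq0_lt psi0 dpsi.
have s0_gt0 : 0 < (a / v) `^ q^-1 by rewrite powR_gt0// divr_gt0.
have [ss0|ss0] := ltP s ((a / v) `^ q^-1).
  rewrite (comp_powR_near0 _ a0 v0 q0 psi0 ss0) (comp_powR_near0 _ a0 v0 q0 psi'0 ss0).
  rewrite !mulr0 addr0.
  apply: (@near_eq_is_derive _ _ _ (cst (0:R))).
  near=> y; rewrite (comp_powR_near0 _ a0 v0 q0 psi0)//.
  by near: y; exact: lt_nbhsl.
have sp : 0 < s by exact: lt_le_trans ss0.
have dE := is_deriveM
  (@is_derive1_comp _ psi (fun s => v * s `^ q) s _ _ (dpsi _)
    (is_deriveM (is_derive_cst v s (1:R)) (is_derive1_powR q sp)))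
  (is_derive1_powR c sp).
have Ed : psi (v * s `^ q) *: (c * s `^ (c - 1)) + s `^ c *:
    (psi' (v * s `^ q) * (cst v s *: (q * s `^ (q - 1)) + s `^ q *: 0)) =
    v * q * comp_powR psi' v q (q - 1 + c) s + c * comp_powR psi v q (c - 1) s.
  rewrite /comp_powR sp !scaleRE mulr0 addr0.
  rewrite (@powRD _ s (q - 1) c) ?(gt_eqF sp) ?implybT//.
  by rewrite /cst; ring.
rewrite -Ed; apply: near_eq_is_derive dE.
by near=> y; rewrite /comp_powR ifT//; near: y; exact: lt_nbhsr.
Unshelve. all: by end_near. Qed.

(** The derivative combines a [comp_powR] of [psi'] with exponent [q - 1 + c] and one of [psi] with
    exponent [c - 1]. The family over all profiles and exponents is thus closed under
    differentiation, and the induction generalises both. *)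
Lemma Ck_comp_powR n (psi : R -> R) (a v q c : R) : 0 < a -> 0 < v -> 0 < q ->
  (forall t, t < a -> psi t = 0) -> (forall m, Ck1 R m psi) ->
  Ck1 R n (comp_powR psi v q c).
Proof.
move=> a0 v0 q0.
have cF (f : R -> R) (d : R) : (forall t, t < a -> f t = 0) -> Ck1 R 1 f ->
    continuous (comp_powR f v q d).
  move=> f0 [_ [f' /(_ tt)[df _]]] s.
  apply/differentiable_continuous/derivable1_diffP.
  by have [] := is_derive_comp_powR d s a0 v0 q0 f0 df.
elim: n psi c => [|n IH] psi c psi0 Cpsi; (split; first exact: cF) => //.
have [_ [psi' /(_ tt)[dpsi _]]] := Cpsi 1%N.
have psi'0 := derive_eq0_lt psi0 dpsi.
(* Each order of smoothness comes with its own witness of the derivative; uniqueness of the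
   derivative identifies them all. *)
have Cpsi' m : Ck1 R m (psi' tt).
  have [_ [g /(_ tt)[dg Cg]]] := Cpsi m.+1.
  suff -> : psi' tt = g tt by [].
  by apply/funext => x; have [_ <-] := dpsi x; have [_ <-] := dg x.
exists (fun _ s => v * q * comp_powR (psi' tt) v q (q - 1 + c) s +
                   c * comp_powR psi v q (c - 1) s) => i.
split; first by move=> x; exact: (is_derive_comp_powR c x a0 v0 q0 psi0 dpsi).
by apply: CkD; (apply: CkM; [exact: Ck_cst|exact: IH]).
Qed.

End cutoff.

Notation CkrV n := (@Ck _ _ 'I_n (fun i => delta_mx ord0 i)).

(** * Smooth and measurable functions of row vectors *)

Section rV_norm.
Context {R : realType} {n : nat}.
Implicit Types x : 'rV[R]_n.

Lemma rV_norm_leP x (e : R) : 0 <= e ->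
  reflect (forall i, `|x ord0 i| <= e) (`|x| <= e).
Proof.
move=> e0; rewrite [leLHS]/Num.norm/= mx_normrE.
apply: (iffP idP) => [/bigmax_leP[_ H] i|H].
  exact: (H (ord0, i)).
by apply/bigmax_leP; split => // -[i j] _; rewrite ord1; exact: H.
Qed.

Lemma rV_norm_coord x i : `|x ord0 i| <= `|x|.
Proof. by have /rV_norm_leP := lexx `|x|; apply. Qed.

Lemma Ck_coord m (i : 'I_n) : @CkrV n m (fun x : 'rV[R]_n => x ord0 i).
Proof.
have c : continuous (fun x : 'rV[R]_n => x ord0 i) by exact: coord_continuous.
case: m => [|m]; split => //.
exists (fun j => cst ((i == j)%:R : R)) => j; split; last exact: Ck_cst.
move=> x; apply/is_derive_line.
have -> : (fun t : R => (t *: delta_mx ord0 j + x) ord0 i) =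
    (fun t => (i == j)%:R * t + x ord0 i).
  by apply/funext => t; rewrite !mxE eqxx/= mulrC.
have := is_deriveD (is_deriveZ ((i == j)%:R : R) (is_derive_id (0 : R) (1 : R)))
  (is_derive_cst (x ord0 i) (0 : R) (1 : R)).
by rewrite scaleRE mulr1 addr0; exact.
Qed.

Lemma Ck_smooth phi : (forall m, @CkrV n m phi) <-> @smooth R n phi.
Proof.
have partialE f (g : 'I_n -> 'rV[R]_n -> R) i :
    (forall x, is_derive x (delta_mx ord0 i) f (g i x)) -> partial i f = g i.
  by move=> fg; apply/funext => x; rewrite /partial; have [_] := fg x.
split=> [Cphi s|].
  have C m : @CkrV n m (iter_partial s phi).
    elim: s m => [|i s IH] m; first exact: Cphi.
    have [_ [g /(_ i)[dg Cg]]] := IH m.+1.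
    by rewrite /= (partialE _ _ _ dg).
  split; first exact: Ck_continuous (C 0%N).
  by move=> i x; have [_ [g /(_ i)[/(_ x)[]]]] := C 1%N.
move=> + m; elim: m phi => [|m IH] phi sphi; have [cphi dphi] := sphi [::].
  by split.
split => //; exists (fun i => partial i phi) => i; split.
  by move=> x; exact/derivableP/dphi.
(* [foldr] applies the last index of the list first, so appending [i] at the end differentiates
   along [i] before the directions in [s]. *)
apply: IH => s; have := sphi (rcons s i).
by rewrite /iter_partial foldr_rcons.
Qed.

(** Compact support is exchanged for vanishing outside a ball of the sup norm, the form that passes
    easily to sums, products and partial derivatives. *)
Lemma test_functionP phi : @test_function R n phi <->
  (forall m, @CkrV n m phi) /\
  exists2 M : R, 0 <= M & forall x, M < `|x| -> phi x = 0.
Proof.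
split=> [[/Ck_smooth Cphi cphi]|[/Ck_smooth Cphi [M M0 phiM]]]; split => //.
  have [M0 [_ HM]] := compact_bounded cphi.
  exists (`|M0| + 1) => [|x xM]; first by rewrite addr_ge0.
  apply/eqP; apply: contraTT xM => phix; rewrite -leNgt.
  apply: HM; last exact: subset_closure.
  by rewrite ltr_pwDr// ler_norm.
apply: bounded_closed_compact; last exact: closed_closure.
exists M; split; first exact: num_real.
move=> y My x cx; apply: le_trans (ltW My).
have cl : closed [set x : 'rV[R]_n | `|x| <= M].
  apply: (@preimage_closed _ _ (fun x : 'rV[R]_n => `|x|) [set t | t <= M]).
    by move=> z _; exact: norm_continuous.
  exact: closed_le.
suff : closure [set x : 'rV[R]_n | `|x| <= M] x by rewrite -((closure_id _).1 cl).
apply: closureS cx => z /=; rewrite leNgt; apply: contra => /phiM ->.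
by rewrite eqxx.
Qed.

(** The sigma-algebra is generated by coordinates rather than by open sets, so [f] is approximated:
    each coordinate is rounded down to a multiple of [1 / (k + 1)]. The values of [f] at the rounded
    points form a function with countably many values on measurable cells, and they converge to [f]
    by continuity. *)
Lemma continuous_measurable_rV (f : 'rV[R]_n -> R) :
  continuous f -> measurable_fun setT f.
Proof.
move=> cf.
pose z (k : nat) (x : 'rV[R]_n) : 'rV[int]_n :=
  \row_i Num.floor (k.+1%:R * x ord0 i).
pose q (k : nat) (v : 'rV[int]_n) : 'rV[R]_n := \row_i ((v ord0 i)%:~R / k.+1%:R).
apply: (@measurable_realfun.measurable_fun_cvg _ _ R setT (fun k x => f (q k (z k x)))) => [k|x _].
  move=> _ Y mY; rewrite setTI.
  have -> : (fun x => f (q k (z k x))) @^-1` Y =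
      \bigcup_(v : 'rV[int]_n)
         (if f (q k v) \in Y then [set x | z k x = v] else set0).
    apply/seteqP; split => x /=.
      by move=> Yx; exists (z k x) => //; rewrite mem_set.
    by move=> [v _]; case: ifPn => [/set_mem Yv /= zv|//]; rewrite zv.
  apply: countable_bigcupT_measurable; first exact: countableP.
  move=> v; case: ifPn => // _.
  have -> : [set x | z k x = v] = \bigcap_(i in [set: 'I_n])
      ((fun x : 'rV[R]_n => x ord0 i) @^-1`
       [set t : R | Num.floor (k.+1%:R * t) = v ord0 i]).
    apply/seteqP; split => x /=; first by move=> <- i _ /=; rewrite mxE.
    by move=> H; apply/rowP => i; rewrite mxE; exact: H.
  apply: fin_bigcap_measurable => // i _.
  rewrite -[X in measurable X]setTI; apply: measurable_coord => //.
  rewrite (_ : [set t | _] = `[(v ord0 i)%:~R / k.+1%:R, (v ord0 i + 1)%:~R / k.+1%:R[%classic)//.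
  apply/seteqP; split => t /=; rewrite in_itv/= ler_pdivrMr// ltr_pdivlMr// [t * _]mulrC.
    by move=> <-; exact: floor_itv.
  by move=> ?; apply: floor_def.
apply: continuous_cvg; first exact: cf.
apply/cvgrPdist_le => e e0; near=> k.
apply/rV_norm_leP; first exact: ltW.
move=> i; rewrite !mxE.
have /andP[h1 h2] := floor_itv (k.+1%:R * x ord0 i).
rewrite -(@ler_pM2l _ k.+1%:R)// -[X in X * `|_|]ger0_norm// -normrM mulrBr.
rewrite (mulrC _ (_ / _)) divfK// ger0_norm ?subr_ge0//.
apply: (@le_trans _ _ 1).
  by rewrite lerBlDr addrC -intrD1; exact: ltW.
rewrite -ler_pdivrMr// mul1r.
apply/ltW.
near: k; exists (Num.truncn e^-1) => // k /= hk.
by apply: lt_le_trans (truncnS_gt _) _; rewrite ler_nat ltnS.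
Unshelve. all: by end_near. Qed.

End rV_norm.

(** * Lebesgue measure and integrals on R^n *)

Definition rV_box {R : realType} n (a b : 'I_n -> R) : set 'rV[R]_n :=
  [set x | forall i, a i < x ord0 i < b i].

Section rV_box.
Context {R : realType} {n : nat}.
Implicit Types (a b : 'I_n -> R) (x : 'rV[R]_n).

Lemma rV_boxE a b :
  rV_box a b = [set x | forall i, `]a i, b i[%classic (x ord0 i)].
Proof. by apply/seteqP; split => x /= H i; have := H i; rewrite in_itv. Qed.

Lemma measurable_rV_box a b : measurable (rV_box a b).
Proof.
have -> : rV_box a b = \bigcap_(i in [set: 'I_n])
    ((fun x : 'rV[R]_n => x ord0 i) @^-1` `]a i, b i[%classic).
  apply/seteqP; split => x /= H i; first by move=> _; rewrite /= in_itv; exact: H.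
  by have := H i I; rewrite /= in_itv.
apply: fin_bigcap_measurable => // i _.
by rewrite -[X in measurable X]setTI; exact: measurable_coord.
Qed.

Lemma lebesgue_rV_boxE a b :
  lebesgue_rV n (rV_box a b) = (\prod_(i < n) Num.max 0 (b i - a i))%:E.
Proof.
rewrite rV_boxE.
have -> := @lebesgue_rV_box R n (fun i => `]a i, b i[%classic) (fun i => measurable_itv _).
under eq_bigr do rewrite lebesgue_measure_itv/= lte_fin.
elim/big_rec2 : _ => // i y1 y2 _ ->; rewrite EFinM; congr (_ * _)%E.
case: ifPn => h; first by rewrite max_r ?subr_ge0 ?ltW.
by rewrite max_l// subr_le0 leNgt.
Qed.

Lemma lebesgue_rV_box_lty a b : (lebesgue_rV n (rV_box a b) < +oo)%E.
Proof. by rewrite lebesgue_rV_boxE ltry. Qed.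

Definition rV_boxes : set (set 'rV[R]_n) :=
  [set A | exists a b, A = rV_box a b].

Let cube k : set 'rV[R]_n := rV_box (fun=> - k%:R) (fun=> k%:R).

Let cube_cover : \bigcup_k cube k = setT.
Proof.
apply/seteqP; split => // x _.
exists (Num.truncn `|x|).+1 => // i; rewrite -ltr_norml.
by rewrite (le_lt_trans (rV_norm_coord x i))// truncnS_gt.
Qed.

Lemma measurable_rV_boxes : @measurable _ 'rV[R]_n = <<s rV_boxes >>.
Proof.
apply/seteqP; split.
  apply: smallest_sub; first exact: smallest_sigma_algebra.
  move=> A; rewrite -bigcup_seq => -[i _ [B mB <-]]; rewrite setTI.
  pose T := g_sigma_algebraType rV_boxes.
  suff : measurable_fun [set: T] (fun x : T => (x : 'rV[R]_n) ord0 i).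
    by move=> /(_ measurableT _ mB); rewrite setTI.
  apply: (@measurability _ _ T _ _ _ (@RGenOInfty.G R)).
    exact: RGenOInfty.measurableE.
  move=> _ [_ [r ->] <-]; rewrite setTI.
  have -> : (fun x : T => (x : 'rV[R]_n) ord0 i) @^-1` `]r, +oo[%classic =
      \bigcup_k rV_box (fun j => if j == i then r else - k%:R) (fun=> k%:R).
    apply/seteqP; split => x /=; rewrite in_itv/= andbT.
      move=> rx; have : (\bigcup_k cube k) x by rewrite cube_cover.
      move=> [k _ ck]; exists k => // j; case: ifPn => [/eqP ->|_]; last exact: ck.
      by rewrite rx; have /andP[] := ck i.
    by move=> [k _ /(_ i)]; rewrite eqxx => /andP[].
  apply: (@bigcup_measurable _ T) => k _; apply: sub_sigma_algebra.
  by eexists; eexists.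
apply: smallest_sub; first exact: sigma_algebra_measurable.
by move=> _ [a [b ->]]; exact: measurable_rV_box.
Qed.

(** Open boxes are stable under intersection and generate the sigma-algebra, and countably many
    cubes of finite measure cover the space. *)
Lemma rV_measure_unique (m1 m2 : {measure set 'rV[R]_n -> \bar R}) :
  (forall a b, m1 (rV_box a b) = m2 (rV_box a b)) ->
  (forall a b, (m1 (rV_box a b) < +oo)%E) ->
  forall A, measurable A -> m1 A = m2 A.
Proof.
move=> m12 m1oo; apply: (measure_unique rV_boxes cube) => //.
- exact: measurable_rV_boxes.
- move=> _ _ [a [b ->]] [a' [b' ->]].
  exists (fun i => Num.max (a i) (a' i)), (fun i => Num.min (b i) (b' i)).
  apply/seteqP; split => x /=.
    move=> [h h'] i; have /andP[p q] := h i; have /andP[p' q'] := h' i.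
    by rewrite gt_max lt_min p q p' q'.
  by move=> h; split => i; have := h i; rewrite gt_max lt_min;
    move=> /andP[/andP[p p'] /andP[q q']]; apply/andP.
- by move=> k; eexists; eexists.
- by move=> _ [a [b ->]].
- by move=> k; exact: m1oo.
Qed.

Lemma measurable_rV_scale (c : R) :
  measurable_fun setT (fun x : 'rV[R]_n => c *: x).
Proof.
apply: measurable_fun_rV => i; under eq_fun do rewrite mxE.
by apply: measurable_funM => //; exact: measurable_coord.
Qed.

Lemma lebesgue_rV_scale (c : R) A : 0 < c -> measurable A ->
  (lebesgue_rV n ((fun x : 'rV[R]_n => c *: x) @^-1` A) =
   (c ^- n)%:E * lebesgue_rV n A)%E.
Proof.
move=> c0 mA; have c'0 : 0 <= c ^- n by rewrite invr_ge0 exprn_ge0// ltW.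
rewrite -/(pushforward (lebesgue_rV n) (fun x : 'rV[R]_n => c *: x) A).
pose m1 := measure_function_pushforward__canonical__measure_function_Measure
  (lebesgue_rV n) (measurable_rV_scale c).
have boxE a b : pushforward (lebesgue_rV n) (fun x : 'rV[R]_n => c *: x) (rV_box a b) =
    ((c ^- n)%:E * lebesgue_rV n (rV_box a b))%E.
  rewrite /pushforward.
  have -> : (fun x : 'rV[R]_n => c *: x) @^-1` rV_box a b =
      rV_box (fun i => a i / c) (fun i => b i / c).
    apply/seteqP; split => x /= h i; have := h i;
      by rewrite mxE ltr_pdivrMr// ltr_pdivlMr// mulrC.
  rewrite !lebesgue_rV_boxE -EFinM; congr (_%:E).
  under eq_bigr do rewrite -mulrBl -(mul0r c^-1) -maxr_pMl ?invr_ge0 1?ltW//.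
  by rewrite big_split/= mulrC prodr_const card_ord exprVn.
have := @rV_measure_unique m1 (mscale (NngNum c'0) (lebesgue_rV n)) boxE _ A mA.
apply => a b.
have -> : m1 (rV_box a b) = ((c ^- n)%:E * lebesgue_rV n (rV_box a b))%E by exact: boxE.
by rewrite lebesgue_rV_boxE -EFinM ltry.
Qed.

Lemma ge0_integral_rV_scale (c : R) (f : 'rV[R]_n -> \bar R) : 0 < c ->
  measurable_fun setT f -> (forall x, 0 <= f x)%E ->
  (\int[lebesgue_rV n]_x f (c *: x) =
   (c ^- n)%:E * \int[lebesgue_rV n]_x f x)%E.
Proof.
move=> c0 mf f0; have c'0 : 0 <= c ^- n by rewrite invr_ge0 exprn_ge0// ltW.
have := @ge0_integral_pushforward _ _ _ _ _ _ (measurable_rV_scale c)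
  (lebesgue_rV n) setT f measurableT mf (fun x _ => f0 x).
rewrite preimage_setT => <-.
rewrite -[c ^- n]/((NngNum c'0)%:num) -ge0_integral_mscale//.
apply: eq_measure_integral => [|mc A mA _]; first exact: measurable_rV_scale.
exact: lebesgue_rV_scale.
Qed.

End rV_box.

Section rV_integrals.
Context {R : realType}.
Implicit Types n : nat.
Local Notation leb n := (@lebesgue_rV R n).

Lemma rV_ball_box n (M : R) (x : 'rV[R]_n) : 0 <= M -> `|x| <= M ->
  rV_box (fun=> - (M + 1)) (fun=> M + 1) x.
Proof.
move=> M0 xM i; rewrite -ltr_norml.
by apply: le_lt_trans (le_trans (rV_norm_coord x i) xM) _; rewrite ltrDl.
Qed.

Lemma bounded_support_integrable n (f : 'rV[R]_n -> R) (M C : R) : 0 <= M ->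
  measurable_fun setT f -> (forall x, M < `|x| -> f x = 0) ->
  (forall x, `|f x| <= C) -> (leb n).-integrable setT (EFin \o f).
Proof.
move=> M0 mf f0 fC.
pose B := @rV_box R n (fun=> - (M + 1)) (fun=> M + 1).
have mB : measurable B by exact: measurable_rV_box.
have -> : EFin \o f = (EFin \o f) \_ B.
  apply/funext => x; rewrite patchE; case: ifPn => //.
  rewrite notin_setE => /= xB; congr EFin; apply: f0.
  by rewrite ltNge; apply: contra_notN xB; exact: rV_ball_box.
apply/(integrable_mkcond _ mB).
apply: measurable_bounded_integrable => //.
- exact: lebesgue_rV_box_lty.
- exact: measurable_funS mf.
- exists `|C|; split; first exact: num_real.
  move=> y Cy x _ /=; apply: le_trans (fC x) _.
  by apply: le_trans (ler_norm _) _; exact: ltW.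
Qed.

Lemma continuous_support_bounded n (f : 'rV[R]_n -> R) (M : R) :
  continuous f -> (forall x, M < `|x| -> f x = 0) ->
  exists C : R, forall x, `|f x| <= C.
Proof.
move=> cf f0.
have [M0|M0] := ltP M 0.
  by exists 0 => x; rewrite f0 ?normr0// (lt_le_trans M0).
have cB : compact [set x : 'rV[R]_n | `|x| <= M].
  apply: bounded_closed_compact.
    by exists M; split => [|y My x /= xM]; [exact: num_real|exact: le_trans xM (ltW My)].
  apply: (@preimage_closed _ _ (fun x : 'rV[R]_n => `|x|) [set t | t <= M]).
    by move=> x _; exact: norm_continuous.
  exact: closed_le.
have cfB : {within [set x : 'rV[R]_n | `|x| <= M], continuous f}.
  exact: continuous_subspaceT.
have [C [_ HC]] := compact_bounded (continuous_compact cfB cB).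
exists (`|C| + 1) => x; have [xM|xM] := leP `|x| M.
  by apply: HC; [rewrite ltr_pwDr// ler_norm|exists x].
by rewrite f0// normr0 addr_ge0.
Qed.

Lemma continuous_support_integrable n (f : 'rV[R]_n -> R) (M : R) :
  continuous f -> (forall x, M < `|x| -> f x = 0) ->
  (leb n).-integrable setT (EFin \o f).
Proof.
move=> cf f0; have [C fC] := continuous_support_bounded cf f0.
have f0' x : Num.max 0 M < `|x| -> f x = 0 by rewrite gt_max => /andP[_ /f0].
have M0 : 0 <= Num.max 0 M by rewrite le_max lexx.
exact: (bounded_support_integrable M0 (continuous_measurable_rV cf) f0' fC).
Qed.

(** [lebesgue_rV n.+1] is by construction the image of a product measure under [rV_cons]; this opens
    the way to Fubini in the first coordinate. *)
Lemma lebesgue_rV_succ_integral n (f : 'rV[R]_n.+1 -> \bar R) :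
  measurable_fun setT f ->
  (leb n.+1).-integrable setT f ->
  (\int[leb n.+1]_x f x =
   \int[lebesgue_measure \x leb n]_z f (rV_cons z))%E /\
  (lebesgue_measure \x leb n)%E.-integrable setT (f \o (@rV_cons R n)).
Proof.
move=> mf /integrableP[_ fi].
have i : (lebesgue_measure \x leb n)%E.-integrable setT (f \o (@rV_cons R n)).
  apply/integrableP; split.
    by apply: measurableT_comp => //; exact: measurable_rV_cons.
  move: fi; rewrite [X in (X < _)%E -> _](_ : _ =
     \int[pushforward (lebesgue_measure \x leb n)%E (@rV_cons R n)]_x `|f x|)%E//.
  rewrite (ge0_integral_pushforward (@measurable_rV_cons R n))//.
  exact: measurableT_comp.
split => //.
rewrite -[LHS]/(\int[pushforward (lebesgue_measure \x leb n)%E (@rV_cons R n)]_x f x)%E.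
by rewrite (integral_pushforward (@measurable_rV_cons R n)).
Qed.

Lemma rV_cons_lift n (t : R) (v : 'rV[R]_n) j : rV_cons (t, v) ord0 (lift ord0 j) = v ord0 j.
Proof. by rewrite mxE liftK. Qed.

Lemma rV_cons0 n (t : R) (v : 'rV[R]_n) : rV_cons (t, v) ord0 ord0 = t.
Proof. by rewrite mxE unlift_none. Qed.

Lemma rV_cons_norm n (t : R) (v : 'rV[R]_n) :
  `|t| <= `|rV_cons (t, v)| /\ `|v| <= `|rV_cons (t, v)|.
Proof.
split; first by rewrite -{1}(rV_cons0 t v); exact: rV_norm_coord.
apply/rV_norm_leP => // j; rewrite -(rV_cons_lift t v); exact: rV_norm_coord.
Qed.

Lemma rV_consD0 n (s t : R) (v : 'rV[R]_n) :
  s *: delta_mx ord0 ord0 + rV_cons (t, v) = rV_cons (s + t, v).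
Proof.
apply/rowP => i; rewrite /rV_cons !mxE; case: (unliftP ord0 i) => [j|] ->.
  by rewrite /= mulr0 add0r.
by rewrite /= mulr1.
Qed.

Lemma rV_consD_lift n (s t : R) (v : 'rV[R]_n) j :
  s *: delta_mx ord0 (lift ord0 j) + rV_cons (t, v) =
  rV_cons (t, s *: delta_mx ord0 j + v).
Proof.
apply/rowP => i; rewrite /rV_cons !mxE; case: (unliftP ord0 i) => [k|] ->.
  by rewrite !mxE /= (inj_eq (@lift_inj _ ord0)).
by rewrite /= mulr0 add0r.
Qed.

Lemma continuous_rV_consl n (v : 'rV[R]_n) : continuous (fun t => rV_cons (t, v)).
Proof.
move=> t; apply/cvgrPdist_le => e e0; near=> s.
apply/rV_norm_leP; first exact: ltW.
move=> i; rewrite /rV_cons !mxE; case: (unliftP ord0 i) => [k|] _.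
  by rewrite subrr normr0 ltW.
near: s.
by apply: (@cvgr_dist_le _ _ _ (nbhs t) _ id) => //; exact: cvg_id.
Unshelve. all: by end_near. Qed.

Lemma continuous_rV_consr n (t : R) : continuous (fun v : 'rV[R]_n => rV_cons (t, v)).
Proof.
move=> v; apply/(@cvgrPdist_le _ _ _ (nbhs v)) => e e0; near=> w.
apply/rV_norm_leP; first exact: ltW.
move=> i; rewrite /rV_cons !mxE; case: (unliftP ord0 i) => [k|] _.
  rewrite -[_ - _](_ : (v - w) ord0 k = _); last by rewrite !mxE.
  apply: le_trans (rV_norm_coord _ _) _; near: w.
  by apply: (@cvgr_dist_le _ _ _ (nbhs v) _ id).
by rewrite subrr normr0 ltW.
Unshelve. all: by end_near. Qed.

Lemma integral_derive_compact (h g : R -> R) (M : R) : 0 <= M -> continuous g ->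
  (forall t : R, is_derive t 1 h (g t)) -> (forall t, M < `|t| -> h t = 0) ->
  (\int[lebesgue_measure]_t (g t)%:E = 0)%E.
Proof.
move=> M0 cg dh h0.
have g0 t : M < `|t| -> g t = 0.
  move=> Mt; have [_ <-] := dh t.
  rewrite (near_eq_derive (g := cst 0)) ?derive_cst//.
  near=> s; rewrite h0//; near: s.
  by apply: (cvgr_gt _ (@norm_continuous _ _ t)).
have M1 : - (M + 1) < M + 1 by lra.
rewrite (_ : (fun t => _) = (fun t => (g t)%:E) \_ `[- (M + 1), M + 1]); last first.
  apply/funext => t; rewrite patchE; case: ifPn => //.
  rewrite notin_setE/= in_itv/= => /negP; rewrite -ler_norml -ltNge => Mt.
  by rewrite g0//; lra.
rewrite -integral_mkcond (@continuous_FTC2 _ g h)//.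
- by rewrite !h0 ?subee// ?normrN ger0_norm; lra.
- exact: continuous_subspaceT.
- have ch : continuous h.
    by move=> t; apply/differentiable_continuous/derivable1_diffP; have [] := dh t.
  split; first by move=> t _; have [] := dh t.
    exact/cvg_at_right_filter/ch.
  exact/cvg_at_left_filter/ch.
- by move=> t _; rewrite derive1E; have [_ ->] := dh t.
Unshelve. all: by end_near. Qed.

(** Induction on the dimension through Fubini. If the derivative is along the first coordinate, that
    variable is integrated first and the fundamental theorem of calculus gives 0; otherwise the
    first coordinate is frozen and the induction hypothesis applies to the remaining ones. *)
Lemma integral_partial_compact n (i : 'I_n) (h g : 'rV[R]_n -> R) (M : R) :
  0 <= M -> continuous g -> (forall x, is_derive x (delta_mx ord0 i) h (g x)) ->
  (forall x, M < `|x| -> h x = 0) -> (forall x, M < `|x| -> g x = 0) ->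
  (\int[leb n]_x (g x)%:E = 0)%E.
Proof.
elim: n i h g => [[]//|n IH] i h g M0 cg dh h0 g0.
have gi := continuous_support_integrable cg g0.
have mg : measurable_fun setT (EFin \o g).
  by apply/measurable_EFinP; exact: continuous_measurable_rV.
have [-> i1] := lebesgue_rV_succ_integral mg gi.
case: (unliftP ord0 i) => [j|] iE; subst i.
- rewrite -(integral12_prod_meas1 i1); apply: integral0_eq => t _.
  rewrite /fubini_F /=.
  apply: (IH j (fun v => h (rV_cons (t, v))) (fun v => g (rV_cons (t, v)))) => //.
  + by move=> v; apply: continuous_comp; [exact: continuous_rV_consr|exact: cg].
  + move=> v; apply/is_derive_line.
    have /is_derive_line := dh (rV_cons (t, v)).
    by under eq_fun do rewrite rV_consD_lift.
  + by move=> v Mv; rewrite h0//; apply: lt_le_trans Mv _; have [] := rV_cons_norm t v.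
  + by move=> v Mv; rewrite g0//; apply: lt_le_trans Mv _; have [] := rV_cons_norm t v.
- rewrite -(integral21_prod_meas1 i1); apply: integral0_eq => v _.
  rewrite /fubini_G /=.
  apply: (@integral_derive_compact (fun t => h (rV_cons (t, v))) _ M) => //.
  + by move=> t; apply: continuous_comp; [exact: continuous_rV_consl|exact: cg].
  + move=> t; apply/is_derive_line.
    have /is_derive_line := dh (rV_cons (t, v)).
    under eq_fun do rewrite rV_consD0.
    suff -> : (fun s : R => h (rV_cons (s *: 1 + t, v))) =
      (fun s : R => h (rV_cons (s + t, v))) by [].
    by apply/funext => s; rewrite [_%:A]mulr1.
  + by move=> t Mt; rewrite h0//; apply: lt_le_trans Mt _; have [] := rV_cons_norm t v.
Qed.

End rV_integrals.

Section ge0_density.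
Context d {T : measurableType d} {R : realType}.
Variables (mu : {measure set T -> \bar R}) (f : T -> \bar R).
Hypotheses (mf : measurable_fun setT f) (f0 : forall x, (0 <= f x)%E).

(** The two hypotheses are arguments of the function, so that the measure structure declared below
    attaches to the term itself. *)
Definition ge0_density of measurable_fun setT f & (forall x, (0 <= f x)%E) :=
  fun A : set T => (\int[mu]_(x in A) f x)%E.

Local Notation nu := (ge0_density mf f0).

Let nu0 : nu set0 = 0%E. Proof. exact: integral_set0. Qed.

Let nu_ge0 A : (0 <= nu A)%E. Proof. by apply: integral_ge0 => x _; exact: f0. Qed.

Let nu_sigma_additive : semi_sigma_additive nu.
Proof.
move=> F mF tF mUF; rewrite [X in _ --> X](_ : _ = \sum_(n <oo) nu (F n))%E.
  by apply/cvg_closeP; split; [exact: is_cvg_nneseries|rewrite closeE].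
rewrite /ge0_density ge0_integral_bigcup//.
exact: measurable_funS mf.
Qed.

HB.instance Definition _ := isMeasure.Build _ _ _ nu nu0 nu_ge0 nu_sigma_additive.

End ge0_density.

(** * Test functions and weak gradients *)

(** Stands in for Hölder's inequality: on a set of finite measure, a bound on the integral of
    [|f|^N] controls the integral of [|f|]. *)
Lemma ler_1Dexprn {R : realType} (t : R) N : (0 < N)%N -> 0 <= t -> t <= 1 + t ^+ N.
Proof.
move=> N0 t0; have [t1|t1] := leP t 1; first by rewrite ler_wpDr// exprn_ge0.
by rewrite ler_wpDl// ler_eXnr// ltW.
Qed.

Section Lp.
Context {R : realType} {n : nat}.
Implicit Types (u f : 'rV[R]_n -> R) (N : nat).
Local Notation leb := (@lebesgue_rV R n).

Lemma Lnorm_natE N f : (0 < N)%N ->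
  ('N[leb]_(N%:R)%:E[EFin \o f] `^ N%:R = \int[leb]_x (`|f x| ^+ N)%:E)%E.
Proof.
move=> N0; rewrite poweR_Lnorm ?pnatr_eq0 -?lt0n//.
by apply: eq_integral => x _ /=; rewrite powR_mulrn.
Qed.

Lemma in_LpP N u : (0 < N)%N -> in_Lp N%:R u <->
  measurable_fun setT u /\ (\int[leb]_x (`|u x| ^+ N)%:E < +oo)%E.
Proof.
move=> N0; rewrite -Lnorm_natE//; have N0' : N%:R != 0 :> R by rewrite pnatr_eq0 -lt0n.
split=> [/andP[]|[mu uoo]].
  by rewrite !inE/= => mu /poweR_lty uoo; split.
by apply/andP; rewrite !inE/=; split => //; exact: lty_poweRy uoo.
Qed.

Lemma Lp_bounded_support_integrable N u f (M C : R) : (0 < N)%N ->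
  in_Lp N%:R u -> 0 <= M -> measurable_fun setT f ->
  (forall x, M < `|x| -> f x = 0) -> (forall x, `|f x| <= C) ->
  leb.-integrable setT (EFin \o (fun x => u x * f x)).
Proof.
move=> N0 /(in_LpP _ N0)[mu uoo] M0 mf f0 fC.
have C0 : 0 <= C by exact: le_trans (normr_ge0 _) (fC 0).
have mfi := bounded_support_integrable M0 mf f0 fC.
have ui : leb.-integrable setT (EFin \o (fun x => C * `|u x| ^+ N)).
  apply/integrableP; split.
    apply/measurable_EFinP; apply: measurable_funM => //.
    by apply: measurable_funX; exact: measurableT_comp.
  under eq_integral do rewrite /= ger0_norm ?mulr_ge0 ?exprn_ge0// EFinM.
  rewrite ge0_integralZl//; first by rewrite lte_mul_pinfty.
    by apply/measurable_EFinP; apply: measurable_funX; exact: measurableT_comp.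
have gi := integrableD measurableT (integrable_norm mfi) ui.
apply: (le_integrable measurableT _ _ gi).
  by apply/measurable_EFinP; exact: measurable_funM.
move=> x _ /=; rewrite lee_fin normrM.
rewrite [leRHS]ger0_norm ?addr_ge0 ?mulr_ge0 ?exprn_ge0//.
apply: (@le_trans _ _ ((1 + `|u x| ^+ N) * `|f x|)).
  by rewrite ler_wpM2r// ler_1Dexprn.
by rewrite mulrDl mul1r lerD2l mulrC ler_wpM2r ?exprn_ge0.
Qed.

End Lp.

Section test_functions.
Context {R : realType} {n : nat}.
Implicit Types (u phi : 'rV[R]_n -> R) (N : nat).
Local Notation leb := (@lebesgue_rV R n).
Local Notation test := (@test_function R n).

Lemma test_functionM u phi : (forall m, CkrV n m u) -> test phi ->
  test (fun x => u x * phi x).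
Proof.
move=> Cu /test_functionP[Cphi [M M0 phi0]]; apply/test_functionP; split.
  by move=> m; exact: CkM.
by exists M => // x /phi0 ->; rewrite mulr0.
Qed.

Lemma test_function_Ck phi : test phi -> forall m, CkrV n m phi.
Proof. by move=> /test_functionP[]. Qed.

Lemma test_function0 : test (cst 0).
Proof.
apply/test_functionP; split => [m|]; first exact: Ck_cst.
by exists 0.
Qed.

Lemma test_functionD u phi : test u -> test phi -> test (fun x => u x + phi x).
Proof.
move=> /test_functionP[Cu [M M0 u0]] /test_functionP[Cphi [M' M'0 phi0]].
apply/test_functionP; split; first by move=> m; exact: CkD.
exists (Num.max M M'); first by rewrite le_max M0.
by move=> x; rewrite gt_max => /andP[/u0 -> /phi0 ->]; rewrite addr0.
Qed.

Lemma test_functionZ (c : R) phi : test phi -> test (fun x => c * phi x).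
Proof. by apply: test_functionM => m; exact: Ck_cst. Qed.

Lemma is_derive_partial phi i x : test phi ->
  is_derive x (delta_mx ord0 i) phi (partial i phi x).
Proof. by move=> [/(_ [::])[_ /(_ i x) d] _]; exact/derivableP. Qed.

Lemma derive_partial phi i x d : is_derive x (delta_mx ord0 i) phi d ->
  partial i phi x = d.
Proof. by move=> [_ <-]. Qed.

Lemma test_function_partial phi i : test phi -> test (partial i phi).
Proof.
move=> /[dup] tphi [sphi _]; apply/test_functionP; split.
  apply/Ck_smooth => s; have := sphi (rcons s i).
  by rewrite /iter_partial foldr_rcons.
have /test_functionP[_ [M M0 phi0]] := tphi.
exists M => // x xM; rewrite /partial (near_eq_derive (g := cst 0)) ?derive_cst//.
near=> y; rewrite phi0//; near: y.
exact: (cvgr_gt _ (@norm_continuous _ _ x)).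
Unshelve. all: by end_near. Qed.

Lemma test_function_continuous phi : test phi -> continuous phi.
Proof. by move=> [/(_ [::])[]]. Qed.

Lemma test_function_measurable phi : test phi -> measurable_fun setT phi.
Proof. by move=> /test_function_continuous; exact: continuous_measurable_rV. Qed.

Lemma test_function_bounded phi : test phi ->
  exists MC : R * R, [/\ 0 <= MC.1, (forall x, MC.1 < `|x| -> phi x = 0) &
    forall x, `|phi x| <= MC.2].
Proof.
move=> /[dup] /test_function_continuous cphi /test_functionP[_ [M M0 phi0]].
by have [C phiC] := continuous_support_bounded cphi phi0; exists (M, C).
Qed.

Lemma test_function_integrable phi : test phi -> leb.-integrable setT (EFin \o phi).
Proof.
move=> /[dup] /test_function_measurable mphi /test_function_bounded[[M C]/=[]].
by move=> M0 phi0 phiC; exact: bounded_support_integrable phi0 phiC.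
Qed.

Lemma Lp_test_integrable N u phi : (0 < N)%N -> in_Lp N%:R u -> test phi ->
  leb.-integrable setT (EFin \o (fun x => u x * phi x)).
Proof.
move=> N0 uN /[dup] /test_function_measurable mphi /test_function_bounded[[M C]/=[]].
by move=> M0 phi0 phiC; exact: (Lp_bounded_support_integrable N0 uN M0 mphi phi0 phiC).
Qed.

Lemma test_function_in_Lp N phi : (0 < N)%N -> test phi -> in_Lp N%:R phi.
Proof.
move=> N0 tphi; apply/in_LpP => //; split; first exact: test_function_measurable.
have [[M C]/=[M0 phi0 phiC]] := test_function_bounded tphi.
have mphi := test_function_measurable tphi.
have mN : measurable_fun setT (fun x => `|phi x| ^+ N).
  by apply: measurable_funX; exact: measurableT_comp.
have := @bounded_support_integrable _ _ _ M (C ^+ N) M0 mN.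
have phiN0 x : M < `|x| -> `|phi x| ^+ N = 0.
  by move=> /phi0 ->; rewrite normr0 expr0n gtn_eqF.
have phiNC x : `| `|phi x| ^+ N | <= C ^+ N.
  rewrite ger0_norm ?exprn_ge0//; apply: lerXn2r; rewrite ?nnegrE//.
  exact: le_trans (phiC x).
move=> /(_ phiN0 phiNC) /integrableP[_].
by under eq_integral do rewrite /= ger0_norm ?exprn_ge0//.
Qed.

Lemma integral_partial_test phi i : test phi -> (\int[leb]_x (partial i phi x)%:E = 0)%E.
Proof.
move=> tphi; have tp := test_function_partial i tphi.
have /test_functionP[_ [M M0 phi0]] := tphi.
have /test_functionP[_ [M' M'0 phi0']] := tp.
apply: (@integral_partial_compact _ _ i phi _ (Num.max M M')).
- by rewrite le_max M0.
- exact: test_function_continuous.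
- by move=> x; exact: is_derive_partial.
- by move=> x; rewrite gt_max => /andP[/phi0].
- by move=> x; rewrite gt_max => /andP[_ /phi0'].
Qed.

(** Integration by parts: the partial derivative of the product [u * phi] is again that of a test
    function and has integral 0. *)
Lemma test_function_weak_gradient N u : (0 < N)%N -> test u ->
  is_weak_gradient N%:R u (fun x => \row_i partial i u x).
Proof.
move=> N0 tu i; rewrite (_ : (fun x => _) = partial i u); last first.
  by apply/funext => x; rewrite mxE.
have tui := test_function_partial i tu.
split; first exact: test_function_in_Lp.
move=> phi tphi.
have tphi' := test_function_partial i tphi.
apply/eqP; rewrite -addr_eq0; apply/eqP.
have t1 := test_functionM (test_function_Ck tu) tphi'.
have t2 := test_functionM (test_function_Ck tui) tphi.
under [X in _ + X]eq_Rintegral do rewrite mxE.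
rewrite -RintegralD//; [|exact: test_function_integrable..].
have tM := test_functionM (test_function_Ck tu) tphi.
have := integral_partial_test i tM; rewrite /Rintegral => H.
transitivity (fine (\int[leb]_x (partial i (fun x => u x * phi x) x)%:E)%E); last by rewrite H.
congr fine; apply: eq_integral => x _; congr EFin; apply/esym.
apply: derive_partial; apply: is_derive_eq.
  apply: is_deriveM; exact: is_derive_partial.
by rewrite !scaleRE [phi x * _]mulrC.
Qed.

Lemma test_function_W1 N u : (0 < N)%N -> test u -> W1 N%:R u.
Proof.
move=> N0 tu; split; first exact: test_function_in_Lp.
by exists (fun x => \row_i partial i u x); exact: test_function_weak_gradient.
Qed.

End test_functions.

(** * The du Bois-Reymond lemma and uniqueness of weak gradients *)

Section integrals_over_boxes.
Context {R : realType} {n : nat}.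
Local Notation leb := (@lebesgue_rV R n).

(** The positive and negative parts of [h] are densities of two measures that agree on boxes, hence
    on all measurable sets. On the set where [h >= 0] the second measure vanishes, hence so does the
    first; off this set the first vanishes anyway. Both total masses are therefore 0. *)
Lemma integral_rV_box_eq0 (h : 'rV[R]_n -> \bar R) : measurable_fun setT h ->
  (forall a b, leb.-integrable (rV_box a b) h) ->
  (forall a b, \int[leb]_(x in rV_box a b) h x = 0)%E ->
  ae_eq leb setT h (cst 0%E).
Proof.
move=> mh hi h0.
have mp := measurable_funepos mh; have mn := measurable_funeneg mh.
have hp0 x : (0 <= h^\+ x)%E by exact: funepos_ge0.
have hn0 x : (0 <= h^\- x)%E by exact: funeneg_ge0.
pose m1 := ge0_density leb mp hp0; pose m2 := ge0_density leb mn hn0.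
have m12 a b : m1 (rV_box a b) = m2 (rV_box a b).
  have := h0 a b; rewrite integralE => /eqP.
  rewrite sube_eq ?add0e; first by move=> /eqP.
    exact: (integrable_pos_fin_num (measurable_rV_box a b)).
  by rewrite fin_num_adde_defl// (integrable_neg_fin_num (measurable_rV_box a b)).
have m1oo a b : (m1 (rV_box a b) < +oo)%E.
  by apply: integral_funepos_lt_pinfty => //; exact: measurable_rV_box.
have E A : measurable A -> m1 A = m2 A by exact: (rV_measure_unique m12 m1oo).
pose A := [set x | (0 <= h x)%E].
have mA : measurable A.
  by rewrite -[A]setTI; exact: emeasurable_fun_c_infty.
have m2A : m2 A = 0%E.
  apply: integral0_eq => x /= hx; rewrite funenegE max_r//.
  by rewrite oppe_le0.
have m1A : m1 (~` A) = 0%E.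
  apply: integral0_eq => x /= /negP; rewrite -ltNge => hx; rewrite funeposE max_r//.
  exact: ltW.
have m10 : m1 setT = 0%E.
  have D : (m1 setT = m1 A + m1 (~` A))%E.
    have := @measureU _ _ _ m1 A (~` A) mA (measurableC mA) (setICr A).
    by rewrite setUv; exact.
  by rewrite D m1A adde0 E.
have m20 : m2 setT = 0%E by rewrite -E.
apply/(ae_eq_integral_abs _ measurableT mh).
under eq_integral do rewrite -[`|h _|%E]/((abse \o h) _) fune_abse.
by rewrite ge0_integralD// [X in (X + _)%E]m10 [X in (_ + X)%E]m20 adde0.
Qed.

End integrals_over_boxes.

Section weak_gradient_unique.
Context {R : realType} {n : nat}.
Implicit Types (u phi : 'rV[R]_n -> R) (g : 'rV[R]_n -> 'rV[R]_n) (N : nat).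
Local Notation leb := (@lebesgue_rV R n).

Definition box_bump (k : nat) (a b : 'I_n -> R) (x : 'rV[R]_n) : R :=
  \prod_(i < n) smooth_bump k (a i) (b i) (x ord0 i).

Lemma box_bump_le1 k a b x : `|box_bump k a b x| <= 1.
Proof.
rewrite ger0_norm; last by apply: prodr_ge0 => i _; exact: smooth_bump_ge0.
apply: (@le_trans _ _ (\prod_(i < n) 1)); last by rewrite big1.
by apply: ler_prod => i _; rewrite smooth_bump_ge0 smooth_bump_le1.
Qed.

Lemma box_bump_out k a b x : ~ rV_box a b x -> box_bump k a b x = 0.
Proof.
move=> /existsNP[i /negP xi].
by rewrite /box_bump (bigD1 i)//= smooth_bump_eq0// mul0r.
Qed.

Lemma rV_box_norm a b : exists2 M : R, 0 <= M &
  forall x : 'rV[R]_n, rV_box a b x -> `|x| <= M.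
Proof.
have ge0 i : 0 <= `|a i| + `|b i| by rewrite addr_ge0.
exists (\sum_(i < n) (`|a i| + `|b i|)); first exact: sumr_ge0.
move=> x xab; apply/rV_norm_leP; first exact: sumr_ge0.
move=> i; rewrite (bigD1 i)//=.
have := xab i; have := ler_norm (b i); have := ler_norm (- a i); rewrite normrN.
have : 0 <= \sum_(j < n | j != i) (`|a j| + `|b j|) by exact: sumr_ge0.
have := normr_ge0 (a i); have := normr_ge0 (b i).
by move=> ? ? ? ? ? /andP[? ?]; rewrite ler_norml; apply/andP; split; lra.
Qed.

Lemma test_function_box_bump k a b : test_function (box_bump k a b).
Proof.
apply/test_functionP; split => [m|].
  rewrite /box_bump; apply: Ck_prod => i.
  exact: (Ck_comp (Ck_smooth_bump m k (a i) (b i)) (Ck_coord m i)).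
have [M M0 xM] := rV_box_norm a b; exists M => // x Mx.
by apply: box_bump_out => /xM; rewrite leNgt Mx.
Qed.

Lemma cvg_box_bump a b x :
  box_bump k a b x @[k --> \oo] --> (\1_(rV_box a b) x : R).
Proof.
have -> : \1_(rV_box a b) x = \prod_(i < n) (\1_(`]a i, b i[%classic) (x ord0 i) : R).
  rewrite indicE; have [xab|xab] := boolP (x \in rV_box a b).
    rewrite big1// => i _; rewrite indicE mem_set//.
    by rewrite /= in_itv; move/set_mem : xab; exact.
  move: xab; rewrite notin_setE => /existsNP[i xi].
  rewrite (bigD1 i)//= indicE memNset ?mul0r//.
apply: cvg_big; first exact: mul_continuous.
by move=> i _; exact: cvg_smooth_bump.
Qed.

(** Box bumps tend to the indicator of the box, and dominated convergence turns orthogonality to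
    test functions into vanishing integrals over boxes. Integrability is assumed against every
    bounded multiplier of bounded support because it is applied both to the bumps and to the
    indicators. *)
Lemma du_bois_reymond N (f : 'rV[R]_n -> R) : (0 < N)%N ->
  measurable_fun setT f ->
  (forall (phi : 'rV[R]_n -> R) (M C : R), 0 <= M -> measurable_fun setT phi ->
    (forall x, M < `|x| -> phi x = 0) -> (forall x, `|phi x| <= C) ->
    leb.-integrable setT (EFin \o (fun x => f x * phi x))) ->
  (forall phi, test_function phi -> \int[leb]_x (f x * phi x) = 0) ->
  ae_eq leb setT f (cst 0).
Proof.
move=> N0 mf fi f0.
suff : ae_eq leb setT (EFin \o f) (cst 0%E).
  by apply: filterS => x /= /[apply] -[].
have bi a b : leb.-integrable setT (EFin \o (fun x => f x * \1_(rV_box a b) x)).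
  have [M M0 xM] := rV_box_norm a b; apply: (fi _ M 1) => //.
  - by apply: measurable_indic; exact: measurable_rV_box.
  - move=> x Mx; rewrite indicE memNset// => /xM.
    by rewrite leNgt Mx.
  - by move=> x; rewrite indicE normr_nat lern1; case: (_ \in _).
have bE a b : (EFin \o (fun x => f x * \1_(rV_box a b) x)) = (EFin \o f) \_ (rV_box a b).
  apply/funext => x; rewrite patchE /= indicE.
  by case: ifPn => _; rewrite ?mulr1 ?mulr0.
apply: integral_rV_box_eq0; first exact/measurable_EFinP.
  move=> a b; apply/(integrable_mkcond _ (measurable_rV_box a b)).
  by rewrite -bE.
move=> a b; rewrite integral_mkcond -bE.
have [M M0 xM] := rV_box_norm a b.
have ti k := test_function_box_bump k a b.
have mti k := test_function_measurable (ti k).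
have Mb k x : M < `|x| -> box_bump k a b x = 0.
  by move=> Mx; apply: box_bump_out => /xM; rewrite leNgt Mx.
have fbi k := fi _ M 1 M0 (mti k) (Mb k) (box_bump_le1 k a b).
have I0 k : (\int[leb]_x (f x * box_bump k a b x)%:E = 0)%E.
  have := f0 _ (ti k); rewrite /Rintegral => H.
  rewrite -[LHS]fineK ?H//; exact: (integrable_fin_num measurableT (fbi k)).
have H : (\int[leb]_x (f x * box_bump k a b x)%:E @[k --> \oo] -->
    \int[leb]_x (f x * \1_(rV_box a b) x)%:E)%E.
  apply: (@dominated_cvg _ _ _ _ _ measurableT _ _
    (abse \o (EFin \o (fun x => f x * \1_(rV_box a b) x)))).
  - by move=> k; exact: measurable_int (fbi k).
  - move=> x _; apply/cvg_EFin; first exact: nearW.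
    by apply: cvgM; [exact: cvg_cst|exact: cvg_box_bump].
  - by move=> x _.
  - exact: integrable_abse (bi a b).
  - move=> k x _ /=; rewrite lee_fin !normrM ler_wpM2l// indicE.
    have [_|] := boolP (x \in rV_box a b); first by rewrite normr1 box_bump_le1.
    by rewrite notin_setE => /box_bump_out ->.
rewrite (_ : (fun k => _) = cst 0%E) in H; last exact/funext.
exact: (cvg_unique _ H (cvg_cst _)).
Qed.

Lemma weak_gradient_unique N u g g' i : (0 < N)%N ->
  is_weak_gradient N%:R u g -> is_weak_gradient N%:R u g' ->
  {ae leb, forall x, g x ord0 i = g' x ord0 i}.
Proof.
move=> N0 /(_ i)[gN gu] /(_ i)[g'N g'u].
have [[mg _] [mg' _]] := ((in_LpP _ N0).1 gN, (in_LpP _ N0).1 g'N).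
have : ae_eq leb setT (fun x => g x ord0 i - g' x ord0 i) (cst 0).
  apply: (du_bois_reymond N0); first exact: measurable_funB.
    move=> phi M C M0 mphi phi0 phiC.
    have := integrableB measurableT
      (Lp_bounded_support_integrable N0 gN M0 mphi phi0 phiC)
      (Lp_bounded_support_integrable N0 g'N M0 mphi phi0 phiC).
    by congr (_.-integrable _ _); apply/funext => x /=; rewrite -EFinB mulrBl.
  move=> phi tphi; under eq_Rintegral do rewrite mulrBl.
  rewrite RintegralB//; [|exact: (Lp_test_integrable N0)..].
  by rewrite -[X in X - _]opprK -[X in _ - X]opprK -gu// -g'u// subrr.
by apply: filterS => x /= /(_ I)/eqP; rewrite subr_eq0 => /eqP.
Qed.

Lemma measurable_enorm : measurable_fun setT (@enorm R n).
Proof.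
apply: measurableT_comp.
  by apply: continuous_measurable_fun => //; exact: sqrt_continuous.
by apply: measurable_sum => i; apply: measurable_funX; exact: measurable_coord.
Qed.

(** [W1_energy] is written with the gradient picked by [xget]. It agrees with [g] almost everywhere,
    so any weak gradient may be used to compute the energy. *)
Lemma W1_energyE N u g : (0 < N)%N -> is_weak_gradient N%:R u g ->
  W1_energy N%:R u = (\int[leb]_x (enorm (g x) ^+ N)%:E +
                      \int[leb]_x (`|u x| ^+ N)%:E)%E.
Proof.
move=> N0 gu; rewrite /W1_energy !Lnorm_natE//; congr (_ + _)%E.
have wu : is_weak_gradient N%:R u (weak_gradient N%:R u).
  by apply: (@xgetPex _ _ [set g | is_weak_gradient N%:R u g]); exists g.
have mgrad f : is_weak_gradient N%:R u f -> measurable_fun setT (fun x => enorm (f x) ^+ N).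
  move=> fu; apply: measurable_funX; apply: measurableT_comp; first exact: measurable_enorm.
  by apply: measurable_fun_rV => i; have [/(in_LpP _ N0)[]] := fu i.
under eq_integral do rewrite /= ger0_norm ?sqrtr_ge0//.
apply: ge0_ae_eq_integral => //.
- by apply/measurable_EFinP; exact: mgrad wu.
- by apply/measurable_EFinP; exact: mgrad gu.
- by move=> x _; rewrite lee_fin exprn_ge0// sqrtr_ge0.
- by move=> x _; rewrite lee_fin exprn_ge0// sqrtr_ge0.
have : {ae leb, forall x, forall i, weak_gradient N%:R u x ord0 i = g x ord0 i}.
  by apply: filter_forall => i; exact: weak_gradient_unique wu gu.
apply: filterS => x H _; congr (enorm _ ^+ _)%:E.
by apply/rowP.
Qed.

Lemma W1_energy_test N u : (0 < N)%N -> test_function u ->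
  W1_energy N%:R u = (\int[leb]_x (enorm (\row_i partial i u x) ^+ N)%:E +
                      \int[leb]_x (`|u x| ^+ N)%:E)%E.
Proof. by move=> N0 tu; rewrite (W1_energyE N0 (test_function_weak_gradient N0 tu)). Qed.

End weak_gradient_unique.

(** * Decay of radial functions *)

Section smoothing.
Context {R : realType}.
Implicit Types (f : R -> R) (a e t : R).
Local Notation mu := (@lebesgue_measure R).

Lemma smooth_step_derivative : exists (rho : R -> R) (K : R),
  [/\ forall t : R, is_derive t 1 (@smooth_step R) (rho t), continuous rho,
      forall t, 1 < `|t| -> rho t = 0, 0 < K & forall t, `|rho t| <= K].
Proof.
have [_ [g /(_ tt)[dg Cg]]] := @Ck_smooth_step R 1.
have cg : continuous (g tt) by case: Cg.
have g0 t : 1 < `|t| -> g tt t = 0.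
  move=> t1; have [_ <-] := dg t.
  have [t0|t0] := leP 0 t; [rewrite ger0_norm// in t1|rewrite ltr0_norm// in t1].
    rewrite (near_eq_derive (g := cst (1:R))) ?derive_cst//.
    near=> s; rewrite smooth_step_eq1//; apply: ltW; near: s; exact: lt_nbhsr.
  rewrite (near_eq_derive (g := cst (0:R))) ?derive_cst//.
  near=> s; rewrite smooth_step_eq0//; apply: ltW; near: s; apply: lt_nbhsl.
  by rewrite ltrNr.
have [|C [_ HC]] := @compact_bounded _ _ (g tt @` `[-1, 1]%classic).
  apply: continuous_compact; last exact: segment_compact.
  exact: continuous_subspaceT.
exists (g tt), (`|C| + 1); split => //.
move=> t; have [t1|t1] := leP `|t| 1.
  apply: HC; first by rewrite ltr_pwDr// ler_norm.
  by exists t => //; rewrite /= in_itv/= -ler_norml.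
by rewrite g0// normr0 addr_ge0.
Unshelve. all: by end_near. Qed.

Lemma is_derive_smooth_step_scaled (rho : R -> R) a e (s : R) :
  (forall t : R, is_derive t 1 (@smooth_step R) (rho t)) ->
  is_derive s 1 (fun s => smooth_step ((s - a) / e)) (rho ((s - a) / e) / e).
Proof.
move=> drho; apply: (@is_derive1_comp _ _ (fun s => (s - a) / e)).
have -> : (fun s => (s - a) / e) = (fun s => e^-1 * s + - (a / e)).
  by apply/funext => y; rewrite mulrBl mulrC.
have := is_deriveD (is_deriveZ e^-1 (is_derive_id s (1:R))) (is_derive_cst (- (a / e)) s (1:R)).
by rewrite scaleRE mulr1 addr0.
Qed.

Lemma bump_integral1 (rho : R -> R) a e : 0 < e ->
  (forall t : R, is_derive t 1 (@smooth_step R) (rho t)) -> continuous rho ->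
  (\int[mu]_(s in `[(a - 2 * e)%R, (a + 2 * e)%R]) (rho ((s - a) / e) / e)%:E = 1)%E.
Proof.
move=> e0 drho crho.
have dS s := is_derive_smooth_step_scaled a e s drho.
have cS : continuous (fun s => smooth_step ((s - a) / e)).
  by move=> s; apply/differentiable_continuous/derivable1_diffP; have [] := dS s.
rewrite (@continuous_FTC2 _ _ (fun s => smooth_step ((s - a) / e))).
- have -> : (a + 2 * e - a) / e = 2 by field; rewrite gt_eqF.
  have -> : (a - 2 * e - a) / e = - 2 by field; rewrite gt_eqF.
  by rewrite smooth_step_eq1 ?smooth_step_eq0 ?sube0//; lra.
- lra.
- apply: continuous_subspaceT => s; apply: cvgM; last exact: cvg_cst.
  apply: continuous_comp; last exact: crho.
  apply: cvgM; last exact: cvg_cst.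
  by apply: cvgB; [exact: cvg_id|exact: cvg_cst].
- split; first by move=> t _; have [] := dS t.
    exact/cvg_at_right_filter/cS.
  exact/cvg_at_left_filter/cS.
- by move=> t _; rewrite derive1E; have [_ ->] := dS t.
Qed.

(** The kernel has integral 1, so the error is the integral of [f - f a] against it. This is
    controlled by the mean of [|f - f a|] over a small ball, which tends to 0 at a Lebesgue
    point. *)
Lemma bump_average (rho : R -> R) (K : R) f a (eta : R) :
  (forall t : R, is_derive t 1 (@smooth_step R) (rho t)) -> continuous rho ->
  (forall t, 1 < `|t| -> rho t = 0) -> 0 < K -> (forall t, `|rho t| <= K) ->
  locally_integrable setT f -> lebesgue_pt f a -> 0 < eta ->
  \forall e \near 0^'+,
    mu.-integrable setT (EFin \o (fun s => f s * (rho ((s - a) / e) / e))) /\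
    `|\int[mu]_s (f s * (rho ((s - a) / e) / e)) - f a| <= eta.
Proof.
move=> drho crho rho0 K0 rhoK [mf _ lf] la eta0.
(* The kernel is at most [K / e] and the ball of radius [3 * e] has length [6 * e], so the error is
   at most [6 * K] times the mean oscillation over that ball. *)
have d0 : (0 < (eta / (6 * K))%:E)%E by rewrite lte_fin divr_gt0// mulr_gt0.
have [d /= dp Hd] : \forall r \near 0^'+, (davg f a r < (eta / (6 * K))%:E)%E.
  exact: (la _ (open_ereal_lt' d0)).
near=> e; have e0 : 0 < e by near: e; exact: nbhs_right_gt.
have {Hd} Hd : (davg f a (3 * e) < (eta / (6 * K))%:E)%E.
  apply: Hd; last by rewrite mulr_gt0.
  rewrite /= distrC subr0 gtr0_norm ?mulr_gt0// -ltr_pdivlMl//.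
  by near: e; apply: nbhs_right_lt; rewrite mulr_gt0.
(* A compact window that contains the support [[a - e, a + e]] of the kernel and is contained in the
   open ball of radius [3 * e]. *)
pose D : set (measurableTypeR R) := `[a - 2 * e, a + 2 * e]%classic.
pose b s := rho ((s - a) / e) / e.
have mD : measurable D by exact: measurable_itv.
have cD : compact D by exact: segment_compact.
have cb : continuous b.
  move=> s; apply: cvgM; last exact: cvg_cst.
  apply: continuous_comp; last exact: crho.
  apply: cvgM; last exact: cvg_cst.
  by apply: cvgB; [exact: cvg_id|exact: cvg_cst].
have mb : measurable_fun setT b by exact: continuous_measurable_fun.
have bK s : `|b s| <= K / e.
  by rewrite normrM ler_pM// gtr0_norm// invr_gt0.
have b0 s : ~ D s -> b s = 0.
  move=> Ds; rewrite /b rho0 ?mul0r//.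
  rewrite ltNge; apply: contra_notN Ds => h; rewrite /D/= in_itv/=.
  move: h; rewrite normrM [`|e^-1|]gtr0_norm ?invr_gt0// ler_pdivrMr// mul1r ler_norml.
  by move=> /andP[? ?]; apply/andP; split; lra.
have bB : [bounded b x | x in D].
  exists (K / e); split; first exact: num_real.
  by move=> y Ky x _ /=; apply: le_trans (bK x) (ltW Ky).
have fD : mu.-integrable D (EFin \o f).
  apply/integrableP; split; last exact: lf.
  by apply/measurable_EFinP; exact: measurable_funS mf.
have mbD : measurable_fun D b by exact: measurable_funS mb.
have fbD : mu.-integrable D (EFin \o (fun s => f s * b s)).
  rewrite (_ : EFin \o _ = (EFin \o f) \* (EFin \o b))%E.
    by apply: integrableMl.
  by apply/funext => s; rewrite /= EFinM.
have E : EFin \o (fun s => f s * b s) = (EFin \o (fun s => f s * b s)) \_ D.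
  apply/funext => s; rewrite patchE; case: ifPn => //.
  by rewrite notin_setE /= => /b0 ->; rewrite mulr0.
split.
  have := (integrable_mkcond (mu := mu) (EFin \o (fun s => f s * b s)) mD).1 fbD.
  by rewrite -E; exact.
have muD : (mu D < +oo)%E by exact: compact_finite_measure.
have bD : mu.-integrable D (EFin \o b) by exact: measurable_bounded_integrable.
have fabD : mu.-integrable D (EFin \o (fun s => f a * b s)).
  rewrite (_ : EFin \o _ = (fun s => (f a)%:E * (EFin \o b) s)%E).
    by apply: integrableZl.
  by apply/funext => s; rewrite /= EFinM.
rewrite (_ : \int[mu]_s (f s * b s) = \int[mu]_(s in D) (f s * b s)); last first.
  by rewrite /Rintegral [in RHS]integral_mkcond -E.
have -> : f a = \int[mu]_(s in D) (f a * b s).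
  rewrite RintegralZl// [X in _ * X](_ : _ = 1) ?mulr1//.
  by rewrite /Rintegral bump_integral1.
rewrite -RintegralB//.
have dD : mu.-integrable D (EFin \o (fun s => f s * b s - f a * b s)).
  rewrite (_ : EFin \o _ = (EFin \o (fun s => (f s * b s)%R)) \-
    (EFin \o (fun s => (f a * b s)%R)))%E; first by apply: integrableB.
  by apply/funext => s; rewrite /= EFinB.
apply: le_trans (le_normr_Rintegral mD dD) _.
rewrite -lee_fin /Rintegral fineK; last first.
  exact: (integrable_fin_num mD (integrable_norm dD)).
apply: (@le_trans _ _ (\int[mu]_(s in ball a (3 * e)) ((K / e)%:E * `|f s - f a|%:E))%E).
  apply: (@le_trans _ _ (\int[mu]_(s in D) ((K / e)%:E * `|f s - f a|%:E))%E).
    apply: ge0_le_integral => //.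
    - apply/measurable_EFinP; apply: measurableT_comp => //.
      by have /measurable_EFinP := measurable_int _ dD.
    - apply/measurable_EFinP; apply: measurable_funM => //.
      apply: measurableT_comp => //; apply: measurable_funB => //.
      exact: measurable_funS mf.
    - move=> s _; rewrite -EFinM lee_fin -mulrBl normrM mulrC.
      by rewrite ler_wpM2r.
  apply: ge0_subset_integral => //; first exact: measurable_ball.
    apply/measurable_EFinP; apply: measurable_funM => //.
    apply: measurableT_comp => //; apply: measurable_funB => //.
    exact: measurable_funS mf.
  - by move=> s _; rewrite mule_ge0// lee_fin divr_ge0// ltW.
  - move=> s; rewrite /D/= in_itv/= => /andP[h1 h2].
    by rewrite /ball/= ltr_norml; apply/andP; split; lra.
have mba : measurable_fun (ball a (3 * e)) (fun s => (`|f s - f a|)%:E).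
  apply/measurable_EFinP; apply: measurableT_comp => //; apply: measurable_funB => //.
  exact: measurable_funS mf.
rewrite ge0_integralZl//; last 2 first.
- exact: measurable_ball.
- by rewrite lee_fin divr_ge0// ltW.
have e3 : 0 < 3 * e by rewrite mulr_gt0.
have lb := @lebesgue_measure_ball R a _ (ltW e3).
move: Hd; rewrite /davg /iavg lb inver mulrn_eq0/= gt_eqF// => /ltW.
set I := (\int[mu]_(y in _) _)%E => HI.
have -> : ((K / e)%:E * I = (6 * K)%:E * (((3 * e) *+ 2)^-1%:E * I))%E.
  rewrite muleA -EFinM; congr (_%:E * _)%E.
  by rewrite -mulr_natr; field; rewrite gt_eqF.
have K6 : 0 < 6 * K by rewrite mulr_gt0.
have K6e : (0 <= (6 * K)%:E)%E by rewrite lee_fin ltW.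
apply: (le_trans (lee_wpmul2l K6e HI)).
by rewrite -EFinM mulrC divfK// gt_eqF.
Unshelve. all: by end_near. Qed.


End smoothing.

Section oscillation.
Context {R : realType}.
Local Notation mu := (@lebesgue_measure R).
Implicit Types f : R -> R.

(* The derivative of the difference of two smooth steps is the difference of two
   approximate Dirac masses. *)
Lemma lebesgue_pt_oscillation f (B s1 s2 : R) : locally_integrable setT f ->
  lebesgue_pt f s1 -> lebesgue_pt f s2 -> s1 <= s2 ->
  (forall psi psi' : R -> R, (forall m, Ck1 R m psi) ->
    (forall t : R, is_derive t 1 psi (psi' t)) -> (forall t, `|psi t| <= 1) ->
    (forall t, ~ (s1 - 1 <= t <= s2 + 1) -> psi t = 0) ->
    `|\int[mu]_s (f s * psi' s)| <= B) ->
  `|f s1 - f s2| <= B.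
Proof.
move=> lf l1 l2 s12 HB.
have [rho [K [drho crho rho0 K0 rhoK]]] := @smooth_step_derivative R.
apply/ler_addgt0Pr => eta eta0.
have eta2 : 0 < eta / 2 by rewrite divr_gt0.
have A1 := bump_average drho crho rho0 K0 rhoK lf l1 eta2.
have A2 := bump_average drho crho rho0 K0 rhoK lf l2 eta2.
near (0:R)^'+ => e.
have e0 : 0 < e by near: e; exact: nbhs_right_gt.
(* Keeps the difference of the two steps supported in [[s1 - 1, s2 + 1]]. *)
have e1 : e <= 1 by near: e; exact: nbhs_right_le.
have [i1 E1] : mu.-integrable setT (EFin \o (fun s => f s * (rho ((s - s1) / e) / e))) /\
    `|\int[mu]_s (f s * (rho ((s - s1) / e) / e)) - f s1| <= eta / 2 by near: e.
have [i2 E2] : mu.-integrable setT (EFin \o (fun s => f s * (rho ((s - s2) / e) / e))) /\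
    `|\int[mu]_s (f s * (rho ((s - s2) / e) / e)) - f s2| <= eta / 2 by near: e.
pose step c t : R := smooth_step ((t - c) / e).
have stepE c : step c = fun t => smooth_step (e^-1 * t + - (c / e)).
  by apply/funext => t; rewrite /step mulrBl mulrC.
have dstep c (t : R) := is_derive_smooth_step_scaled c e t drho.
have Cstep c m : Ck1 R m (step c).
  by rewrite stepE; apply: Ck_comp_affine; exact: Ck_smooth_step.
have H := HB (fun t => step s1 t + -1 * step s2 t)
  (fun t => rho ((t - s1) / e) / e - rho ((t - s2) / e) / e).
have {H} H : `|\int[mu]_s (f s * (rho ((s - s1) / e) / e)) -
    \int[mu]_s (f s * (rho ((s - s2) / e) / e))| <= B.
  rewrite -RintegralB//; under eq_Rintegral do rewrite -mulrBr; apply: H.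
  - by move=> m; apply: CkD => //; apply: CkM => //; exact: Ck_cst.
  - move=> t; apply: is_deriveD; first exact: dstep.
    by have := is_deriveZ (-1) (dstep s2 t); rewrite scaleRE mulN1r; exact.
  - move=> t; rewrite mulN1r /step.
    have := smooth_step_ge0 ((t - s1) / e); have := smooth_step_le1 ((t - s1) / e).
    have := smooth_step_ge0 ((t - s2) / e); have := smooth_step_le1 ((t - s2) / e).
    by move=> ? ? ? ?; rewrite ler_norml; apply/andP; split; lra.
  - move=> t /negP; rewrite negb_and -!ltNge => /orP[h|h]; rewrite mulN1r /step.
      rewrite !smooth_step_eq0 ?subr0//; by rewrite ler_pdivrMr//; lra.
    rewrite !smooth_step_eq1 ?subrr//; by rewrite ler_pdivlMr//; lra.
move: H E1 E2; set I1 := \int[mu]_s (f s * (rho ((s - s1) / e) / e)).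
set I2 := \int[mu]_s (f s * (rho ((s - s2) / e) / e)) => H E1 E2.
have -> : f s1 - f s2 = (I1 - I2) + (I2 - f s2) - (I1 - f s1) by ring.
apply: le_trans (ler_normB _ _) _; apply: le_trans (lerD (ler_normD _ _) (lexx _)) _.
by rewrite -addrA lerD//; lra.
Unshelve. all: by end_near. Qed.

(** Chebyshev's argument: otherwise [|f|^N > 2 / l] almost everywhere on an interval of length [l],
    and the integral would be at least 2. The property [P] allows the point found to be a Lebesgue
    point as well. *)
Lemma exists_small_value f (P : R -> Prop) N (s l : R) : (0 < l) ->
  measurable_fun setT f ->
  (\int[mu]_(t in `]s, (s + l)%R[) (`|f t| ^+ N)%:E <= 1)%E ->
  {ae mu, forall t, P t} ->
  exists t, [/\ s < t, t < s + l, P t & `|f t| ^+ N <= 2 / l].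
Proof.
move=> l0 mf fI aeP; apply: contrapT => /forallNP H.
have mN : measurable_fun setT (fun t => (`|f t| ^+ N)%:E).
  by apply/measurable_EFinP; apply: measurable_funX; exact: measurableT_comp.
have : (\int[mu]_(t in `]s, (s + l)%R[%classic) (2 / l)%:E <= 1)%E.
  apply: le_trans fI; apply: ae_ge0_le_integral => //.
  - by move=> t _; rewrite lee_fin divr_ge0// ltW.
  - exact: measurable_funS mN.
  move: aeP; apply: filterS; first exact: (ae_filter_ringOfSetsType mu).
  move=> t Pt /=; rewrite in_itv/= => /andP[h1 h2].
  rewrite lee_fin leNgt; apply/negP => /ltW h3.
  by apply: (H t); split.
rewrite integral_cst//= lebesgue_measure_itv/= lte_fin ltrDl l0 -EFinB -EFinM lee_fin.
by rewrite addrC addKr divfK ?gt_eqF// lern1.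
Qed.

End oscillation.

(** * The Euclidean norm and the volume of balls as radial variable *)

Section euclidean_norm.
Context {R : realType} {n : nat}.
Implicit Types x : 'rV[R]_n.
Local Notation leb := (@lebesgue_rV R n).

Lemma enorm_ge0 x : 0 <= enorm x. Proof. exact: sqrtr_ge0. Qed.

Lemma enorm_sqr x : enorm x ^+ 2 = \sum_(i < n) x ord0 i ^+ 2.
Proof. by rewrite sqr_sqrtr// sumr_ge0// => i _; exact: sqr_ge0. Qed.

Lemma enorm_coord x i : `|x ord0 i| <= enorm x.
Proof.
rewrite -(ler_pXn2r (n := 2))// ?nnegrE ?enorm_ge0// enorm_sqr.
rewrite (bigD1 i)//= real_normK ?num_real// lerDl.
by apply: sumr_ge0 => j _; exact: sqr_ge0.
Qed.

Lemma rV_norm_enorm x : `|x| <= enorm x.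
Proof. by apply/rV_norm_leP; [exact: enorm_ge0|exact: enorm_coord]. Qed.

Lemma enormZ (c : R) x : 0 <= c -> enorm (c *: x) = c * enorm x.
Proof.
move=> c0; apply/eqP; rewrite -(eqrXn2 (n := 2)) ?mulr_ge0 ?enorm_ge0//.
rewrite exprMn !enorm_sqr mulr_sumr; apply/eqP; apply: eq_bigr => i _.
by rewrite mxE exprMn.
Qed.

Lemma measurable_eball r : measurable (@eball R n r).
Proof.
rewrite -[eball r]setTI; have := @measurable_enorm R n measurableT `]-oo, r[%classic (measurable_itv _).
by congr measurable; apply/seteqP; split => x /=; rewrite in_itv.
Qed.

Lemma lebesgue_eball1_lty : (leb (eball 1) < +oo)%E.
Proof.
apply: le_lt_trans (lebesgue_rV_box_lty (fun=> -1) (fun=> 1)).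
apply: le_measure; rewrite ?inE; [exact: measurable_eball|exact: measurable_rV_box|].
by move=> x /= x1 i; rewrite -ltr_norml (le_lt_trans (enorm_coord x i)).
Qed.

Definition unit_volume : R := fine (leb (eball 1)).

Lemma lebesgue_eball1 : leb (eball 1) = unit_volume%:E.
Proof. by rewrite fineK// ge0_fin_numE// lebesgue_eball1_lty. Qed.

Lemma unit_volume_gt0 : 0 < unit_volume.
Proof.
rewrite -lte_fin -lebesgue_eball1.
(* A cube of half-width [1 / (n + 1)] fits in the unit ball, since [n / (n + 1)^2 < 1]. *)
pose c : R := n.+1%:R^-1; have c0 : 0 < c by rewrite invr_gt0.
apply: (@lt_le_trans _ _ (leb (rV_box (fun=> - c) (fun=> c)))).
  rewrite lebesgue_rV_boxE lte_fin; apply: prodr_gt0 => i _.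
  by rewrite lt_max; apply/orP; right; lra.
apply: le_measure; rewrite ?inE; [exact: measurable_rV_box|exact: measurable_eball|].
move=> x /= xc; rewrite /eball/= -(ltr_pXn2r (n := 2))// ?nnegrE ?enorm_ge0//.
rewrite enorm_sqr expr1n; apply: (@le_lt_trans _ _ (\sum_(i < n) c ^+ 2)).
  apply: ler_sum => i _; rewrite -[x ord0 i ^+ 2]real_normK ?num_real//.
  by rewrite ler_pXn2r// ?nnegrE//; [have := xc i; rewrite -ltr_norml => /ltW|exact: ltW].
rewrite sumr_const card_ord -mulr_natr /c exprVn mulrC ltr_pdivrMr ?exprn_gt0//.
by rewrite mul1r -natrX ltr_nat expnS expn1 (leq_trans (ltnSn n))// leq_pmulr.
Qed.

Lemma lebesgue_eball r : 0 < r -> leb (eball r) = (unit_volume * r ^+ n)%:E.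
Proof.
move=> r0; have -> : @eball R n r = (fun x => r^-1 *: x) @^-1` eball 1.
  by apply/seteqP; split => x /=; rewrite /eball/= enormZ ?invr_ge0 ?ltW// mulrC ltr_pdivrMr// mul1r.
rewrite lebesgue_rV_scale ?invr_gt0//; last exact: measurable_eball.
by rewrite exprVn invrK lebesgue_eball1 -EFinM mulrC.
Qed.

Definition volume_rad x : R := unit_volume * enorm x ^+ n.

Lemma volume_rad_ge0 x : 0 <= volume_rad x.
Proof. by rewrite mulr_ge0 ?exprn_ge0 ?enorm_ge0// ltW// unit_volume_gt0. Qed.

Lemma measurable_volume_rad : measurable_fun setT volume_rad.
Proof.
by apply: measurable_funM => //; apply: measurable_funX; exact: measurable_enorm.
Qed.

Hypothesis n0 : (0 < n)%N.

Lemma volume_rad_lt x s : 0 < s ->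
  (volume_rad x < s) = (enorm x < (s / unit_volume) `^ n%:R^-1).
Proof.
move=> s0; have v0 := unit_volume_gt0.
rewrite -[RHS](@ltr_pXn2r _ n)// ?nnegrE ?enorm_ge0 ?powR_ge0//.
rewrite -[X in _ = (_ < X)]powR_mulrn ?powR_ge0// -powRrM mulVf ?pnatr_eq0 -?lt0n//.
by rewrite powRr1 ?divr_ge0 ?ltW// ltr_pdivlMr// mulrC.
Qed.

Lemma lebesgue_volume_rad_lt s :
  leb [set x | volume_rad x < s] = (Num.max 0 s)%:E.
Proof.
have v0 := unit_volume_gt0.
have [s0|s0] := leP s 0.
  rewrite (_ : [set x | _] = set0) ?measure0//.
  by apply/seteqP; split => // x /=; rewrite ltNge (le_trans s0)// volume_rad_ge0.
rewrite (_ : [set x | _] = eball ((s / unit_volume) `^ n%:R^-1)); last first.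
  by apply/seteqP; split => x /=; rewrite volume_rad_lt.
rewrite lebesgue_eball ?powR_gt0 ?divr_gt0//.
rewrite -[X in _ * X]powR_mulrn ?powR_ge0// -powRrM mulVf ?pnatr_eq0 -?lt0n//.
by rewrite powRr1 ?divr_ge0 ?ltW// mulrC divfK// gt_eqF.
Qed.

(** Both sides are measures in [A] that agree on the rays []-oo, s[], by the volume of balls, and
    rays form a generating family stable under intersection. This change of variable takes the place
    of polar coordinates. *)
Lemma lebesgue_volume_rad (A : set (measurableTypeR R)) : measurable A ->
  leb (volume_rad @^-1` A) = lebesgue_measure (A `&` `[0, +oo[%classic).
Proof.
move=> mA.
have mv : measurable_fun setT (volume_rad : 'rV[R]_n -> measurableTypeR R).
  exact: measurable_volume_rad.
pose m1 : {measure set (measurableTypeR R) -> \bar R} :=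
  measure_function_pushforward__canonical__measure_function_Measure
  leb mv.
have mI : measurable (`[0, +oo[%classic : set (measurableTypeR R)) by exact: measurable_itv.
pose m2 : {measure set (measurableTypeR R) -> \bar R} := mrestr (@lebesgue_measure R) mI.
have ray s : pushforward leb volume_rad `]-oo, s[%classic = (Num.max 0 s)%:E.
  rewrite /pushforward -lebesgue_volume_rad_lt.
  by rewrite (_ : volume_rad @^-1` _ = [set x | volume_rad x < s]).
have ray2 s : lebesgue_measure (`]-oo, s[%classic `&` `[0, +oo[%classic) = (Num.max 0 s)%:E :> \bar R.
  rewrite (_ : _ `&` _ = `[0, s[%classic); last first.
    apply/seteqP; split => t /=; rewrite !in_itv/= ?andbT.
      by move=> [-> ->].
    by move=> /andP[-> ->].
  rewrite lebesgue_measure_itv/= lte_fin sube0; case: ltP => // h.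
suff : m1 A = m2 A by [].
apply: (@measure_unique _ R (measurableTypeR R) (@RGenInftyO.G R) (fun k => `]-oo, k%:R[%classic)) => //.
- exact: RGenInftyO.measurableE.
- move=> _ _ [x ->] [y ->]; exists (Num.min x y).
  apply/seteqP; split => t /=; rewrite !in_itv/= lt_min.
    by move=> [-> ->].
  by move=> /andP.
- by move=> k; eexists.
- apply/seteqP; split => // t _; exists (Num.truncn `|t|).+1 => //=.
  by rewrite in_itv/= (le_lt_trans (ler_norm _))// truncnS_gt.
- by move=> _ [s ->]; rewrite -[LHS]/(pushforward leb volume_rad _) ray -[RHS]/(lebesgue_measure _) ray2.
- by move=> k; rewrite -[X in (X < _)%E]/(pushforward leb volume_rad _) ray ltry.
Qed.

End euclidean_norm.

Section radial_integrals.
Context {R : realType} {n : nat} (n0 : (0 < n)%N).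
Local Notation leb := (@lebesgue_rV R n).
Local Notation mu := (@lebesgue_measure R).
Local Notation T := (@volume_rad R n).

Let D : set (measurableTypeR R) := `[0, +oo[%classic.
Let mD : measurable D. Proof. exact: measurable_itv. Qed.

Let mT : measurable_fun setT (T : 'rV[R]_n -> measurableTypeR R).
Proof. exact: measurable_volume_rad. Qed.

Let preD : T @^-1` D = setT.
Proof.
by apply/seteqP; split => x // _; rewrite /D /= in_itv/= volume_rad_ge0.
Qed.

Lemma ge0_integral_volume_rad (h : R -> \bar R) :
  measurable_fun setT (h : measurableTypeR R -> \bar R) -> (forall t, 0 <= h t)%E ->
  (\int[leb]_x h (T x) = \int[mu]_(t in `[0%R, +oo[) h t)%E.
Proof.
move=> mh h0.
have := @ge0_integral_pushforward _ _ _ _ _ _ mT leb D h mD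
  (measurable_funS measurableT (@subsetT _ _) mh) (fun t _ => h0 t).
rewrite preD => <-; apply: eq_measure_integral => A mA AD.
rewrite [LHS](lebesgue_volume_rad n0 mA) setIidl//.
Qed.

Lemma integral_volume_rad (h : R -> \bar R) :
  measurable_fun setT (h : measurableTypeR R -> \bar R) ->
  leb.-integrable setT (h \o T) ->
  (\int[leb]_x h (T x) = \int[mu]_(t in `[0%R, +oo[) h t)%E.
Proof.
move=> mh hi.
have := @integral_pushforward _ _ _ _ _ _ mT leb D h mh.
rewrite preD => /(_ hi mD) <-; apply: eq_measure_integral => A mA AD.
rewrite [LHS](lebesgue_volume_rad n0 mA) setIidl//.
Qed.

Lemma ae_volume_rad (P : R -> Prop) :
  {ae mu, forall t, P t} -> {ae leb, forall x, P (T x)}.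
Proof.
move=> [A [mA A0 PA]]; exists (T @^-1` A); split.
- by rewrite -[X in measurable X]setTI; exact: mT.
- rewrite [LHS](lebesgue_volume_rad n0 mA); apply: subset_measure0 A0 => //.
  exact: measurableI.
- by move=> x Px; apply: PA.
Qed.

End radial_integrals.

Lemma Rintegral_sum d (T : measurableType d) (R : realType)
    (mu : {measure set T -> \bar R}) (I : Type) (s : seq I) (f : I -> T -> R) :
  (forall i, mu.-integrable setT (EFin \o f i)) ->
  \int[mu]_x (\sum_(i <- s) f i x) = \sum_(i <- s) \int[mu]_x (f i x).
Proof.
move=> fi; elim: s => [|i s IH].
  rewrite big_nil (_ : (fun x => _) = cst 0); last by apply/funext => x; rewrite big_nil.
  by rewrite /Rintegral integral0.
rewrite big_cons -IH -RintegralD//.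
  by congr Rintegral; apply/funext => x; rewrite big_cons.
have := @integrable_sum _ _ _ mu setT measurableT _ s xpredT
  (fun i => EFin \o f i) (fun i _ => fi i).
by congr (_.-integrable _ _); apply/funext => x /=; rewrite sumEFin.
Qed.

(** * Radial test fields with divergence a multiple of [psi'] *)

Section radial_field.
Context {R : realType} {n : nat} (n2 : (2 <= n)%N).
Local Notation leb := (@lebesgue_rV R n).
Local Notation T := (@volume_rad R n).
Local Notation v := (@unit_volume R n).
Variables (psi psi' : R -> R) (L a b : R).
Hypotheses (Cpsi : forall m, Ck1 R m psi)
  (dpsi : forall t : R, is_derive t 1 psi (psi' t))
  (psi1 : forall t, `|psi t| <= 1)
  (L1 : 1 <= L) (La : v * L ^+ n <= a) (ab : a <= b)
  (psi0 : forall t, ~ (a <= t <= b) -> psi t = 0).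

Let n0 : (0 < n)%N. Proof. exact: leq_trans n2. Qed.
Let v0 : 0 < v. Proof. exact: unit_volume_gt0. Qed.
Let L0 : 0 < L. Proof. exact: lt_le_trans L1. Qed.
Let a0 : 0 < a. Proof. by apply: lt_le_trans La; rewrite mulr_gt0// exprn_gt0. Qed.
(** Half the dimension, because the field is written in terms of [|x|^2], a polynomial in the
    coordinates: [(|x|^2)^q = |x|^n]. *)
Let q : R := n%:R / 2.
Let q0 : 0 < q. Proof. by rewrite divr_gt0// ltr0n. Qed.

Let psi_lt t : t < a -> psi t = 0.
Proof. by move=> ta; apply: psi0 => /andP[at' _]; move: ta; rewrite ltNge at'. Qed.

Let sqr_powR (r : R) : 0 <= r -> (r ^+ 2) `^ q = r ^+ n.
Proof.
move=> r0; rewrite -(powR_mulrn 2 r0) -powRrM /q mulrC divfK ?pnatr_eq0//.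
by rewrite powR_mulrn.
Qed.

Let S (x : 'rV[R]_n) : R := \sum_(i < n) x ord0 i ^+ 2.
Let H := comp_powR psi v q (- q).

(* The field psi(T x) x / |x|^n, with T x the volume of the ball of radius |x|. *)
Definition radial_field (i : 'I_n) (x : 'rV[R]_n) : R :=
  x ord0 i * comp_powR psi v q (- q) (\sum_(i < n) x ord0 i ^+ 2).

Let SE x : S x = enorm x ^+ 2. Proof. by rewrite enorm_sqr. Qed.

Let fieldE i x : 0 < enorm x -> radial_field i x = x ord0 i * (psi (T x) / enorm x ^+ n).
Proof.
move=> x0; rewrite /radial_field -/(S x) SE /comp_powR exprn_gt0//.
by rewrite powRN sqr_powR ?enorm_ge0.
Qed.

Let T_gt_a x : a <= T x -> L <= enorm x.
Proof.
move=> aT; rewrite -(@ler_pXn2r _ n)// ?nnegrE ?enorm_ge0 ?(ltW L0)//.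
by rewrite -(ler_pM2l v0) (le_trans La).
Qed.

Lemma radial_field_out i x : ~ (a <= T x <= b) -> radial_field i x = 0.
Proof.
move=> xab; have [x0|x0] := ltP 0 (enorm x).
  by rewrite fieldE// psi0// mul0r mulr0.
rewrite /radial_field -/(S x) SE /comp_powR ifF ?mulr0//.
have -> : enorm x = 0 by apply/eqP; rewrite eq_le x0 enorm_ge0.
by rewrite expr0n ltxx.
Qed.

(** On the support [|x| >= L >= 1], so [|x_i| / |x|^n <= |x|^(1-n) <= 1 / |x| <= 1 / L]; the middle
    step uses [n >= 2]. *)
Lemma radial_field_le i x : `|radial_field i x| <= L^-1 * \1_[set x | a <= T x <= b] x.
Proof.
rewrite indicE; have [|] := boolP (x \in _) => xab; last first.
  by rewrite mulr0 radial_field_out ?normr0//; move: xab; rewrite notin_setE.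
rewrite mulr1; move: xab => /set_mem/= /andP[aT Tb].
have Lx := T_gt_a aT; have x0 : 0 < enorm x by exact: lt_le_trans Lx.
rewrite fieldE// !normrM.
apply: (@le_trans _ _ (enorm x * (1 * `|(enorm x ^+ n)^-1|))).
  apply: ler_pM => //; first exact: enorm_coord.
  by rewrite ler_wpM2r.
rewrite mul1r ger0_norm ?invr_ge0 ?exprn_ge0 ?enorm_ge0//.
have -> : enorm x ^+ n = enorm x * enorm x ^+ n.-1 by rewrite -exprS prednK.
rewrite invfM mulrA divff ?gt_eqF// mul1r.
rewrite lef_pV2 ?posrE ?exprn_gt0//.
apply: le_trans Lx _; apply: ler_eXnr; last exact: le_trans L1 (T_gt_a aT).
by case: (n) n2 => [|[]].
Qed.

Lemma test_function_radial_field i : test_function (radial_field i).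
Proof.
apply/test_functionP; split => [m|].
  apply: CkM; first exact: Ck_coord.
  have CS : CkrV n m (fun x : 'rV[R]_n => \sum_(i < n) x ord0 i ^+ 2).
    by apply: Ck_sum => j; exact: (CkM (Ck_coord m j) (Ck_coord m j)).
  exact: (Ck_comp (Ck_comp_powR m (- q) a0 v0 q0 psi_lt Cpsi) CS).
exists (1 + b / v) => [|x xM].
  by rewrite addr_ge0// divr_ge0// ?(ltW v0)// (le_trans (ltW a0)).
apply: radial_field_out => /andP[_]; apply/negP; rewrite -ltNge.
have x1 : 1 + b / v < enorm x := lt_le_trans xM (rV_norm_enorm x).
have bv : 0 <= b / v by rewrite divr_ge0 ?(ltW v0)// (le_trans (ltW a0)).
rewrite /volume_rad mulrC -ltr_pdivrMr//.
apply: (@lt_le_trans _ _ (enorm x)); first by apply: le_lt_trans x1; rewrite lerDr.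
by rewrite ler_eXnr//; apply: le_trans (ltW x1); rewrite lerDl.
Qed.

(** The field x / |x|^n is divergence free away from 0, and the gradient of [T] is
    [n v |x|^(n-2) x]; its scalar product with x / |x|^n is the constant [n v]. *)
Lemma divergence_radial_field x :
  \sum_(i < n) partial i (radial_field i) x = n%:R * v * psi' (T x).
Proof.
have pE i : partial i (radial_field i) x = H (S x) + x ord0 i ^+ 2 * (2 *
    (v * q * comp_powR psi' v q (q - 1 - q) (S x) - q * comp_powR psi v q (- q - 1) (S x))).
  apply: derive_partial.
  have dc (j : 'I_n) : is_derive x (delta_mx ord0 i) (fun x : 'rV[R]_n => x ord0 j) (j == i)%:R.
    apply/is_derive_line.
    have -> : (fun t : R => (t *: delta_mx ord0 i + x) ord0 j) =
        (fun t => (j == i)%:R * t + x ord0 j).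
      by apply/funext => t; rewrite !mxE eqxx/= mulrC.
    have := is_deriveD (is_deriveZ ((j == i)%:R : R) (is_derive_id (0 : R) (1 : R)))
      (is_derive_cst (x ord0 j) (0 : R) (1 : R)).
    by rewrite scaleRE mulr1 addr0; exact.
  have dS : is_derive x (delta_mx ord0 i) S (2 * x ord0 i).
    have -> : S = \sum_(j < n) (fun x : 'rV[R]_n => x ord0 j * x ord0 j).
      by apply/funext => y; rewrite fct_sumE; apply: eq_bigr => j _; rewrite expr2.
    have Dd : \sum_(j < n) (x ord0 j *: (j == i)%:R + x ord0 j *: (j == i)%:R) =
        2 * x ord0 i :> R.
      rewrite (bigD1 i)//= big1; last by move=> j /negbTE ->; rewrite scaler0 addr0.
      by rewrite eqxx scaleRE mulr1 addr0 -mulr2n mulr_natl.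
    by have := is_derive_sum (fun j : 'I_n => is_deriveM (dc j) (dc j)); rewrite Dd; exact.
  have dH := is_derive_compR (is_derive_comp_powR (- q) (S x) a0 v0 q0 psi_lt dpsi) dS.
  have := is_deriveM (dc i) dH; rewrite eqxx !scaleRE mulr1 mulNr.
  by move=> dM; apply: (is_derive_eq dM); rewrite /= /H; ring.
under eq_bigr do rewrite pE.
rewrite big_split/= sumr_const card_ord -mulr_suml -/(S x).
(* At the origin both sides vanish, because [psi], and hence [psi'], is zero below [a > 0]. *)
have [x0|x0] := ltP 0 (enorm x); last first.
  have e0 : enorm x = 0 by apply/eqP; rewrite eq_le x0 enorm_ge0.
  have S0 : S x = 0 by rewrite SE e0 expr0n.
  rewrite S0 /H /comp_powR ltxx mul0rn mul0r addr0.
  rewrite (derive_eq0_lt psi_lt dpsi) ?mulr0//.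
  by rewrite /volume_rad e0 expr0n gtn_eqF// mulr0.
have Sp : 0 < S x by rewrite SE exprn_gt0.
rewrite /H /comp_powR Sp.
have -> : (S x) `^ (q - 1 - q) = (S x)^-1.
  rewrite (_ : q - 1 - q = - 1); last by ring.
  by rewrite powR_inv1// ltW.
have -> : (S x) `^ (- q - 1) = (S x) `^ (- q) / S x.
  by rewrite powRB ?powRr1 ?ltW// (gt_eqF Sp) implybT.
have -> : v * S x `^ q = T x by rewrite SE sqr_powR ?enorm_ge0.
rewrite -mulr_natl /q; field.
by rewrite gt_eqF.
Qed.

Variables (u : 'rV[R]_n -> R) (g : 'rV[R]_n -> 'rV[R]_n).
Hypotheses (un : in_Lp n%:R u) (ug : is_weak_gradient n%:R u g)
  (g1 : forall i, (\int[leb]_x (`|g x ord0 i| ^+ n)%:E <= 1)%E).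

(** Testing the i-th component of [g] against the i-th component of the field and summing over i
    gives [n v] times the integral, up to sign. Each of the [n] terms is at most [(b - a + 1) / L]:
    the field is at most [1 / L] on a set of measure [b - a], and there [|g_i| <= 1 + |g_i|^n]. *)
Lemma radial_test_bound :
  leb.-integrable setT (EFin \o (fun x => u x * psi' (T x))) /\
  `|\int[leb]_x (u x * psi' (T x))| <= (b - a + 1) / (v * L).
Proof.
have ti i := test_function_radial_field i.
have tpi i := test_function_partial i (ti i).
have nv0 : 0 < n%:R * v :> R by rewrite mulr_gt0// ltr0n.
have ui i := Lp_test_integrable n0 un (tpi i).
have E x : \sum_(i < n) u x * partial i (radial_field i) x =
    n%:R * v * (u x * psi' (T x)).
  by rewrite -mulr_sumr divergence_radial_field; ring.
have sumi : leb.-integrable setT (EFin \o (fun x => n%:R * v * (u x * psi' (T x)))).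
  have := @integrable_sum _ _ _ leb setT measurableT _ (index_enum 'I_n) xpredT
    (fun i => EFin \o (fun x => u x * partial i (radial_field i) x)) (fun i _ => ui i).
  by congr (_.-integrable _ _); apply/funext => x /=; rewrite sumEFin E.
have upi : leb.-integrable setT (EFin \o (fun x => u x * psi' (T x))).
  have := integrableZl measurableT ((n%:R * v)^-1) sumi.
  congr (_.-integrable _ _); apply/funext => x /=.
  by rewrite -EFinM mulKf// gt_eqF.
split => //.
pose S0 := [set x | a <= T x <= b].
have S0E : S0 = T @^-1` `[a, b]%classic.
  by apply/seteqP; split => x /=; rewrite in_itv.
have mS0 : measurable S0.
  rewrite S0E -[X in measurable X]setTI.
  exact: (measurable_volume_rad measurableT (measurable_itv _)).
have lS0 : leb S0 = (b - a)%:E.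
  have mab : measurable (`[a, b]%classic : set (measurableTypeR R)) by exact: measurable_itv.
  rewrite S0E (lebesgue_volume_rad n0 mab) setIidl; last first.
    by move=> t /=; rewrite !in_itv/= andbT => /andP[/(le_trans (ltW a0))].
  rewrite lebesgue_measure_itv/= lte_fin; case: ltP ab => // ba ab'.
  by congr _%:E; apply/eqP; rewrite eq_sym subr_eq0 eq_le ba ab'.
have gb i : `|\int[leb]_x (g x ord0 i * radial_field i x)| <= L^-1 * (b - a + 1).
  have gi := (ug i).1; have [mg _] := (in_LpP _ n0).1 gi.
  have ii := Lp_test_integrable n0 gi (ti i).
  apply: le_trans (le_normr_Rintegral measurableT ii) _.
  rewrite -lee_fin /Rintegral fineK;
    last exact: (integrable_fin_num measurableT (integrable_norm ii)).
  have mgn : measurable_fun setT (fun x => (`|g x ord0 i| ^+ n)%:E).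
    by apply/measurable_EFinP; apply: measurable_funX; exact: measurableT_comp.
  have mI : measurable_fun setT (fun x => (\1_S0 x)%:E : \bar R).
    by apply/measurable_EFinP; exact: measurable_indic.
  apply: (@le_trans _ _ (\int[leb]_x (L^-1%:E * ((\1_S0 x)%:E + (`|g x ord0 i| ^+ n)%:E)))%E).
    apply: ge0_le_integral => //.
    - apply/measurable_EFinP; apply: measurableT_comp => //.
      by have /measurable_EFinP := measurable_int _ ii.
    - by apply: measurable_funeM; exact: emeasurable_funD.
    - move=> x _; rewrite -EFinD -EFinM lee_fin normrM.
      have h := radial_field_le i x.
      apply: le_trans (ler_wpM2l (normr_ge0 _) h) _.
      rewrite mulrCA ler_wpM2l ?invr_ge0 ?(ltW L0)// -/S0 indicE.
      case: (_ \in _); rewrite ?mulr0 ?add0r ?exprn_ge0// mulr1.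
      exact: ler_1Dexprn.
  rewrite ge0_integralZl//; last 3 first.
  - exact: emeasurable_funD.
  - by move=> x _; rewrite adde_ge0// lee_fin// exprn_ge0.
  - by rewrite lee_fin invr_ge0 ltW.
  rewrite EFinM; apply: lee_wpmul2l; first by rewrite lee_fin invr_ge0 ltW.
  rewrite ge0_integralD//.
  have -> : (\int[leb]_x (\1_S0 x)%:E = (b - a)%:E)%E.
    by rewrite integral_indic// setIT; exact: lS0.
  by apply: le_trans (leeD2l _ (g1 i)) _; rewrite -EFinD.
have e1 : n%:R * v * \int[leb]_x (u x * psi' (T x)) =
    \sum_(i < n) \int[leb]_x (u x * partial i (radial_field i) x).
  rewrite -RintegralZl// -Rintegral_sum//.
  by congr Rintegral; apply/funext => x; rewrite E.
have e2 : \sum_(i < n) \int[leb]_x (u x * partial i (radial_field i) x) =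
    - \sum_(i < n) \int[leb]_x (g x ord0 i * radial_field i x).
  by rewrite -sumrN; apply: eq_bigr => i _; exact: (ug i).2.
rewrite ler_pdivlMr ?mulr_gt0// -(@ler_pM2l _ n%:R) ?ltr0n//.
rewrite [X in X <= _](_ : _ = `|n%:R * v * \int[leb]_x (u x * psi' (T x))| * L); last first.
  by rewrite normrM (gtr0_norm nv0); ring.
rewrite -ler_pdivlMr// e1 e2 normrN.
apply: le_trans (ler_norm_sum _ _ _) _.
apply: le_trans (ler_sum _ (fun i _ => gb i)) _.
rewrite sumr_const card_ord -[X in X <= _]mulr_natl le_eqVlt.
by apply/orP; left; apply/eqP; ring.
Qed.

End radial_field.

Section ae_equal.
Context {R : realType} {n : nat}.
Local Notation leb := (@lebesgue_rV R n).
Implicit Types u : 'rV[R]_n -> R.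

(** With the next lemma, this lets a radial [u] be replaced by the composite of its profile with
    [volume_rad]. *)
Lemma in_Lp_ae N u u' : (0 < N)%N -> measurable_fun setT u' ->
  {ae leb, forall x, u x = u' x} -> in_Lp N%:R u -> in_Lp N%:R u'.
Proof.
move=> N0 mu' uu' /(in_LpP _ N0)[mu uoo]; apply/in_LpP => //; split => //.
rewrite -(@ge0_ae_eq_integral _ _ _ leb setT (fun x => (`|u x| ^+ N)%:E))//.
- by apply/measurable_EFinP; apply: measurable_funX; exact: measurableT_comp.
- by apply/measurable_EFinP; apply: measurable_funX; exact: measurableT_comp.
- by apply: filterS uu' => x ->.
Qed.

Lemma weak_gradient_ae (p : R) u u' g : measurable_fun setT u -> measurable_fun setT u' ->
  {ae leb, forall x, u x = u' x} ->
  is_weak_gradient p u g -> is_weak_gradient p u' g.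
Proof.
move=> mu mu' uu' ug i; have [gp H] := ug i; split => // phi tphi.
rewrite -H//; rewrite /Rintegral; congr fine; apply: ae_eq_integral => //.
- apply/measurable_EFinP; apply: measurable_funM => //.
  by apply: test_function_measurable; exact: test_function_partial.
- apply/measurable_EFinP; apply: measurable_funM => //.
  by apply: test_function_measurable; exact: test_function_partial.
- by apply: filterS uu' => x ->.
Qed.

End ae_equal.

(** * Uniform decay at infinity *)

Section radial_decay.
Context {R : realType} {n : nat} (n2 : (2 <= n)%N).
Local Notation leb := (@lebesgue_rV R n).
Local Notation T := (@volume_rad R n).
Local Notation v := (@unit_volume R n).
Local Notation mu := (@lebesgue_measure R).

Let n0 : (0 < n)%N. Proof. exact: leq_trans n2. Qed.
Let v0 : 0 < v. Proof. exact: unit_volume_gt0. Qed.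

(** The profile is re-expressed in the volume variable. Its value 0 on negative arguments makes
    integrals over the line coincide with integrals over the half-line. *)
Lemma radial_profile u : radially_symmetric u -> exists2 f : R -> R,
  measurable_fun setT f & {ae leb, forall x, u x = f (T x)} /\ forall t, t < 0 -> f t = 0.
Proof.
move=> [f mf uf].
exists (fun s => if 0 <= s then f ((s / v) `^ n%:R^-1) else 0).
  apply: measurable_fun_ifT => //.
    exact: (measurable_fun_ler (measurable_cst (0:R)) (@measurable_id _ _ setT)).
  have mp : measurable_fun setT (fun t : R => t `^ n%:R^-1) by exact: measurable_powR.
  have ms : measurable_fun setT (fun s : R => s / v) by exact: measurable_funM.
  exact: (measurableT_comp mf (measurableT_comp mp ms)).
split; last by move=> t; rewrite ltNge => /negbTE ->.
apply: filterS uf => x ->; rewrite volume_rad_ge0; congr f.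
rewrite /volume_rad mulrAC divff ?gt_eqF// mul1r -powR_mulrn ?enorm_ge0//.
by rewrite -powRrM divff ?powRr1 ?enorm_ge0// pnatr_eq0 -lt0n.
Qed.

Lemma Lp_locally_integrable (f : R -> R) : measurable_fun setT f ->
  (\int[mu]_(t in `[0%R, +oo[) (`|f t| ^+ n)%:E <= 1)%E ->
  (forall t, t < 0 -> f t = 0) -> locally_integrable setT f.
Proof.
move=> mf f1 f0; split => //; first exact: openT.
move=> K _ cK; have mK : measurable (K : set (measurableTypeR R)).
  exact: compact_measurable.
have mfn : measurable_fun setT (fun t => (`|f t| ^+ n)%:E).
  by apply/measurable_EFinP; apply: measurable_funX; exact: measurableT_comp.
have muK : (mu K < +oo)%E by exact: compact_finite_measure.
apply: (@le_lt_trans _ _ (\int[mu]_(x in K) (1 + (`|f x| ^+ n)%:E))%E).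
  apply: ge0_le_integral => //.
  - apply/measurable_EFinP; apply: measurableT_comp => //; exact: measurable_funS mf.
  - by apply: emeasurable_funD => //; exact: measurable_funS mfn.
  - by move=> x _; rewrite -EFinD lee_fin ler_1Dexprn.
rewrite ge0_integralD//; last first.
  - exact: measurable_funS mfn.
rewrite integral_cst// mul1e lte_add_pinfty//.
apply: (@le_lt_trans _ _ (\int[mu]_x (`|f x| ^+ n)%:E)%E).
  by apply: ge0_subset_integral => //.
have -> : (\int[mu]_x (`|f x| ^+ n)%:E = \int[mu]_(t in `[0%R, +oo[) (`|f t| ^+ n)%:E)%E.
  rewrite [in RHS]integral_mkcond; apply: eq_integral => t _; rewrite patchE.
  case: ifPn => //; rewrite notin_setE/= in_itv/= andbT => /negP; rewrite -ltNge => t0.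
  by rewrite f0// normr0 expr0n gtn_eqF.
by apply: le_lt_trans f1 _; rewrite ltry.
Qed.

Lemma radial_decay (delta : R) : 0 < delta -> exists s0 : R,
  forall u : 'rV[R]_n -> R, W1 n%:R u -> radially_symmetric u ->
    W1_energy n%:R u = 1%E ->
    {ae leb, forall x, s0 <= T x -> `|u x| <= delta}.
Proof.
(* One half of [delta] is for the small value of the profile, the other for its oscillation. The
   length [l] is such that the small value satisfies [|f|^n <= 2 / l = d^n], and [L] such that the
   oscillation bound [(l + 3) / (v * L)] is at most [d]. *)
move=> d0; pose d := delta / 2; have dp : 0 < d by rewrite divr_gt0.
pose l := 2 / d ^+ n; have l0 : 0 < l by rewrite divr_gt0// exprn_gt0.
pose L := Num.max 1 ((l + 3) / (v * d)).
have L1 : 1 <= L by rewrite le_max lexx.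
have L0 : 0 < L by exact: lt_le_trans L1.
have Lb : (l + 3) / (v * L) <= d.
  rewrite ler_pdivrMr ?mulr_gt0// mulrA -ler_pdivrMl ?mulr_gt0//.
  by rewrite mulrC (mulrC d) le_max lexx orbT.
have vL0 : 0 <= v * L ^+ n by rewrite mulr_ge0 ?exprn_ge0// ltW.
(* The extra 1 is room for the test profile, whose support starts at [s1 - 1] and must stay where
   [|x| >= L]. *)
exists (v * L ^+ n + 1) => u [un [g ug]] ru uE.
have [f mf [uf f0]] := radial_profile ru.
have [mu_ uoo] := (in_LpP _ n0).1 un.
have mfT : measurable_fun setT (fun x => f (T x)).
  by apply: (measurableT_comp mf); exact: measurable_volume_rad.
have un' := in_Lp_ae n0 mfT uf un.
have ug' := weak_gradient_ae mu_ mfT uf ug.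
have mfn : measurable_fun setT (fun t => (`|f t| ^+ n)%:E).
  by apply/measurable_EFinP; apply: measurable_funX; exact: measurableT_comp.
have mgi i : measurable_fun setT (fun x => g x ord0 i).
  by have [/(in_LpP _ n0)[]] := ug i.
have E := W1_energyE n0 ug; rewrite uE in E.
have I1 : (0 <= \int[leb]_x (enorm (g x) ^+ n)%:E)%E.
  by apply: integral_ge0 => x _; rewrite lee_fin exprn_ge0// enorm_ge0.
have I2 : (0 <= \int[leb]_x (`|u x| ^+ n)%:E)%E.
  by apply: integral_ge0 => x _; rewrite lee_fin exprn_ge0.
have g1 i : (\int[leb]_x (`|g x ord0 i| ^+ n)%:E <= 1)%E.
  rewrite E; apply: le_trans (leeDl _ I2).
  apply: ge0_le_integral => //.
  - by apply/measurable_EFinP; apply: measurable_funX; exact: measurableT_comp.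
  - apply/measurable_EFinP; apply: measurable_funX.
    by apply: (measurableT_comp measurable_enorm); exact: measurable_fun_rV.
  - move=> x _; rewrite lee_fin; apply: lerXn2r; rewrite ?nnegrE ?enorm_ge0//.
    exact: enorm_coord.
have f1 : (\int[mu]_(t in `[0%R, +oo[) (`|f t| ^+ n)%:E <= 1)%E.
  rewrite -(ge0_integral_volume_rad n0 (h := fun t => (`|f t| ^+ n)%:E))//.
  rewrite E; apply: le_trans (leeDr _ I1).
  rewrite (@ge0_ae_eq_integral _ _ _ leb setT (fun x => (`|u x| ^+ n)%:E)
    (fun x => (`|f (T x)| ^+ n)%:E))//.
  - by apply/measurable_EFinP; apply: measurable_funX; exact: measurableT_comp.
  - by apply/measurable_EFinP; apply: measurable_funX; exact: measurableT_comp.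
  - by apply: filterS uf => x ->.
have lf := Lp_locally_integrable mf f1 f0.
have aeL := lebesgue_differentiation lf.
suff : {ae leb, forall x, v * L ^+ n + 1 <= T x -> `|f (T x)| <= delta}.
  by move=> H; apply: filterS2 uf H => x -> /[apply].
apply: (ae_volume_rad n0 (P := fun t => v * L ^+ n + 1 <= t -> `|f t| <= delta)).
move: aeL; apply: filterS; first exact: (ae_filter_ringOfSetsType mu).
move=> s1 l1 s1L.
have s1p : 0 <= s1 by apply: le_trans s1L; rewrite addr_ge0.
have fI : (\int[mu]_(t in `]s1, (s1 + l)%R[) (`|f t| ^+ n)%:E <= 1)%E.
  apply: le_trans f1; apply: ge0_subset_integral => //.
    exact: measurable_funS mfn.
  by move=> t /=; rewrite !in_itv/= andbT => /andP[h _]; rewrite (le_trans s1p)// ltW.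
have [s2 [s12 s2l l2 fs2]] := exists_small_value l0 mf fI (lebesgue_differentiation lf).
have {}fs2 : `|f s2| <= d.
  rewrite -(@ler_pXn2r _ n)// ?nnegrE ?(ltW dp)//; apply: le_trans fs2 _.
  by rewrite /l invf_div mulrCA divff ?mulr1.
have osc : `|f s1 - f s2| <= (l + 3) / (v * L).
  apply: (lebesgue_pt_oscillation lf l1 l2 (ltW s12)) => psi psi' Cpsi dpsi psi1 psi0.
  have La : v * L ^+ n <= s1 - 1 by rewrite lerBrDr.
  have ab : s1 - 1 <= s2 + 1 by lra.
  have [ii B] := radial_test_bound n2 Cpsi dpsi psi1 L1 La ab psi0 un' ug' g1.
  have mpsi' : measurable_fun setT psi'.
    have [_ [h /(_ tt)[dh [ch _]]]] := Cpsi 1%N.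
    have -> : psi' = h tt by apply/funext => t; have [_ <-] := dpsi t; have [_ <-] := dh t.
    exact: continuous_measurable_fun.
  have -> : \int[mu]_s (f s * psi' s) = \int[leb]_x (f (T x) * psi' (T x)).
    rewrite /Rintegral; congr fine.
    rewrite (integral_volume_rad n0 (h := fun t => (f t * psi' t)%:E))//; last first.
      by apply/measurable_EFinP; exact: measurable_funM.
    rewrite [in RHS]integral_mkcond; apply: eq_integral => t _; rewrite patchE.
    case: ifPn => //; rewrite notin_setE/= in_itv/= andbT => /negP; rewrite -ltNge => t0.
    by rewrite f0// mul0r.
  (* With [a = s1 - 1] and [b = s2 + 1] the numerator [b - a + 1] is [s2 - s1 + 3], and
     [s2 < s1 + l]. *)
  apply: le_trans B _; rewrite ler_wpM2r ?invr_ge0 ?mulr_ge0 ?ltW//.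
  by lra.
rewrite -(subrK (f s2) (f s1)); apply: le_trans (ler_normD _ _) _.
apply: le_trans (lerD (le_trans osc Lb) fs2) _.
by rewrite /d; lra.
Qed.

End radial_decay.

(** * The upper bound *)

Section limn_esup_bounds.
Context {R : realType}.
Implicit Types (u : (\bar R)^nat) (c : \bar R).

Lemma limn_esup_le_near u c : (\forall k \near \oo, u k <= c)%E -> (limn_esup u <= c)%E.
Proof.
move=> uc; rewrite /limn_esup /limf_esup.
apply: (@le_trans _ _ (ereal_sup [set u k | k in [set k | (u k <= c)%E]])).
  by apply: ereal_inf_lbound; exists [set k | (u k <= c)%E].
by apply: ge_ereal_sup => _ [k /= kc <-].
Qed.

Lemma limn_esup_ge_near u c : (\forall k \near \oo, c <= u k)%E -> (c <= limn_esup u)%E.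
Proof.
move=> uc; rewrite /limn_esup /limf_esup; apply: le_ereal_inf_tmp => _ [V /= oV <-].
have [k [/= ck Vk]] : exists k, (c <= u k)%E /\ V k.
  have := filterI uc oV; move=> [m _ mP]; exists m.
  by have [] := mP m (leqnn m).
by apply: (le_trans ck); apply: ereal_sup_ubound; exists k.
Qed.

End limn_esup_bounds.

Section growth.
Context {R : realType} (N : nat) (beta : R) (F : R -> R) (N2 : (2 <= N)%N).
Hypothesis hF : F_conditions N beta F.

Let N0 : (0 < N)%N. Proof. exact: leq_trans N2. Qed.

Lemma F_ge0 t : 0 <= F t.
Proof. by have /andP[] := F_bounds hF t. Qed.

(** The upper bound on [F 0] is [Phi 0], and for [N >= 2] the constant term of the truncated sum
    cancels [exp 0]. *)
Lemma F0 : F 0 = 0.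
Proof.
have N1 : N%:R - 1 != 0 :> R.
  by rewrite subr_eq0 (eqr_nat R N 1) gtn_eqF.
apply/eqP; rewrite eq_le F_ge0 andbT.
have /andP[_] := F_bounds hF 0.
rewrite normr0 powR0 ?mulr0; last by rewrite mulf_neq0 ?invr_eq0// pnatr_eq0 -lt0n.
move=> /le_trans; apply; rewrite /Phi expR0.
case: (N) N2 => [|[|m]]// _; rewrite big_ord_recl/= expr0 fact0 divr1.
by rewrite big1 ?addr0 ?subrr// => i _; rewrite expr0n/= mul0r.
Qed.

Lemma measurable_F : measurable_fun setT F.
Proof.
apply: continuous_measurable_fun => t.
by apply/differentiable_continuous/derivable1_diffP; have [] := F_C1 hF.
Qed.

Lemma F_near0 (e : R) : 0 < e -> exists2 d : R, 0 < d & forall t, `|t| <= d ->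
  (C_F N F - e) * `|t| ^+ N <= F t <= (C_F N F + e) * `|t| ^+ N.
Proof.
move=> e0; have cF : power_ratio N F t @[t --> 0^'] --> C_F N F := F_cvg_0 hF.
have /cvgrPdist_le/(_ e e0)[d /= d0 Hd] := cF.
exists (d / 2) => [|t td]; first by rewrite divr_gt0.
(* The limit defining [C_F] ignores [t = 0], where the claim is [F 0 = 0]. *)
have [->|t0] := eqVneq t 0; first by rewrite F0 normr0 expr0n gtn_eqF// !mulr0 lexx.
have := Hd t; rewrite /= distrC subr0 => /(_ _ t0).
have td' : `|t| < d by apply: le_lt_trans td _; lra.
move=> /(_ td'); rewrite /power_ratio.
have tN : 0 < `|t| ^+ N by rewrite exprn_gt0// normr_gt0.
rewrite ler_norml => /andP[h1 h2].
have E : F t = (`|t| ^- N * F t) * `|t| ^+ N by rewrite mulrAC mulVf ?mul1r// gt_eqF.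
by rewrite E; apply/andP; split; apply: ler_wpM2r; rewrite ?(ltW tN)//; lra.
Qed.

Lemma C_F_ge0 : 0 <= C_F N F.
Proof.
rewrite leNgt; apply/negP => C0.
have [d d0 Hd] := @F_near0 (- (C_F N F) / 2) ltac:(lra).
have /andP[_] := Hd d ltac:(by rewrite gtr0_norm).
apply/negP; rewrite -ltNge; apply: lt_le_trans (F_ge0 d).
rewrite nmulr_rlt0 ?exprn_gt0 ?normr_gt0 ?gt_eqF//; lra.
Qed.

End growth.

Section upper_bound.
Context {R : realType} (N : nat) (beta : R) (F : R -> R) (N2 : (2 <= N)%N)
  (beta01 : 0 <= beta < 1).
Hypothesis hF : F_conditions N beta F.
Local Notation leb := (@lebesgue_rV R N).
Local Notation T := (@volume_rad R N).
Local Notation v := (@unit_volume R N).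

Let N0 : (0 < N)%N. Proof. exact: leq_trans N2. Qed.
Let v0 : 0 < v. Proof. exact: unit_volume_gt0. Qed.

Lemma measurable_F_integrand (u : 'rV[R]_N -> R) : measurable_fun setT u ->
  measurable_fun setT (fun x => (enorm x `^ (- (N%:R * beta)) * F (u x))%:E).
Proof.
move=> mu; apply/measurable_EFinP; apply: measurable_funM.
  apply: (measurableT_comp (f := fun t : R => t `^ (- (N%:R * beta)))).
    exact: measurable_powR.
  exact: measurable_enorm.
by apply: measurableT_comp mu; exact: measurable_F hF.
Qed.

(** Outside a large ball [|u|] is within the range where [F] is compared with its N-th power; the
    weight is at most its value at radius [r], and unit energy bounds the integral of [|u|^N] by 1.
    The radius [r0] depends on [e] but not on [u], so it serves a whole sequence. *)
Lemma F_integral_setC (e : R) : 0 < e -> exists r0 : R,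
  forall (r : R) (u : 'rV[R]_N -> R), r0 <= r -> 0 < r ->
    W1 N%:R u -> radially_symmetric u -> W1_energy N%:R u = 1%E ->
    (F_integral beta F (~` eball r) u <=
     (r `^ (- (N%:R * beta)) * (C_F N F + e))%:E)%E.
Proof.
move=> e0; have [d d0 Hd] := F_near0 N2 hF e0.
have [s0 Hs0] := radial_decay N2 d0.
(* For [|x| >= r >= 1] one has [T x = v |x|^N >= v |x| >= s0], so the decay estimate applies. *)
exists (Num.max 1 (s0 / v)) => r u; rewrite ge_max => /andP[r1 rs0] rp Wu ru uE.
have [un [g ug]] := Wu; have [mu uoo] := (in_LpP _ N0).1 un.
have Ce : 0 <= C_F N F + e by rewrite addr_ge0 ?(ltW e0)// (C_F_ge0 N2 hF).
have mur : measurable (~` @eball R N r) by apply: measurableC; exact: measurable_eball.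
pose k := r `^ (- (N%:R * beta)) * (C_F N F + e).
have k0 : 0 <= k by rewrite mulr_ge0 ?powR_ge0.
have muN : measurable_fun setT (fun x => (`|u x| ^+ N)%:E).
  by apply/measurable_EFinP; apply: measurable_funX; exact: measurableT_comp.
apply: (@le_trans _ _ (\int[leb]_(x in ~` eball r) (k%:E * (`|u x| ^+ N)%:E))%E).
  apply: ae_ge0_le_integral => //.
  - by move=> x _; rewrite lee_fin mulr_ge0 ?powR_ge0// (F_ge0 hF).
  - by apply: measurable_funS (measurable_F_integrand mu).
  - by move=> x _; rewrite -EFinM lee_fin mulr_ge0// exprn_ge0.
  - by apply: measurable_funeM; exact: measurable_funS muN.
  apply: filterS (Hs0 u Wu ru uE) => x Hx /negP; rewrite -leNgt => rx.
  rewrite -EFinM lee_fin /k -mulrA; apply: ler_pM; rewrite ?powR_ge0 ?(F_ge0 hF)//.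
    rewrite !powRN lef_pV2 ?posrE ?powR_gt0// ?(lt_le_trans rp rx)//.
    apply: ge0_ler_powR; rewrite ?nnegrE ?(ltW rp) ?enorm_ge0//.
    by rewrite mulr_ge0//; case/andP: beta01.
  have ud : `|u x| <= d.
    apply: Hx; rewrite /volume_rad mulrC -ler_pdivrMr//.
    apply: (le_trans rs0); apply: (le_trans rx).
    by apply: ler_eXnr => //; exact: le_trans r1 rx.
  by have /andP[_] := Hd (u x) ud.
rewrite ge0_integralZl//; last first.
  exact: measurable_funS muN.
rewrite -[X in (_ <= X)%E]mule1; apply: lee_wpmul2l; first by rewrite lee_fin.
apply: (@le_trans _ _ (\int[leb]_x (`|u x| ^+ N)%:E)%E).
  by apply: ge0_subset_integral.
rewrite -uE (W1_energyE N0 ug) leeDr//.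
by apply: integral_ge0 => x _; rewrite lee_fin exprn_ge0// enorm_ge0.
Qed.

Lemma F_integral_split (r : R) (u : 'rV[R]_N -> R) : measurable_fun setT u ->
  (F_integral beta F setT u =
   F_integral beta F (eball r) u + F_integral beta F (~` eball r) u)%E.
Proof.
move=> mu; rewrite /F_integral -ge0_integral_setU//.
- by rewrite setUv.
- exact: measurable_eball.
- by apply: measurableC; exact: measurable_eball.
- by apply: measurable_funS (measurable_F_integrand mu).
- by move=> x _; rewrite lee_fin mulr_ge0 ?powR_ge0// (F_ge0 hF).
- by apply/disj_setPCl.
Qed.

Lemma RNVS_limn_esup_le (u_ : nat -> 'rV[R]_N -> R) : RNVS beta F u_ ->
  (limn_esup (fun k => F_integral beta F setT (u_ k)) <=
   if beta == 0%R then (C_F N F)%:E else 0)%E.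
Proof.
move=> ru; have mu k : measurable_fun setT (u_ k).
  by have [/(in_LpP _ N0)[]] := RNVS_W1 ru k.
(* At fixed [r] the integral over the ball is eventually below [e] by the vanishing condition; what
   remains is the outer bound, uniform along the sequence. *)
have key (e r : R) : 0 < e -> 0 < r ->
    (forall k, F_integral beta F (~` eball r) (u_ k) <=
       (r `^ (- (N%:R * beta)) * (C_F N F + e))%:E)%E ->
    (limn_esup (fun k => F_integral beta F setT (u_ k)) <=
     (e + r `^ (- (N%:R * beta)) * (C_F N F + e))%:E)%E.
  move=> e0 r0 Hr; apply: limn_esup_le_near.
  have ee : (0 < e%:E)%E by rewrite lte_fin.
  have Hr0 : \forall k \near \oo, (F_integral beta F (eball r) (u_ k) < e%:E)%E.
    exact: (RNVS_vanishing ru r0 (open_ereal_lt' ee)).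
  apply: filterS Hr0 => k /= /ltW Hk.
  by rewrite (F_integral_split r (mu k)) EFinD leeD.
case: ifPn => [/eqP b0|b0].
  apply/lee_addgt0Pr => e e0.
  have e2 : 0 < e / 2 by rewrite divr_gt0.
  have [r0 Hr0] := F_integral_setC e2.
  pose r := Num.max 1 r0; have r1 : 0 < r by rewrite lt_max ltr01.
  have := key (e / 2) r e2 r1; rewrite b0 mulr0 oppr0 powRr0 mul1r.
  rewrite -EFinD (_ : e / 2 + (C_F N F + e / 2) = C_F N F + e); last by field.
  apply => k; have := Hr0 r (u_ k).
  rewrite b0 mulr0 oppr0 powRr0 mul1r; apply => //.
  - by rewrite le_max lexx orbT.
  - exact: RNVS_W1 ru k.
  - exact: RNVS_radial ru k.
  - exact: RNVS_normalized ru k.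
apply/lee_addgt0Pr => e e0; rewrite add0e.
have bp : 0 < N%:R * beta.
  by rewrite mulr_gt0 ?ltr0n// lt_def b0; case/andP: beta01.
have e2 : 0 < e / 2 by rewrite divr_gt0.
have [r0 Hr0] := F_integral_setC e2.
have C0 := C_F_ge0 N2 hF.
have Ce : 0 < C_F N F + e / 2 by rewrite ltr_wpDl.
(* Once [r^(N beta) >= K], the weight times [C_F N F + e / 2] is at most [e / 2]. *)
pose K := (C_F N F + e / 2) / (e / 2); have K0 : 0 < K by rewrite divr_gt0.
pose r := Num.max 1 (Num.max r0 (K `^ (N%:R * beta)^-1)).
have r1 : 0 < r by rewrite lt_max ltr01.
have rK : K <= r `^ (N%:R * beta).
  have K1 : K = (K `^ (N%:R * beta)^-1) `^ (N%:R * beta).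
    by rewrite -powRrM mulVf ?gt_eqF// powRr1 ?ltW.
  rewrite [leLHS]K1.
  apply: ge0_ler_powR; rewrite ?nnegrE ?powR_ge0 ?(ltW r1) ?(ltW bp)//.
  by rewrite !le_max lexx !orbT.
apply: le_trans (key (e / 2) r e2 r1 _) _ => [k|].
  apply: Hr0 => //.
  - by rewrite !le_max lexx orbT.
  - exact: RNVS_W1 ru k.
  - exact: RNVS_radial ru k.
  - exact: RNVS_normalized ru k.
rewrite lee_fin [leRHS](splitr e) lerD2l powRN [leLHS]mulrC ler_pdivrMr ?powR_gt0//.
by move: rK; rewrite /K ler_pdivrMr// [X in _ <= X -> _]mulrC.
Qed.

End upper_bound.

(** * A sequence attaining the bound *)

Section annular_bump.
Context {R : realType} {n : nat} (n0 : (0 < n)%N).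
Local Notation leb := (@lebesgue_rV R n).
Implicit Types (c : R) (x : 'rV[R]_n).

(** Squaring keeps the function smooth in [x]; the bounds 1 and 4 on the square correspond to the
    annulus [1 < c |x| < 2]. *)
Definition annular_bump c x : R := smooth_bump 1 1 4 ((c * enorm x) ^+ 2).

Lemma annular_bump_scale c x : 0 <= c -> annular_bump c x = annular_bump 1 (c *: x).
Proof. by move=> c0; rewrite /annular_bump enormZ// mul1r. Qed.

Lemma annular_bump_ge0 c x : 0 <= annular_bump c x.
Proof. exact: smooth_bump_ge0. Qed.

Lemma annular_bump_le1 c x : annular_bump c x <= 1.
Proof. exact: smooth_bump_le1. Qed.

Lemma annular_bump_out c x : 0 <= c -> ~~ (1 <= c * enorm x <= 2) -> annular_bump c x = 0.
Proof.
move=> c0 h; apply: smooth_bump_eq0; apply: contra h => /andP[h1 h2].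
have ce : 0 <= c * enorm x by rewrite mulr_ge0// enorm_ge0.
by apply/andP; split; rewrite -(@ler_pXn2r _ 2)// ?nnegrE// ?expr1n ltW//;
  apply: lt_le_trans h2 _; rewrite expr2; lra.
Qed.

Lemma test_function_annular_bump c : 0 < c -> test_function (annular_bump c : 'rV[R]_n -> R).
Proof.
move=> c0; apply/test_functionP; split => [m|].
  have CS : CkrV n m (fun x : 'rV[R]_n => c ^+ 2 * \sum_(i < n) x ord0 i ^+ 2).
    apply: CkM; first exact: Ck_cst.
    by apply: Ck_sum => j; exact: (CkM (Ck_coord m j) (Ck_coord m j)).
  have -> : annular_bump c = smooth_bump 1 1 4 \o
      (fun x : 'rV[R]_n => c ^+ 2 * \sum_(i < n) x ord0 i ^+ 2).
    by apply/funext => x; rewrite /annular_bump/= exprMn enorm_sqr.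
  exact: (Ck_comp (Ck_smooth_bump m 1 1 4) CS).
exists (2 / c) => [|x xc]; first by rewrite divr_ge0// ltW.
apply: annular_bump_out; first exact: ltW.
rewrite negb_and -!ltNge; apply/orP; right.
by rewrite mulrC -ltr_pdivrMr//; apply: lt_le_trans xc (rV_norm_enorm x).
Qed.

Lemma partial_annular_bump c i x : 0 < c ->
  partial i (annular_bump c) x = c * partial i (annular_bump 1) (c *: x).
Proof.
move=> c0; apply: derive_partial; apply/is_derive_line.
have /is_derive_line d1 := is_derive_partial i (c *: x) (test_function_annular_bump ltr01).
have -> : (fun t : R => annular_bump c (t *: delta_mx ord0 i + x)) =
    (fun t : R => annular_bump 1 (t *: delta_mx ord0 i + c *: x)) \o (fun t : R => c * t).
  by apply/funext => t /=; rewrite annular_bump_scale ?(ltW c0)// scalerDr scalerA.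
rewrite mulrC; apply: is_derive1_comp; first by rewrite mulr0.
by have := is_deriveZ c (is_derive_id (0:R) (1:R)); rewrite scaleRE mulr1.
Qed.

Lemma partial_annular_bump_out c i x : 0 < c -> ~~ (1 <= c * enorm x <= 2) ->
  partial i (annular_bump c) x = 0.
Proof.
move=> c0 h; rewrite /partial (near_eq_derive (g := cst (0:R))) ?derive_cst//.
have ce : continuous (fun y : 'rV[R]_n => c * enorm y).
  move=> y; apply: (@continuousM _ _ (cst c) (@enorm R n)); first exact: cst_continuous.
  have cS : {for y, continuous (fun y : 'rV[R]_n => \sum_(i < n) y ord0 i ^+ 2)}.
    have : Ck (fun i : 'I_n => delta_mx ord0 i : 'rV[R]_n) 0
        (fun y : 'rV[R]_n => \sum_(i < n) y ord0 i ^+ 2).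
      by apply: Ck_sum => j; exact: (CkM (Ck_coord 0 j) (Ck_coord 0 j)).
    by case => H _; exact: H.
  by apply: continuous_comp => //; exact: sqrt_continuous.
move: h; rewrite negb_and -!ltNge => /orP[h|h].
  near=> y; apply: annular_bump_out; first exact: ltW.
  rewrite negb_and -!ltNge; apply/orP; left; near: y.
  exact: (cvgr_lt _ (ce x)).
near=> y; apply: annular_bump_out; first exact: ltW.
rewrite negb_and -!ltNge; apply/orP; right; near: y.
exact: (cvgr_gt _ (ce x)).
Unshelve. all: by end_near. Qed.

(** Otherwise the bump would vanish almost everywhere, although it is positive on the open annulus
    between radii 1 and 2, of volume [v * (2^n - 1) > 0]. *)
Lemma annular_bump_Lnorm_gt0 : (0 < \int[leb]_x (`|annular_bump 1 x| ^+ n)%:E)%E.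
Proof.
rewrite lt_def integral_ge0 ?andbT; last by move=> x _; rewrite lee_fin exprn_ge0.
have tb : test_function (annular_bump 1 : 'rV[R]_n -> R) by exact: test_function_annular_bump.
have mN : measurable_fun setT (fun x : 'rV[R]_n => (`|annular_bump 1 x| ^+ n)%:E).
  apply/measurable_EFinP; apply: measurable_funX; apply: measurableT_comp => //.
  exact: test_function_measurable.
apply/eqP => I0.
have : (\int[leb]_x `|(`|annular_bump 1 x| ^+ n)%:E| = 0)%E.
  by rewrite -[RHS]I0; apply: eq_integral => x _; rewrite gee0_abs// lee_fin exprn_ge0.
move=> /(ae_eq_integral_abs leb measurableT mN)[A [mA A0 NA]].
pose v := @unit_volume R n; have v0 : 0 < v := unit_volume_gt0.
have mI : measurable (`]v, v * 2 ^+ n[%classic : set (measurableTypeR R)) by exact: measurable_itv.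
have v2 : v < v * 2 ^+ n by rewrite ltr_pMr// exprn_egt1 ?ltr1n// -lt0n.
have sub : volume_rad @^-1` `]v, v * 2 ^+ n[%classic `<=` A.
  move=> x /=; rewrite in_itv/= /volume_rad -/v => /andP[h1 h2].
  apply: NA => /= /(_ I) [] /eqP; rewrite expf_eq0 n0/= normr_eq0.
  apply/negP; rewrite gt_eqF//; apply: smooth_bump_gt0 => //.
  have e0 := enorm_ge0 x; rewrite mul1r.
  have x1 : 1 < enorm x.
    by rewrite -(@ltr_pXn2r _ n)// ?nnegrE// expr1n -(ltr_pM2l v0) mulr1.
  have x2 : enorm x < 2 by rewrite -(@ltr_pXn2r _ n)// ?nnegrE// -(ltr_pM2l v0).
  by rewrite expr2; apply/andP; split; nra.
have : leb (volume_rad @^-1` `]v, v * 2 ^+ n[%classic) = 0%E.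
  apply: subset_measure0 A0 => //.
  rewrite -[X in measurable X]setTI; exact: (measurable_volume_rad measurableT (measurable_itv _)).
rewrite (lebesgue_volume_rad n0 mI) setIidl; last first.
  by move=> t /=; rewrite !in_itv/= andbT => /andP[/ltW h _]; exact: le_trans (ltW v0) h.
rewrite lebesgue_measure_itv/= lte_fin v2 -EFinB => -[] /eqP.
by rewrite subr_eq0 gt_eqF.
Qed.

Lemma annular_bump_Lnorm c : 0 < c ->
  (\int[leb]_x (`|annular_bump c x| ^+ n)%:E =
   (c ^- n)%:E * \int[leb]_x (`|annular_bump 1 x| ^+ n)%:E)%E.
Proof.
move=> c0.
transitivity (\int[leb]_x (`|annular_bump 1 (c *: x)| ^+ n)%:E)%E.
  by apply: eq_integral => x _; rewrite (annular_bump_scale _ (ltW c0)).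
apply: (ge0_integral_rV_scale (f := fun x => (`|annular_bump 1 x| ^+ n)%:E)) => //.
apply/measurable_EFinP; apply: measurable_funX; apply: measurableT_comp => //.
by apply: test_function_measurable; exact: test_function_annular_bump.
Qed.

(* The exponent equals the dimension, so the gradient norm is scale invariant. *)
Lemma annular_bump_grad_norm c : 0 < c ->
  (\int[leb]_x (enorm (\row_i partial i (annular_bump c) x) ^+ n)%:E =
   \int[leb]_x (enorm (\row_i partial i (annular_bump 1) x) ^+ n)%:E)%E.
Proof.
move=> c0.
pose g (x : 'rV[R]_n) := (enorm (\row_i partial i (annular_bump 1) x) ^+ n)%:E.
have mg : measurable_fun setT g.
  apply/measurable_EFinP; apply: measurable_funX.
  apply: (measurableT_comp (@measurable_enorm R n)); apply: measurable_fun_rV => i.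
  under eq_fun do rewrite mxE.
  apply: test_function_measurable; apply: test_function_partial.
  exact: test_function_annular_bump.
have g0 x : (0 <= g x)%E by rewrite lee_fin exprn_ge0// enorm_ge0.
transitivity (\int[leb]_x ((c ^+ n)%:E * g (c *: x)))%E.
  apply: eq_integral => x _; rewrite /g -EFinM -exprMn -enormZ ?(ltW c0)//.
  congr (enorm _ ^+ _)%:E; apply/rowP => i; rewrite !mxE.
  exact: partial_annular_bump.
rewrite -[RHS]/(\int[leb]_x g x)%E; move: g mg g0 => g mg g0.
have cn0 : (0 <= (c ^+ n)%:E)%E by rewrite lee_fin exprn_ge0// ltW.
have mgc : measurable_fun setT (fun x => g (c *: x)).
  exact: (measurableT_comp mg (measurable_rV_scale c)).
have -> := ge0_integralZl leb measurableT mgc (fun x _ => g0 (c *: x)) cn0.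
have -> := ge0_integral_rV_scale c0 mg g0.
rewrite muleA -EFinM divff ?mul1e//.
by rewrite expf_neq0// gt_eqF.
Qed.

End annular_bump.

(** * Sums of functions with disjoint supports, and weak convergence *)

Section finite_sums.

(** At most one term of the sum is nonzero. The abstract [nrm] covers both the absolute value of the
    functions and the Euclidean norm of their gradients. *)
Lemma exprn_sum_disjoint {R : realType} {V : zmodType} (nrm : V -> R) (F : nat -> V)
    (s : seq nat) N : (0 < N)%N -> nrm 0 = 0 -> (forall y, 0 <= nrm y) -> uniq s ->
  (forall j k, j != k -> F j = 0 \/ F k = 0) ->
  nrm (\sum_(k <- s) F k) ^+ N <= \sum_(k <- s) nrm (F k) ^+ N.
Proof.
move=> N0 nrm0 nrm_ge0 us FF.
have s0 : 0 <= \sum_(k <- s) nrm (F k) ^+ N by apply: sumr_ge0 => k _; rewrite exprn_ge0.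
have [/hasP[k ks Fk]|/hasPn H] := boolP (has (fun k => F k != 0) s).
  have Fj j : j != k -> F j = 0 by move=> /FF[]// Fk0; rewrite Fk0 eqxx in Fk.
  rewrite [in leLHS](bigD1_seq k)//= big1 ?addr0// (bigD1_seq k)//= lerDl.
  by apply: sumr_ge0 => j _; rewrite exprn_ge0.
rewrite big1_seq ?nrm0 ?expr0n ?gtn_eqF// => k /= ks.
by apply/eqP; have := H k ks; rewrite negbK.
Qed.

Lemma uniq_seq_of_infinite (P : nat -> Prop) : (forall m, exists2 k, (m <= k)%N & P k) ->
  forall m, exists s : seq nat, [/\ uniq s, size s = m & forall k, k \in s -> P k].
Proof.
move=> HP; elim=> [|m [s [us ss Ps]]]; first by exists [::].
have [k sk Pk] := HP (\max_(j <- s) j).+1.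
exists (k :: s); split => /=; last 2 first.
- by rewrite ss.
- by move=> j; rewrite inE => /predU1P[->//|]; exact: Ps.
rewrite us andbT; apply/negP => ks; move: sk.
by rewrite ltnNge (big_rem k)//= leq_maxl.
Qed.

End finite_sums.

Section test_gradient.
Context {R : realType} {n : nat}.
Local Notation leb := (@lebesgue_rV R n).
Implicit Types u v : 'rV[R]_n -> R.

Definition gradient u (x : 'rV[R]_n) : 'rV[R]_n := \row_i partial i u x.

Lemma gradientDZ (a : R) u v x : test_function u -> test_function v ->
  gradient (fun x => a * u x + v x) x = a *: gradient u x + gradient v x.
Proof.
move=> tu tv; apply/rowP => i; rewrite !mxE; apply: derive_partial.
exact: (is_deriveD (is_deriveZ a (is_derive_partial i x tu)) (is_derive_partial i x tv)).
Qed.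

Lemma gradient0 x : gradient (cst 0) x = 0.
Proof. by apply/rowP => i; rewrite !mxE; apply: derive_partial. Qed.

Lemma gradientZ (a : R) u x : test_function u ->
  gradient (fun x => a * u x) x = a *: gradient u x.
Proof.
move=> tu; have := gradientDZ a x tu test_function0; rewrite gradient0 addr0 => <-.
by congr (gradient _ x); apply/funext => y; rewrite /= addr0.
Qed.

Lemma test_function_sum (s : seq nat) (e : nat -> R) (u : nat -> 'rV[R]_n -> R) :
  (forall k, test_function (u k)) ->
  test_function (fun x => \sum_(k <- s) e k * u k x) /\
  forall x, gradient (fun x => \sum_(k <- s) e k * u k x) x =
            \sum_(k <- s) e k *: gradient (u k) x.
Proof.
move=> tu; elim: s => [|k s [ts gs]].
  rewrite (_ : (fun x => _) = cst 0); last by apply/funext => x; rewrite big_nil.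
  by split => [|x]; [exact: test_function0|rewrite gradient0 big_nil].
rewrite (_ : (fun x => _) = (fun x => e k * u k x + \sum_(j <- s) e j * u j x)); last first.
  by apply/funext => x; rewrite big_cons.
split=> [|x]; first by apply: test_functionD => //; exact: test_functionZ.
by rewrite gradientDZ// gs big_cons.
Qed.

Lemma enorm0 : enorm (0 : 'rV[R]_n) = 0.
Proof. by rewrite -(scale0r (0 : 'rV[R]_n)) enormZ// mul0r. Qed.

Lemma continuous_gradient_norm u : test_function u ->
  continuous (fun x => enorm (gradient u x)).
Proof.
move=> tu x; apply: (@continuous_comp _ _ _ (fun x => \sum_(i < n) gradient u x ord0 i ^+ 2)
   (@Num.sqrt R)); last exact: sqrt_continuous.
have : Ck (fun i : 'I_n => delta_mx ord0 i : 'rV[R]_n) 0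
    (fun y : 'rV[R]_n => \sum_(i < n) (partial i u y * partial i u y)).
  apply: Ck_sum => j.
  by apply: CkM; apply: (@test_function_Ck _ _ (partial j u)); exact: test_function_partial.
case=> H _; have -> : (fun x => \sum_(i < n) gradient u x ord0 i ^+ 2) =
    (fun y : 'rV[R]_n => \sum_(i < n) (partial i u y * partial i u y)).
  by apply/funext => y; apply: eq_bigr => i _; rewrite mxE expr2.
exact: H.
Qed.

Lemma gradient_norm_lty N u : (0 < N)%N -> test_function u ->
  (\int[leb]_x (enorm (gradient u x) ^+ N)%:E < +oo)%E.
Proof.
move=> N0 tu; have cg := continuous_gradient_norm tu.
have [_ [M M0 u0]] := (test_functionP u).1 tu.
have g0 x : M < `|x| -> enorm (gradient u x) ^+ N = 0.
  move=> xM; rewrite (_ : gradient u x = 0) ?enorm0 ?expr0n ?gtn_eqF//.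
  apply/rowP => i; rewrite !mxE /partial (near_eq_derive (g := cst (0:R))) ?derive_cst//.
  near=> y; rewrite u0//; near: y; exact: (cvgr_gt _ (@norm_continuous _ _ x)).
have cgN : continuous (fun x => enorm (gradient u x) ^+ N).
  move=> x; apply: (@continuous_comp _ _ _ (fun x => enorm (gradient u x))
    (fun t : R => t ^+ N)); [exact: cg|exact: exprn_continuous].
have /integrableP[_] := continuous_support_integrable cgN g0.
by under eq_integral do rewrite /= ger0_norm ?exprn_ge0 ?enorm_ge0//.
Unshelve. all: by end_near. Qed.

(** At each point at most one summand contributes to the value and to the gradient, so N-th powers
    add up and the energy grows linearly in the number of functions. *)
Lemma W1_energy_disjoint_sum N (s : seq nat) (e : nat -> R) (u : nat -> 'rV[R]_n -> R) :
  (0 < N)%N -> (forall k, test_function (u k)) ->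
  (forall k, W1_energy N%:R (u k) = 1%E) -> (forall k, `|e k| <= 1) -> uniq s ->
  (forall x j k, j != k -> u j x = 0 /\ gradient (u j) x = 0 \/
                           u k x = 0 /\ gradient (u k) x = 0) ->
  (W1_energy N%:R (fun x => \sum_(k <- s) e k * u k x)%R <= (size s)%:R%:E)%E.
Proof.
move=> N0 tu u1 e1 us dis; have [ts gs] := test_function_sum s e tu.
have mg f : test_function f -> measurable_fun setT (fun x => (enorm (gradient f x) ^+ N)%:E).
  move=> tf; apply/measurable_EFinP; apply: measurable_funX.
  by apply: continuous_measurable_rV; exact: continuous_gradient_norm.
have mf (f : 'rV[R]_n -> R) : test_function f ->
    measurable_fun setT (fun x => (`|f x| ^+ N)%:E).
  move=> tf; apply/measurable_EFinP; apply: measurable_funX.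
  by apply: measurableT_comp => //; exact: test_function_measurable.
have g0 f x : (0 <= (enorm (gradient f x) ^+ N)%:E)%E.
  by rewrite lee_fin exprn_ge0// enorm_ge0.
have f0 (f : 'rV[R]_n -> R) x : (0 <= (`|f x| ^+ N)%:E)%E by rewrite lee_fin exprn_ge0.
rewrite W1_energy_test// -/(gradient _).
have -> : (size s)%:R%:E = (\sum_(k <- s) W1_energy N%:R (u k))%E.
  under eq_bigr do rewrite u1.
  by rewrite sumEFin big_const_seq count_predT iter_addr_0.
under eq_bigr do rewrite W1_energy_test//.
rewrite big_split/=.
have <- := ge0_integral_sum leb measurableT (fun k => mg _ (tu k)) (fun k x _ => g0 (u k) x) s.
have <- := ge0_integral_sum leb measurableT (fun k => mf _ (tu k)) (fun k x _ => f0 (u k) x) s.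
apply: leeD; apply: ge0_le_integral => //.
- by move=> x _; exact: g0.
- exact: mg.
- by apply: emeasurable_sum => k; exact: mg.
- move=> x _; rewrite sumEFin lee_fin -/(gradient _ _) gs.
  apply: (@le_trans _ _ (\sum_(k <- s) enorm (e k *: gradient (u k) x) ^+ N)).
    apply: exprn_sum_disjoint => //; [exact: enorm0|exact: enorm_ge0|].
    by move=> j k /(dis x)[[_ ->]|[_ ->]]; [left|right]; rewrite scaler0.
  apply: ler_sum => k _; apply: lerXn2r; rewrite ?nnegrE ?enorm_ge0//.
  have -> : enorm (e k *: gradient (u k) x) = `|e k| * enorm (gradient (u k) x).
    rewrite -enormZ// /enorm; congr Num.sqrt; apply: eq_bigr => i _.
    by rewrite !mxE !exprMn real_normK ?num_real.
  by rewrite ler_piMl// enorm_ge0.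
- exact: mf.
- by apply: emeasurable_sum => k; exact: mf.
- move=> x _; rewrite sumEFin lee_fin.
  apply: (@le_trans _ _ (\sum_(k <- s) `|e k * u k x| ^+ N)).
    apply: (@exprn_sum_disjoint _ _ (fun y : R => `|y|)) => //; first exact: normr0.
    by move=> j k /(dis x)[[-> _]|[-> _]]; [left|right]; rewrite mulr0.
  apply: ler_sum => k _; apply: lerXn2r; rewrite ?nnegrE//.
  by rewrite normrM ler_piMl.
Qed.

(* Normalised functions with disjoint supports converge weakly to 0: otherwise
   m of them, added with the right signs, give an element of norm at most
   m^(1/N) on which the functional is at least of order m. *)
Lemma weak_cvg_disjoint N (u : nat -> 'rV[R]_n -> R) :
  (2 <= N)%N -> (forall k, test_function (u k)) ->
  (forall k, W1_energy N%:R (u k) = 1%E) ->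
  (forall x j k, j != k -> u j x = 0 /\ gradient (u j) x = 0 \/
                           u k x = 0 /\ gradient (u k) x = 0) ->
  W1_weak_cvg N%:R u (cst 0).
Proof.
move=> N2 tu u1 dis l [llin [C lC]]; have N0 : (0 < N)%N by exact: leq_trans N2.
have Wt (f : 'rV[R]_n -> R) : test_function f -> W1 N%:R f by exact: test_function_W1.
have l0 : l (cst 0) = 0.
  have := llin 1 _ _ (Wt _ test_function0) (Wt _ test_function0).
  rewrite (_ : (fun x => _) = cst 0); last by apply/funext => x; rewrite /= mulr0 addr0.
  by move=> h; lra.
rewrite l0; apply/cvgrPdist_lt => eps eps0; apply: contrapT => Hn.
have inf m : exists2 k, (m <= k)%N & eps <= `|l (u k)|.
  apply: contrapT => H; apply: Hn; exists m => // k /= mk.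
  rewrite sub0r normrN ltNge; apply/negP => h; apply: H; by exists k.
pose e k := Num.sg (l (u k)).
have e1 k : `|e k| <= 1 by rewrite normr_sg lern1; case: (_ != _).
have lsum s : l (fun x => \sum_(k <- s) e k * u k x) = \sum_(k <- s) `|l (u k)|.
  elim: s => [|k s IH].
    rewrite big_nil -[RHS]l0; congr l; by apply/funext => x; rewrite big_nil.
  rewrite big_cons -IH.
  rewrite (_ : (fun x => _) = (fun x => e k * u k x + \sum_(j <- s) e j * u j x));
    last first.
    by apply/funext => x; rewrite big_cons.
  have [ts _] := test_function_sum s e tu.
  rewrite llin; [|exact: Wt|exact: Wt].
  by rewrite /e -normrEsg.
(* The constant in [W1_dual] carries no sign; its absolute value can be raised to powers
   monotonically. *)
pose C' := `|C|.
have bound m : (0 < m)%N -> (m%:R * eps) ^+ N <= C' ^+ N * m%:R.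
  move=> m0; have [s [us sm Ps]] := uniq_seq_of_infinite inf m.
  have [ts _] := test_function_sum s e tu.
  have h1 : m%:R * eps <= \sum_(k <- s) `|l (u k)|.
    rewrite -sm mulr_natl -iter_addr_0 -(count_predT s) -big_const_seq.
    rewrite big_seq [leRHS]big_seq; apply: ler_sum => k ks; exact: Ps.
  have h2 := lC _ (Wt _ ts); rewrite lsum in h2.
  have en := W1_energy_disjoint_sum N0 tu u1 e1 us dis; rewrite sm in en.
  have S0 : 0 <= \sum_(k <- s) `|l (u k)| by apply: sumr_ge0.
  rewrite ger0_norm// /W1_norm in h2.
  have h3 : (C%:E * W1_energy N%:R (fun x => \sum_(k <- s) e k * u k x)%R `^ N%:R^-1 <=
      (C' * m%:R `^ N%:R^-1)%:E)%E.
    rewrite EFinM; apply: le_trans (lee_wpmul2r _ (_ : (C%:E <= C'%:E)%E)) _.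
    - exact: poweR_ge0.
    - by rewrite lee_fin ler_norm.
    - apply: lee_wpmul2l; first by rewrite lee_fin normr_ge0.
      rewrite -poweR_EFin; apply: gt0_ler_poweR => //.
      + by rewrite in_itv/= leey andbT adde_ge0// ?poweR_ge0.
      + by rewrite in_itv/= leey andbT lee_fin.
  have h4 : m%:R * eps <= C' * m%:R `^ N%:R^-1.
    by apply: le_trans h1 _; rewrite -lee_fin; exact: le_trans h2 h3.
  have -> : C' ^+ N * m%:R = (C' * m%:R `^ N%:R^-1) ^+ N.
    rewrite exprMn -[X in _ = _ * X]powR_mulrn ?powR_ge0// -powRrM mulVf ?powRr1//.
    by rewrite pnatr_eq0 -lt0n.
  apply: lerXn2r h4; rewrite ?nnegrE ?mulr_ge0 ?powR_ge0 ?ler0n ?normr_ge0 ?(ltW eps0)//.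
have epsN : 0 < eps ^+ N by rewrite exprn_gt0.
(* The bound reads [m^N eps^N <= C'^N m]. As [N >= 2] gives [m^N >= m^2], it fails as soon as
   [m > C'^N / eps^N]. *)
pose m := (Num.truncn (C' ^+ N / eps ^+ N)).+1.
have mb := truncnS_gt (C' ^+ N / eps ^+ N); rewrite -/m in mb.
have := bound m isT; apply/negP; rewrite -ltNge.
rewrite ltr_pdivrMr// in mb.
have m1 : 1 <= m%:R :> R by rewrite ler1n.
rewrite exprMn; apply: (@lt_le_trans _ _ (m%:R * eps ^+ N * m%:R)).
  by rewrite ltr_pM2r// ltr0n.
rewrite mulrAC ler_wpM2r ?(ltW epsN)// -expr2.
exact: ler_weXn2l.
Qed.

End test_gradient.

(** * The dilated and normalised bumps *)

Section vanishing_sequence.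
Context {R : realType} {N : nat} (N2 : (2 <= N)%N).
Local Notation leb := (@lebesgue_rV R N).
Implicit Types (x : 'rV[R]_N) (k : nat).

Let N0 : (0 < N)%N. Proof. exact: leq_trans N2. Qed.
Let bump : 'rV[R]_N -> R := annular_bump 1.
Let bump_test : test_function bump. Proof. exact: test_function_annular_bump. Qed.

Definition bump_mass : R := fine (\int[leb]_x (`|annular_bump 1 x| ^+ N)%:E).

Definition bump_dirichlet : R :=
  fine (\int[leb]_x (enorm (gradient (annular_bump 1) x) ^+ N)%:E).

Lemma bump_massE : (\int[leb]_x (`|annular_bump 1 x| ^+ N)%:E = bump_mass%:E)%E.
Proof.
rewrite fineK// ge0_fin_numE.
  by have [] := (in_LpP _ N0).1 (test_function_in_Lp N0 bump_test).
by apply: integral_ge0 => x _; rewrite lee_fin exprn_ge0.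
Qed.

Lemma bump_dirichletE :
  (\int[leb]_x (enorm (gradient (annular_bump 1) x) ^+ N)%:E = bump_dirichlet%:E)%E.
Proof.
rewrite fineK// ge0_fin_numE; first exact: gradient_norm_lty.
by apply: integral_ge0 => x _; rewrite lee_fin exprn_ge0// enorm_ge0.
Qed.

Lemma bump_mass_gt0 : 0 < bump_mass.
Proof. by rewrite -lte_fin -bump_massE annular_bump_Lnorm_gt0. Qed.

Lemma bump_dirichlet_ge0 : 0 <= bump_dirichlet.
Proof.
rewrite -lee_fin -bump_dirichletE.
by apply: integral_ge0 => x _; rewrite lee_fin exprn_ge0// enorm_ge0.
Qed.

Let scale k : R := (4 ^+ k)^-1.
Let scale_gt0 k : 0 < scale k. Proof. by rewrite invr_gt0 exprn_gt0. Qed.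

(** The energy of the bump dilated by [4^k]: the gradient part is scale invariant and the mass is
    multiplied by [4^(kN)]. *)
Definition spread_energy k : R := bump_dirichlet + (4 ^+ k) ^+ N * bump_mass.

Lemma spread_energy_gt0 k : 0 < spread_energy k.
Proof.
by rewrite ltr_wpDl ?bump_dirichlet_ge0// mulr_gt0 ?bump_mass_gt0// !exprn_gt0.
Qed.

Definition spread_weight k : R := (spread_energy k)^-1 `^ N%:R^-1.

Lemma spread_weight_ge0 k : 0 <= spread_weight k.
Proof. exact: powR_ge0. Qed.

Lemma spread_weightX k : spread_weight k ^+ N = (spread_energy k)^-1.
Proof.
rewrite -powR_mulrn ?powR_ge0// -powRrM mulVf ?powRr1//.
  by rewrite invr_ge0 ltW// spread_energy_gt0.
by rewrite pnatr_eq0 -lt0n.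
Qed.

Definition spread_seq k x : R := spread_weight k * annular_bump (4 ^+ k)^-1 x.

Lemma test_function_spread_seq k : test_function (spread_seq k).
Proof. by apply: test_functionZ; exact: test_function_annular_bump. Qed.

Lemma spread_seq_Lnorm k : (\int[leb]_x (`|spread_seq k x| ^+ N)%:E =
  ((spread_energy k)^-1 * ((4 ^+ k) ^+ N * bump_mass))%:E)%E.
Proof.
have mb : measurable_fun setT (fun x => (`|annular_bump (4 ^+ k)^-1 x| ^+ N)%:E).
  apply/measurable_EFinP; apply: measurable_funX; apply: measurableT_comp => //.
  by apply: test_function_measurable; exact: test_function_annular_bump.
have b0 x : (0 <= (`|annular_bump (4 ^+ k)^-1 x| ^+ N)%:E)%E.
  by rewrite lee_fin exprn_ge0.
have w0 : (0 <= (spread_weight k ^+ N)%:E)%E.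
  by rewrite lee_fin exprn_ge0// spread_weight_ge0.
transitivity (\int[leb]_x ((spread_weight k ^+ N)%:E *
    (`|annular_bump (4 ^+ k)^-1 x| ^+ N)%:E))%E.
  apply: eq_integral => x _.
  by rewrite -EFinM -exprMn /spread_seq normrM (ger0_norm (spread_weight_ge0 k)).
have -> := ge0_integralZl leb measurableT mb (fun x _ => b0 x) w0.
have -> := @annular_bump_Lnorm R N _ (scale_gt0 k).
by rewrite bump_massE spread_weightX -!EFinM exprVn invrK.
Qed.

Lemma spread_seq_grad_norm k :
  (\int[leb]_x (enorm (gradient (spread_seq k) x) ^+ N)%:E =
   ((spread_energy k)^-1 * bump_dirichlet)%:E)%E.
Proof.
have tb : test_function (annular_bump (4 ^+ k)^-1 : 'rV[R]_N -> R).
  exact: test_function_annular_bump.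
have mb : measurable_fun setT
    (fun x => (enorm (gradient (annular_bump (4 ^+ k)^-1) x) ^+ N)%:E).
  apply/measurable_EFinP; apply: measurable_funX.
  by apply: continuous_measurable_rV; exact: continuous_gradient_norm.
have b0 x : (0 <= (enorm (gradient (annular_bump (4 ^+ k)^-1) x) ^+ N)%:E)%E.
  by rewrite lee_fin exprn_ge0// enorm_ge0.
have w0 : (0 <= (spread_weight k ^+ N)%:E)%E.
  by rewrite lee_fin exprn_ge0// spread_weight_ge0.
transitivity (\int[leb]_x ((spread_weight k ^+ N)%:E *
    (enorm (gradient (annular_bump (4 ^+ k)^-1) x) ^+ N)%:E))%E.
  apply: eq_integral => x _.
  by rewrite -EFinM -exprMn gradientZ// enormZ// spread_weight_ge0.
have -> := ge0_integralZl leb measurableT mb (fun x _ => b0 x) w0.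
have -> : (\int[leb]_x (enorm (gradient (annular_bump (4 ^+ k)^-1) x) ^+ N)%:E =
    bump_dirichlet%:E)%E.
  by rewrite -bump_dirichletE; exact: (annular_bump_grad_norm (scale_gt0 k)).
by rewrite spread_weightX -EFinM.
Qed.

Lemma spread_seq_energy k : W1_energy N%:R (spread_seq k) = 1%E.
Proof.
rewrite (W1_energy_test N0 (test_function_spread_seq k)).
rewrite [X in (X + _)%E](spread_seq_grad_norm k) spread_seq_Lnorm -EFinD -mulrDr.
by rewrite mulVf// gt_eqF// spread_energy_gt0.
Qed.

(** The k-th function and its gradient vanish off the closed annulus [4^k <= |x| <= 2 * 4^k], and
    [2 * 4^k < 4^(k+1)]. *)
Lemma spread_seq_disjoint x j k : j != k ->
  spread_seq j x = 0 /\ gradient (spread_seq j) x = 0 \/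
  spread_seq k x = 0 /\ gradient (spread_seq k) x = 0.
Proof.
have out i : ~~ (1 <= (4 ^+ i)^-1 * enorm x <= 2) ->
    spread_seq i x = 0 /\ gradient (spread_seq i) x = 0.
  move=> h; split; first by rewrite /spread_seq (annular_bump_out (ltW (scale_gt0 i)))// mulr0.
  rewrite gradientZ; last exact: test_function_annular_bump.
  rewrite (_ : gradient _ x = 0) ?scaler0//; apply/rowP => l; rewrite !mxE.
  exact: (partial_annular_bump_out l (scale_gt0 i)).
have lt_out i l : (i < l)%N -> 1 <= (4 ^+ l)^-1 * enorm x ->
    ~~ (1 <= (4 ^+ i)^-1 * enorm x <= 2).
  move=> il; rewrite mulrC ler_pdivlMr ?exprn_gt0// mul1r => h.
  rewrite negb_and -!ltNge; apply/orP; right.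
  rewrite mulrC ltr_pdivlMr ?exprn_gt0//; apply: lt_le_trans h.
  have : 4 ^+ i.+1 <= 4 ^+ l :> R by rewrite ler_weXn2l// ler1n.
  have : 0 < 4 ^+ i :> R by rewrite exprn_gt0.
  rewrite exprS; lra.
wlog jk : j k / (j < k)%N.
  move=> H; rewrite neq_ltn => /orP[jk|kj].
    by apply: H => //; rewrite neq_ltn jk.
  by apply/or_comm/H => //; rewrite neq_ltn kj.
move=> _; have [h|/negP h] := boolP (1 <= (4 ^+ k)^-1 * enorm x <= 2); last first.
  by right; apply: out; apply/negP.
by left; apply/out/(lt_out j k jk); have /andP[] := h.
Qed.

Lemma spread_seq_weak_cvg : W1_weak_cvg N%:R spread_seq (cst 0).
Proof.
apply: weak_cvg_disjoint => //.
- exact: test_function_spread_seq.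
- exact: spread_seq_energy.
- exact: spread_seq_disjoint.
Qed.

Lemma spread_seq_radial k : radially_symmetric (spread_seq k).
Proof.
exists (fun t => spread_weight k * smooth_bump 1 1 4 (((4 ^+ k)^-1 * t) ^+ 2)).
  apply: measurable_funM => //.
  apply: (measurableT_comp (f := smooth_bump 1 1 4)).
    by apply: continuous_measurable_fun; case: (Ck_smooth_bump 0 1 1 (4 : R)).
  by apply: measurable_funX; exact: measurable_funM.
by apply: aeW.
Qed.

Lemma near_exprn4_ge (r : R) : \forall k \near \oo, r <= 4 ^+ k.
Proof.
exists (Num.truncn r).+1 => // k /= rk; have := truncnS_gt r => /ltW/le_trans; apply.
apply: (@le_trans _ _ k%:R); first by rewrite ler_nat.
by rewrite -natrX ler_nat ltnW// ltn_expl.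
Qed.

Lemma spread_seq_eball r : \forall k \near \oo, forall x, eball r x -> spread_seq k x = 0.
Proof.
near=> k => x; rewrite /eball/= => xr.
rewrite /spread_seq (annular_bump_out (ltW (scale_gt0 k))) ?mulr0//.
rewrite negb_and -!ltNge mulrC ltr_pdivrMr ?exprn_gt0// mul1r.
apply/orP; left; apply: lt_le_trans xr _; near: k; exact: near_exprn4_ge.
Unshelve. all: by end_near. Qed.

Lemma spread_energy_large (r : R) : \forall k \near \oo, r <= spread_energy k.
Proof.
near=> k; apply: (@le_trans _ _ (4 ^+ k * bump_mass)).
  rewrite -ler_pdivrMr ?bump_mass_gt0//; near: k; exact: near_exprn4_ge.
apply: (@le_trans _ _ ((4 ^+ k) ^+ N * bump_mass)).
  by rewrite ler_pM2r ?bump_mass_gt0// ler_eXnr// exprn_ege1// ler1n.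
by rewrite lerDr bump_dirichlet_ge0.
Unshelve. all: by end_near. Qed.

Lemma spread_weight_small (d : R) : 0 < d -> \forall k \near \oo, spread_weight k <= d.
Proof.
move=> d0; near=> k.
rewrite -(@ler_pXn2r _ N)// ?nnegrE ?spread_weight_ge0 ?(ltW d0)// spread_weightX.
rewrite invf_ple ?posrE ?spread_energy_gt0 ?exprn_gt0//.
near: k; exact: spread_energy_large.
Unshelve. all: by end_near. Qed.

(** The right-hand side is 1 minus the gradient share [bump_dirichlet / spread_energy k] of the unit
    energy, and [spread_energy] is unbounded. *)
Lemma spread_seq_Lnorm_near1 (e : R) : 0 < e -> \forall k \near \oo,
  1 - e <= (spread_energy k)^-1 * ((4 ^+ k) ^+ N * bump_mass).
Proof.
move=> e0; near=> k; have E0 := spread_energy_gt0 k.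
have -> : (4 ^+ k) ^+ N * bump_mass = spread_energy k - bump_dirichlet.
  by rewrite /spread_energy addrC addKr.
rewrite mulrBr mulVf ?gt_eqF// lerD2l lerN2 mulrC ler_pdivrMr//.
rewrite mulrC -ler_pdivrMr//; near: k; exact: spread_energy_large.
Unshelve. all: by end_near. Qed.

End vanishing_sequence.

Section spread_RNVS.
Context {R : realType} {N : nat} {beta : R} {F : R -> R}.
Hypothesis N2 : (2 <= N)%N.
Hypothesis hF : F_conditions N beta F.
Local Notation leb := (@lebesgue_rV R N).
Local Notation spread := (@spread_seq R N).

Let N0 : (0 < N)%N. Proof. exact: leq_trans N2. Qed.

(** The vanishing condition holds trivially for large indices: the supports leave every ball, and
    [F 0 = 0]. *)
Lemma spread_seq_RNVS : RNVS beta F spread.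
Proof.
split.
- by move=> k; apply: test_function_W1 => //; exact: test_function_spread_seq.
- exact: spread_seq_radial.
- exact: spread_seq_energy.
- exact: spread_seq_weak_cvg.
move=> r r0; apply: cvg_near_cst; near=> k.
have u0 : forall x, eball r x -> spread k x = 0 by near: k; exact: spread_seq_eball.
rewrite /F_integral integral0_eq// => x xr.
by rewrite u0// (F0 N2 hF) mulr0.
Unshelve. all: by end_near. Qed.

(** For nonzero [beta] the integrand is nonnegative and the bound is 0. For [beta = 0] the functions
    are uniformly small, so [F] is comparable with [C_F N F] times the N-th power, whose integral
    tends to 1. *)
Lemma spread_seq_limn_esup_ge :
  ((if beta == 0%R then (C_F N F)%:E else 0) <=
   limn_esup (fun k => F_integral beta F setT (spread k)))%E.
Proof.
have mF k := measurable_F_integrand hF (test_function_measurable (@test_function_spread_seq R N k)).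
have F00 k x : (0 <= (enorm x `^ (- (N%:R * beta)) * F (spread k x))%:E)%E.
  by rewrite lee_fin mulr_ge0 ?powR_ge0 ?(F_ge0 hF).
case: eqVneq => [b0|_]; last first.
  apply: limn_esup_ge_near; near=> k; exact: integral_ge0.
apply/lee_addgt0Pr => e e0.
have C0 := C_F_ge0 N2 hF.
(* With mass [m] between [1 - e'] and 1, the loss [C_F N F * (1 - m) + e' * m] is at most
   [e' * (C_F N F + 1) = e]; adding 1 avoids division by zero. *)
pose e' : R := e / (C_F N F + 1).
have e'0 : 0 < e' by rewrite divr_gt0//; lra.
have e'E : e' * (C_F N F + 1) = e by rewrite divfK// gt_eqF//; lra.
have [d d0 Fd] := F_near0 N2 hF e'0.
rewrite -leeBlDr//; apply: limn_esup_ge_near; near=> k.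
have w0 := @spread_weight_ge0 R N k.
have ud x : `|spread k x| <= d.
  rewrite normrM (ger0_norm w0) (ger0_norm (annular_bump_ge0 _ _)).
  apply: (@le_trans _ _ (@spread_weight R N k)).
    by rewrite ler_piMr// annular_bump_le1.
  by near: k; exact: spread_weight_small.
have : 1 - e' <= (@spread_energy R N k)^-1 * ((4 ^+ k) ^+ N * @bump_mass R N).
  by near: k; exact: spread_seq_Lnorm_near1.
set m := (X in _ <= X) => m1.
have m2 : m <= 1.
  rewrite /m mulrC ler_pdivrMr ?mul1r ?spread_energy_gt0//.
  by rewrite lerDr bump_dirichlet_ge0.
have mu : measurable_fun setT (fun x => (`|spread k x| ^+ N)%:E).
  apply/measurable_EFinP; apply: measurable_funX; apply: measurableT_comp => //.
  by apply: test_function_measurable; exact: test_function_spread_seq.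
have u0 x : (0 <= (`|spread k x| ^+ N)%:E)%E by rewrite lee_fin exprn_ge0.
have uE := @spread_seq_Lnorm R N N2 k; rewrite -/m in uE.
(* The lower estimate for [F] is written with [e'] moved to the other side, since [C_F N F - e'] may
   be negative and only nonnegative integrands are handled. *)
have : (\int[leb]_x ((C_F N F)%:E * (`|spread k x| ^+ N)%:E) <=
    \int[leb]_x ((enorm x `^ (- (N%:R * beta)) * F (spread k x))%:E +
                  e'%:E * (`|spread k x| ^+ N)%:E))%E.
  apply: ge0_le_integral => //.
  - by move=> x _; rewrite mule_ge0.
  - exact: emeasurable_funM.
  - by apply: emeasurable_funD => //; exact: emeasurable_funM.
  - move=> x _; rewrite b0 mulr0 oppr0 powRr0 mul1r -!EFinM -EFinD lee_fin.
    by have /andP[h _] := Fd _ (ud x); rewrite -lerBlDr -mulrBl.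
have e'0' : (0 <= e'%:E)%E by rewrite lee_fin ltW.
have C0' : (0 <= (C_F N F)%:E)%E by rewrite lee_fin.
have meu : measurable_fun setT (fun x => (e'%:E * (`|spread k x| ^+ N)%:E)%E).
  exact: emeasurable_funM.
have eu0 x : (0 <= e'%:E * (`|spread k x| ^+ N)%:E)%E by rewrite mule_ge0.
have -> := ge0_integralD leb measurableT (fun x _ => F00 k x) (mF k) (fun x _ => eu0 x) meu.
have -> := ge0_integralZl leb measurableT mu (fun x _ => u0 x) C0'.
have -> := ge0_integralZl leb measurableT mu (fun x _ => u0 x) e'0'.
rewrite uE -!EFinM -leeBlDr// -EFinB; apply: le_trans.
rewrite -EFinB lee_fin -e'E mulrDr mulr1.
have : C_F N F * (1 - m) + e' * m <= C_F N F * e' + e' * 1.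
  by apply: lerD; [apply: ler_wpM2l => //; lra|apply: ler_wpM2l => //; lra].
lra.
Unshelve. all: by end_near. Qed.

End spread_RNVS.

Theorem theorem1p4 (R : realType) (N : nat) (beta : R) (F : R -> R)
    (N_ge2 : (2 <= N)%N) (beta01 : 0 <= beta < 1)
    (hF : F_conditions N beta F) :
  d_nvl N beta F = if beta == 0 then (C_F N F)%:E else 0%E.
Proof.
apply/eqP; rewrite eq_le; apply/andP; split.
  by apply: ge_ereal_sup => _ [u ru <-]; exact: (RNVS_limn_esup_le N_ge2 beta01 hF).
apply: le_trans (spread_seq_limn_esup_ge N_ge2 hF) _.
apply: ereal_sup_ubound; exists (@spread_seq R N) => //.
exact: spread_seq_RNVS.
Qed.
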